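(* Let $m\ge1$ and $n\geq 4$ be integers, let $P_d(f)$ denote an algebraic differential polynomial in $f$ of degree $d\leq n-3$, and let $p_1$ and $p_2$ be two non-zero polynomials in $\mathbb{C}^m$. Suppose $\alpha=(\alpha_{11},\ldots,\alpha_{1m})\in\mathbb{C}^m$ and $\beta=(\alpha_{21},\ldots,\alpha_{2m})\in\mathbb{C}^m$ are such that $\alpha_{1i}\neq 0$, $\alpha_{2i}\neq 0$ and $\alpha_{1i}/\alpha_{2i}\notin\mathbb{Q}$ for all $i\in\{1,\ldots,m\}$. Then the equation $$f^n(z)+P_d(f(z))=p_1(z)e^{\langle\alpha,\overline{z}\rangle}+p_2(z)e^{\langle\beta,\overline{z}\rangle}$$ has no transcendental entire solutions $f$ in $\mathbb{C}^m$.
   Context: Notation: for $\gamma=(\gamma_1,\ldots,\gamma_m)\in\mathbb{C}^m$ and $z=(z_1,\ldots,z_m)\in\mathbb{C}^m$, $\langle\gamma,\overline{z}\rangle=\sum_{k=1}^m\gamma_k z_k$. For a multi-index $I=(i_1,\ldots,i_m)\in\mathbb{Z}_{\ge 0}^m$, $\partial^I=\frac{\partial^{|I|}}{\partial z_1^{i_1}\cdots\partial z_m^{i_m}}$ with $|I|=i_1+\cdots+i_m$. Algebraic differential polynomial: given distinct multi-indices $\nu_1,\ldots,\nu_N\in\mathbb{Z}_{\geq 0}^m$ with $0<|\nu_1|\le\cdots\le|\nu_N|$, an algebraic differential polynomial in $f$ is a finite sum $P_d(f)=\sum_{i\in I}c_i\, f^{i_0}(\partial^{\nu_1}(f))^{i_1}\cdots(\partial^{\nu_N}(f))^{i_N}$,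 where $I$ is a finite set of distinct elements $i=(i_0,\ldots,i_N)\in\mathbb{Z}_{\ge 0}^{N+1}$ and the coefficients $c_i$ are polynomials in $z\in\mathbb{C}^m$. Its degree is $d=\max_{i\in I}(i_0+i_1+\cdots+i_N)$. An entire function in $\mathbb{C}^m$ is a holomorphic function $\mathbb{C}^m\to\mathbb{C}$; it is transcendental if it is not a polynomial. *)

(* Defs.v *)
From HB Require Import structures.
From mathcomp Require Import all_boot all_order all_algebra.
From mathcomp Require Import finmap.
From mathcomp Require Import complex.
From mathcomp.multinomials Require Import -(notations) mpoly.
From mathcomp Require Import boolp classical_sets functions reals topology
  normedtype sequences derive exp trigo.

Set Implicit Arguments.
Unset Strict Implicit.
Unset Printing Implicit Defensive.

Import Order.TTheory GRing.Theory Num.Theory.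
Import numFieldNormedType.Exports.

Local Open Scope ring_scope.
Local Open Scope complex_scope.

Definition cexp (R : realType) (z : R[i]) : R[i] :=
  (expR (complex.Re z))%:C * (cos (complex.Im z) +i* sin (complex.Im z)).

(* The bilinear (conjugate-free) sum, written <gamma, conj z> for the
   Hermitian product. *)
Definition dotc (R : realType) (m : nat) (c z : 'rV[R[i]]_m) : R[i] :=
  \sum_(k < m) c 0 k * z 0 k.

Definition evalp (R : realType) (m : nat) (p : mpoly m R[i])
  (z : 'rV[R[i]]_m) : R[i] := meval (fun k => z 0 k) p.

(* R[i]^o carries the structure of a normed space over the field R[i], so
   differentiability below is Frechet differentiability over the complex
   numbers. *)
Definition entire (R : realType) (m : nat) (f : 'rV[R[i]]_m -> R[i]^o) : Prop :=
  forall z, differentiable f z.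

Definition transcendental (R : realType) (m : nat)
  (f : 'rV[R[i]]_m -> R[i]^o) : Prop :=
  ~ exists p : mpoly m R[i], forall z, f z = evalp p z.

Definition pderiv (R : realType) (m : nat) (k : 'I_m)
  (f : 'rV[R[i]]_m -> R[i]^o) : 'rV[R[i]]_m -> R[i]^o :=
  fun z => 'D_(delta_mx 0 k) f z.

Definition mpderiv (R : realType) (m : nat) (I : multinom m)
  (f : 'rV[R[i]]_m -> R[i]^o) : 'rV[R[i]]_m -> R[i]^o :=
  foldr (fun k g => iter (I k) (pderiv k) g) f (enum 'I_m).

(* An exponent i = (i_0, ..., i_N) is a multinom N.+1: its entry at ord0 is
   the power of f, and its entry at lift ord0 k that of the derivative of f of
   multi-index tnth dp_nu k.  The values of dp_coef outside dp_I are
   irrelevant. *)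
Record diff_poly (R : realType) (m : nat) := DiffPoly {
  dp_N : nat;
  dp_nu : dp_N.-tuple (multinom m);
  dp_nu_uniq : uniq dp_nu;
  dp_nu_gt0 : forall k, (0 < mdeg (tnth dp_nu k))%N;
  dp_nu_sorted : forall j k : 'I_dp_N,
    (j <= k)%N -> (mdeg (tnth dp_nu j) <= mdeg (tnth dp_nu k))%N;
  dp_I : {fset multinom dp_N.+1};
  dp_coef : multinom dp_N.+1 -> mpoly m R[i]
}.

Arguments dp_nu {R m} d.
Arguments dp_coef {R m} d i.

Definition dp_deg (R : realType) (m : nat) (P : diff_poly R m) : nat :=
  \max_(i <- dp_I P) mdeg i.

Definition dp_eval (R : realType) (m : nat) (P : diff_poly R m)
  (f : 'rV[R[i]]_m -> R[i]^o) (z : 'rV[R[i]]_m) : R[i] :=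
  \sum_(i <- dp_I P) evalp (dp_coef P i) z * f z ^+ i ord0 *
    \prod_(k < dp_N P) mpderiv (tnth (dp_nu P) k) f z ^+ i (lift ord0 k).

(* Main.v *)
(* Let H(z) = max(0, Re <alpha, z>, Re <beta, z>), with bilinear brackets.  A
   doubling argument based on Cauchy estimates gives |f| <= poly e^(H / n), hence
   |P(f)| <= poly e^((n - 3) H / n).  On a line in a coordinate direction, with
   t rescaled, the equation becomes F^n + Q = p1 e^t + p2 e^(r t).  If r is not
   real, the right-hand side nearly has simple zeros along a ray on which it
   dominates Q, which an n-th power cannot have.  If r is real, one may assume
   |r| < 1; eliminating the exponentials by differentiation yields entire
   functions whose growth on the two half-planes forces them to vanish, so r > 0
   and F^n = p1 e^t.  This holds on almost all lines, hence
   f^n = p1 e^<alpha, z> and P(f) = p2 e^<beta, z>; as P(f) only involves the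
   exponents j <alpha, z> / n, this contradicts the irrationality of r. *)

Require Import Defs.
From HB Require Import structures.
From mathcomp Require Import all_boot all_order all_algebra.
From mathcomp Require Import finmap.
From mathcomp Require Import complex.
From mathcomp.multinomials Require Import -(notations) mpoly.
From mathcomp Require Import boolp classical_sets functions reals topology
  normedtype sequences derive exp trigo.
From mathcomp Require Import measure lebesgue_measure lebesgue_integral ftc.
From mathcomp Require Import ring lra.

Set Implicit Arguments.
Unset Strict Implicit.
Unset Printing Implicit Defensive.

Import Order.TTheory GRing.Theory Num.Theory.
Import numFieldNormedType.Exports.

Local Open Scope ring_scope.
Local Open Scope complex_scope.

(** * Complex modulus and complex derivatives *)

(** Two obstacles shape the proof. A derivative of [f] is not bounded by [f] at the same point, and
    nothing is known beforehand about the growth of [f], so the growth estimate has to work with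
    balls of shrinking radius. Quotients such as [Q / U] would be meromorphic, so identities are
    multiplied out and only entire functions occur. These are compared by their exponential rates on
    the two half-planes: if the right rate is less than the left rate, then multiplication by a
    suitable exponential makes the function decay away from the imaginary axis, and it vanishes. The
    3 in the degree bound enters as follows. On a line, with [U] the right-hand side,
    [n U F' - U' F = n Q F' - Q' F] has right rate at most [1 - 3/n + 1/n = 1 - 2/n]. For
    [r < 1 - 1/n] the coefficient of [e^t] can be isolated in it, because [F e^(r t)] stays below
    [e^t]. For [r >= 1 - 1/n] the rate [1 - 2/n] lies below [r], and the whole expression
    vanishes. *)

Definition cabs (R : realType) (z : R[i]) : R := Normc.normc z.

Section Modulus.
Context {R : realType}.
Implicit Types (z w : R[i]) (x : R).

Lemma cabs0 : cabs (0 : R[i]) = 0. Proof. exact: Normc.normc0. Qed.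

Lemma cabs1 : cabs (1 : R[i]) = 1. Proof. exact: Normc.normc1. Qed.

Lemma cabs_ge0 z : 0 <= cabs z. Proof. by case: z => a b; apply: sqrtr_ge0. Qed.

Lemma cabsM z w : cabs (z * w) = cabs z * cabs w.
Proof. exact: Normc.normcM. Qed.

Lemma cabsV z : cabs z^-1 = (cabs z)^-1. Proof. exact: Normc.normcV. Qed.

Lemma cabsN z : cabs (- z) = cabs z. Proof. exact: normcN. Qed.

Lemma cabsD z w : cabs (z + w) <= cabs z + cabs w.
Proof. exact: le_normcD. Qed.

Lemma cabsB z w : cabs (z - w) <= cabs z + cabs w.
Proof. by rewrite -(cabsN w); apply: cabsD. Qed.

Lemma cabsBC z w : cabs (z - w) = cabs (w - z).
Proof. by rewrite -cabsN opprB. Qed.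

Lemma cabs_eq0 z : (cabs z == 0) = (z == 0).
Proof.
by apply/eqP/eqP => [/Normc.eq0_normc //|->]; apply: cabs0.
Qed.

Lemma cabs_gt0 z : (0 < cabs z) = (z != 0).
Proof. by rewrite lt_def cabs_ge0 cabs_eq0 andbT. Qed.

Lemma cabsX z n : cabs (z ^+ n) = cabs z ^+ n.
Proof. by elim: n => [|n IH]; rewrite ?expr0 ?cabs1 // !exprS cabsM IH. Qed.

Lemma cabsR x : cabs x%:C = `|x|.
Proof. by rewrite /cabs /= expr0n /= addr0 sqrtr_sqr. Qed.

Lemma normE z : `|z| = (cabs z)%:C.
Proof. by case: z. Qed.

Lemma cabs_Re z : `|complex.Re z| <= cabs z.
Proof.
case: z => a b; rewrite -sqrtr_sqr /=.
by apply: ler_wsqrtr; rewrite lerDl sqr_ge0.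
Qed.

Lemma cabs_Im z : `|complex.Im z| <= cabs z.
Proof.
case: z => a b; rewrite -sqrtr_sqr /=.
by apply: ler_wsqrtr; rewrite lerDr sqr_ge0.
Qed.

Lemma cabs_i : cabs ('i%C : R[i]) = 1.
Proof. by rewrite /cabs /= expr0n /= add0r expr1n sqrtr1. Qed.

Lemma cabs_ReIm z : cabs z <= `|complex.Re z| + `|complex.Im z|.
Proof.
rewrite {1}[z]complexE; apply: le_trans (cabsD _ _) _.
by rewrite cabsM !cabsR cabs_i mul1r.
Qed.

Lemma cabs_subr_ge z w : cabs z - cabs w <= cabs (z - w).
Proof. by rewrite lerBlDr; apply: le_trans (cabsD _ _); rewrite subrK. Qed.

Lemma cabs_sum (I : Type) (r : seq I) (P : pred I) (F : I -> R[i]) :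
  cabs (\sum_(i <- r | P i) F i) <= \sum_(i <- r | P i) cabs (F i).
Proof.
elim/big_rec2: _ => [|i y z _ h]; first by rewrite cabs0.
by apply: le_trans (cabsD _ _) _; rewrite lerD2l.
Qed.

End Modulus.

(** Free of quotients, so [h = 0] is no exception and the rules of differentiation reduce to linear
    inequalities over [R]. *)
Definition cder (R : realType) (f : R[i] -> R[i]) (z l : R[i]) : Prop :=
  forall e : R, 0 < e -> exists2 d : R, 0 < d &
    forall h, cabs h < d -> cabs (f (z + h) - f z - l * h) <= e * cabs h.

Definition hd (R : realType) (f f' : R[i] -> R[i]) : Prop :=
  forall z, cder f z (f' z).

Definition ccont (R : realType) (f : R[i] -> R[i]) (z : R[i]) : Prop :=
  forall e : R, 0 < e -> exists2 d : R, 0 < d &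
    forall h, cabs h < d -> cabs (f (z + h) - f z) <= e.

Section Derivatives.
Context {R : realType}.
Implicit Types (f g : R[i] -> R[i]) (z l : R[i]).

Lemma cder_lip f z l : cder f z l ->
  exists2 d : R, 0 < d &
    forall h, cabs h < d -> cabs (f (z + h) - f z) <= (cabs l + 1) * cabs h.
Proof.
move=> /(_ 1 ltr01) [d d0 H]; exists d => // h /H {}H.
have -> : f (z + h) - f z = (f (z + h) - f z - l * h) + l * h by ring.
apply: le_trans (cabsD _ _) _; rewrite cabsM mulrDl mul1r.
by rewrite addrC lerD2l; rewrite mul1r in H.
Qed.

Lemma cder_cont f z l : cder f z l -> ccont f z.
Proof.
move=> /cder_lip [d d0 H] e e0.
have c0 : 0 < cabs l + 1 by have := cabs_ge0 l; lra.
exists (Num.min d (e / (cabs l + 1))); first by rewrite lt_min d0 divr_gt0.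
move=> h; rewrite lt_min => /andP[/H {}H he]; apply: le_trans H _.
by rewrite mulrC -ler_pdivlMr // ltW.
Qed.

Lemma cder_ext f g z l : (forall w, f w = g w) -> cder f z l -> cder g z l.
Proof.
move=> fg H e e0; have [d d0 {}H] := H e e0.
by exists d => // h hd; rewrite -!fg; apply: H.
Qed.

Lemma hd_ext f g f' g' : (forall w, f w = g w) -> (forall w, f' w = g' w) ->
  hd f f' -> hd g g'.
Proof. by move=> fg fg1 H z; rewrite -fg1; apply: (cder_ext fg). Qed.

Lemma cder_cst (c : R[i]) z : cder (fun _ => c) z 0.
Proof.
by move=> e e0; exists 1 => // h _; rewrite mul0r !subrr cabs0 mulr_ge0 ?cabs_ge0 ?ltW.
Qed.

Lemma cder_id z : cder id z 1.
Proof.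
move=> e e0; exists 1 => // h _.
by rewrite mul1r [z + h]addrC addrK subrr cabs0 mulr_ge0 ?cabs_ge0 ?ltW.
Qed.

Lemma cderD f g z l k : cder f z l -> cder g z k ->
  cder (fun w => f w + g w) z (l + k).
Proof.
move=> Hf Hg e e0.
have e2 : 0 < e / 2 by rewrite divr_gt0.
have [d d0 {}Hf] := Hf _ e2; have [d' d'0 {}Hg] := Hg _ e2.
exists (Num.min d d'); first by rewrite lt_min d0.
move=> h; rewrite lt_min => /andP[/Hf {}Hf /Hg {}Hg].
have -> : f (z + h) + g (z + h) - (f z + g z) - (l + k) * h =
  (f (z + h) - f z - l * h) + (g (z + h) - g z - k * h) by ring.
apply: le_trans (cabsD _ _) _; lra.
Qed.

Lemma cderM f g z l k : cder f z l -> cder g z k ->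
  cder (fun w => f w * g w) z (l * g z + f z * k).
Proof.
move=> Hf Hg e e0.
have [d1 d10 Lf] := cder_lip Hf.
have a0 := cabs_ge0 l; have b0 := cabs_ge0 (f z); have c0 := cabs_ge0 (g z).
pose e1 := e / (3 * (1 + cabs l + cabs (f z) + cabs (g z))).
have s0 : 0 < 1 + cabs l + cabs (f z) + cabs (g z) by lra.
have e10 : 0 < e1 by rewrite /e1 divr_gt0 // mulr_gt0.
have [d d0 {}Hf] := Hf _ e10; have Cg := cder_cont Hg.
have [d' d'0 {}Hg] := Hg _ e10; have [d2 d20 {}Cg] := Cg _ e10.
exists (Num.min (Num.min d d') (Num.min d1 d2)).
  by rewrite !lt_min d0 d'0 d10 d20.
move=> h; rewrite !lt_min => /andP[/andP[/Hf {}Hf /Hg {}Hg] /andP[/Lf {}Lf /Cg {}Cg]].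
have -> : f (z + h) * g (z + h) - f z * g z - (l * g z + f z * k) * h =
  (f (z + h) - f z) * (g (z + h) - g z) + (f (z + h) - f z - l * h) * g z
   + f z * (g (z + h) - g z - k * h) by ring.
apply: le_trans (cabsD _ _) _; apply: le_trans (lerD (cabsD _ _) (lexx _)) _.
rewrite !cabsM.
have h0 := cabs_ge0 h.
apply: (@le_trans _ _ ((cabs l + 1) * cabs h * e1 + e1 * cabs h * cabs (g z) + cabs (f z)
  * (e1 * cabs h))).
  apply: lerD; first apply: lerD.
  - by apply: ler_pM => //; apply: cabs_ge0.
  - by apply: ler_wpM2r.
  - by apply: ler_wpM2l.
have -> : e * cabs h = 3 * (1 + cabs l + cabs (f z) + cabs (g z)) * e1 * cabs h.
  by rewrite /e1; field; rewrite gt_eqF.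
have e1h : 0 <= e1 * cabs h by apply: mulr_ge0 (ltW e10) h0.
have := mulr_ge0 e1h a0.
have := mulr_ge0 e1h b0.
have := mulr_ge0 e1h c0.
lra.
Qed.

Lemma cder_comp f g z l k : cder f (g z) l -> cder g z k ->
  cder (fun w => f (g w)) z (l * k).
Proof.
move=> Hf Hg e e0.
have [d1 d10 Lg] := cder_lip Hg.
have a0 := cabs_ge0 l; have b0 := cabs_ge0 k.
have s0 : 0 < 1 + cabs l + cabs k by lra.
pose e1 := e / (2 * (1 + cabs l + cabs k)).
have e10 : 0 < e1 by rewrite /e1 divr_gt0 // mulr_gt0.
have [d d0 {}Hf] := Hf _ e10; have [d' d'0 {}Hg] := Hg _ e10.
exists (Num.min (Num.min d1 d') (d / (cabs k + 1))).
  by rewrite !lt_min d10 d'0 divr_gt0 //; lra.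
move=> h; rewrite !lt_min => /andP[/andP[/Lg {}Lg /Hg {}Hg] hd].
have h0 := cabs_ge0 h.
have k1 : 0 < cabs k + 1 by lra.
have {}Hf := Hf (g (z + h) - g z).
have {}Hf : cabs (f (g (z + h)) - f (g z) - l * (g (z + h) - g z)) <=
    e1 * cabs (g (z + h) - g z).
  have -> : g (z + h) = g z + (g (z + h) - g z) by ring.
  rewrite [_ + _ - g z]addrAC subrr add0r; apply: Hf; apply: le_lt_trans Lg _.
  by rewrite mulrC -ltr_pdivlMr.
have -> : f (g (z + h)) - f (g z) - l * k * h =
  (f (g (z + h)) - f (g z) - l * (g (z + h) - g z))
    + l * (g (z + h) - g z - k * h) by ring.
apply: le_trans (cabsD _ _) _; rewrite [cabs (l * _)]cabsM.
apply: (@le_trans _ _ (e1 * ((cabs k + 1) * cabs h) + cabs l * (e1 * cabs h))).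
  apply: lerD; last exact: ler_wpM2l.
  by apply: le_trans Hf _; apply: ler_wpM2l => //; exact: ltW.
have -> : e * cabs h = 2 * (1 + cabs l + cabs k) * e1 * cabs h.
  by rewrite /e1; field; rewrite gt_eqF.
have e1h : 0 <= e1 * cabs h by apply: mulr_ge0 (ltW e10) h0.
have := mulr_ge0 e1h a0.
have := mulr_ge0 e1h b0.
lra.
Qed.

Lemma cderZ (c : R[i]) f z l : cder f z l -> cder (fun w => c * f w) z (c * l).
Proof.
move=> Hf; have := cderM (cder_cst c z) Hf; rewrite mul0r add0r; exact.
Qed.

Lemma cderB f g z l k : cder f z l -> cder g z k ->
  cder (fun w => f w - g w) z (l - k).
Proof.
move=> Hf Hg; have := cderD Hf (cderZ (-1) Hg); rewrite mulN1r.
by apply: cder_ext => w; rewrite mulN1r.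
Qed.

Lemma cderX f z l n : cder f z l ->
  cder (fun w => f w ^+ n) z (n%:R * f z ^+ n.-1 * l).
Proof.
move=> Hf; case: n => [|n] /=.
  by rewrite !mul0r; apply: cder_ext (cder_cst 1 z) => w; rewrite expr0.
elim: n => [|n IH].
  by rewrite expr0 !mul1r; apply: cder_ext Hf => w; rewrite expr1.
have := cderM Hf IH; have -> : l * f z ^+ n.+1 + f z * (n.+1%:R * f z ^+ n * l) =
  n.+2%:R * f z ^+ n.+1 * l by rewrite -[n.+2]addn1 natrD exprS; ring.
by apply: cder_ext => w; rewrite [RHS]exprS.
Qed.

Lemma cder_shift f (a c z l : R[i]) : cder f (a + c * z) l ->
  cder (fun w => f (a + c * w)) z (l * c).
Proof.
move=> H.
have Hg : cder (fun w => a + c * w) z c.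
  have := cderD (cder_cst a z) (cderZ c (cder_id z)).
  by rewrite add0r mulr1; apply.
exact: (@cder_comp f (fun w => a + c * w) z l c H Hg).
Qed.

Lemma cder_uniq f z l k : cder f z l -> cder f z k -> l = k.
Proof.
move=> Hl Hk; apply/eqP; rewrite -subr_eq0 -cabs_eq0; apply/eqP.
apply/eqP; rewrite eq_le cabs_ge0 andbT leNgt; apply/negP => c0.
have e0 : 0 < cabs (l - k) / 4 by rewrite divr_gt0.
have [d d0 {}Hl] := Hl _ e0; have [d' d'0 {}Hk] := Hk _ e0.
pose m := Num.min d d' / 2.
have mm0 : 0 < Num.min d d' by rewrite lt_min d0.
have m0 : 0 < m by rewrite divr_gt0.
have mE : cabs (m%:C : R[i]) = m by rewrite cabsR ger0_norm // ltW.
have md : m < Num.min d d' by rewrite /m; lra.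
move: md; rewrite lt_min => /andP[md md'].
have := Hl m%:C; have := Hk m%:C; rewrite mE => /(_ md') {}Hk /(_ md) {}Hl.
have : cabs ((l - k) * m%:C) <= cabs (l - k) / 4 * m + cabs (l - k) / 4 * m.
  have -> : (l - k) * m%:C = (f (z + m%:C) - f z - k * m%:C)
    - (f (z + m%:C) - f z - l * m%:C) by ring.
  by apply: le_trans (cabsB _ _) _; apply: lerD.
rewrite cabsM mE -mulrDl ler_pM2r //; lra.
Qed.

Lemma hd_uniq f f' g' : hd f f' -> hd f g' -> forall z, f' z = g' z.
Proof. by move=> H K z; apply: cder_uniq (H z) (K z). Qed.

End Derivatives.

(** * Primitives and Goursat's theorem *)

Definition rder (R : realType) (f : R -> R[i]) (x : R) (l : R[i]) : Prop :=
  forall e : R, 0 < e -> exists2 d : R, 0 < d &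
    forall h : R, `|h| < d -> cabs (f (x + h) - f x - l * h%:C) <= e * `|h|.

Section Paths.
Context {R : realType}.
Implicit Types (phi : R -> R[i]).

Lemma rder_ext phi psi x l : (forall y, phi y = psi y) ->
  rder phi x l -> rder psi x l.
Proof.
move=> fg H e e0; have [d d0 {}H] := H e e0.
by exists d => // h hd; rewrite -!fg; apply: H.
Qed.

Lemma rder_line (f : R[i] -> R[i]) (a v l : R[i]) (x : R) :
  cder f (a + v * x%:C) l -> rder (fun y => f (a + v * y%:C)) x (l * v).
Proof.
move=> /cder_shift H e e0; have [d d0 {}H] := H e e0.
exists d => // h hd; have := H h%:C; rewrite !cabsR rmorphD; exact.
Qed.

Lemma rderB phi psi x l k : rder phi x l -> rder psi x k ->
  rder (fun y => phi y - psi y) x (l - k).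
Proof.
move=> Hf Hg e e0; have e2 : 0 < e / 2 by rewrite divr_gt0.
have [d d0 {}Hf] := Hf _ e2; have [d' d'0 {}Hg] := Hg _ e2.
exists (Num.min d d'); first by rewrite lt_min d0.
move=> h; rewrite lt_min => /andP[/Hf {}Hf /Hg {}Hg].
have -> : phi (x + h) - psi (x + h) - (phi x - psi x) - (l - k) * h%:C =
  (phi (x + h) - phi x - l * h%:C) - (psi (x + h) - psi x - k * h%:C) by ring.
apply: le_trans (cabsB _ _) _; lra.
Qed.

(** Rolle's theorem fails for complex values. The bound is proved with slack [e] in the slope: the
    set of points where it holds contains its supremum, and points beyond the supremum as long as
    this is below [b]. *)
Lemma path_mvi phi phi' (a b M : R) : a <= b ->
  (forall x, a <= x -> x <= b -> rder phi x (phi' x)) ->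
  (forall x, a <= x -> x <= b -> cabs (phi' x) <= M) ->
  cabs (phi b - phi a) <= M * (b - a).
Proof.
move=> ab D B.
have ba0 : 0 <= b - a by rewrite subr_ge0.
suff H e : 0 < e -> cabs (phi b - phi a) <= (M + e) * (b - a).
  apply/ler_addgt0Pr => e e0.
  have c0 : 0 < b - a + 1 by lra.
  apply: le_trans (H (e / (b - a + 1)) (divr_gt0 e0 c0)) _.
  rewrite mulrDl lerD2l mulrAC ler_pdivrMr // ler_pM2l //; lra.
move=> e0.
pose S := [set x | a <= x <= b /\ cabs (phi x - phi a) <= (M + e) * (x - a)]%classic.
have Sa : S a by split; rewrite ?lexx // !subrr cabs0 mulr0.
have hS : has_sup S.
  by split; [exists a | exists b => x [/andP[]]].
pose s := sup S.
have as_ : a <= s by apply: ub_le_sup => //; case: hS.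
have sb : s <= b by apply: ge_sup; [exists a | move=> x [/andP[]]].
have [d d0 Hd] := D s as_ sb e e0.
have M1 h : `|h| < d -> cabs (phi (s + h) - phi s) <= (M + e) * `|h|.
  move=> /Hd {}Hd.
  have -> : phi (s + h) - phi s =
     (phi (s + h) - phi s - phi' s * h%:C) + phi' s * h%:C by ring.
  apply: le_trans (cabsD _ _) _; rewrite [cabs (_ * _)]cabsM cabsR mulrDl addrC.
  by apply: lerD => //; apply: ler_wpM2r => //; apply: B.
have Ss : S s.
  split; first by rewrite as_.
  have [x [/andP[ax xb] Sx] sx] := sup_adherent d0 hS.
  have xs : x <= s by apply: ub_le_sup; [case: hS | split; [rewrite ax|]].
  have := M1 (x - s); rewrite distrC ger0_norm ?subr_ge0 // => /(_ ltac:(rewrite /s; lra)).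
  rewrite [s + _]addrC subrK cabsBC => H1.
  have -> : phi s - phi a = (phi s - phi x) + (phi x - phi a) by ring.
  have -> : (M + e) * (s - a) = (M + e) * (s - x) + (M + e) * (x - a) by ring.
  by apply: le_trans (cabsD _ _) _; apply: lerD.
have [sb'|bs] := ltP s b; last first.
  have bsE : b = s by apply: le_anti; rewrite bs sb.
  by rewrite bsE; case: Ss.
pose h := Num.min (d / 2) (b - s).
have h0 : 0 < h by rewrite lt_min divr_gt0 //= subr_gt0.
have hd : h <= d / 2 by rewrite ge_min lexx.
have hb : h <= b - s by rewrite ge_min lexx orbT.
have := M1 h; rewrite gtr0_norm // => /(_ ltac:(lra)) H1.
have : s + h <= s.
  apply: ub_le_sup; first by case: hS.
  split; first by apply/andP; split; lra.
  have -> : phi (s + h) - phi a = (phi (s + h) - phi s) + (phi s - phi a) by ring.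
  have -> : (M + e) * (s + h - a) = (M + e) * h + (M + e) * (s - a) by ring.
  by apply: le_trans (cabsD _ _) _; apply: lerD => //; case: Ss.
lra.
Qed.

Lemma path_mvi_dist phi phi' (a b M : R) :
  (forall x, rder phi x (phi' x)) ->
  (forall x, `|x - a| <= `|b - a| -> cabs (phi' x) <= M) ->
  cabs (phi b - phi a) <= M * `|b - a|.
Proof.
move=> D B; have [ab|/ltW ba] := leP a b.
  rewrite ger0_norm ?subr_ge0 //; apply: (path_mvi ab (fun x _ _ => D x)) => x ax xb.
  by apply: B; rewrite !ger0_norm ?subr_ge0 //; lra.
rewrite cabsBC distrC ger0_norm ?subr_ge0 //;
  apply: (path_mvi ba (fun x _ _ => D x)) => x ax xb.
by apply: B; rewrite !ler0_norm ?subr_le0 //; lra.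
Qed.

Lemma mvi (f f' : R[i] -> R[i]) (z h : R[i]) (M : R) : hd f f' ->
  (forall x : R, 0 <= x -> x <= 1 -> cabs (f' (z + h * x%:C)) <= M) ->
  cabs (f (z + h) - f z) <= M * cabs h.
Proof.
move=> D B.
have := @path_mvi (fun y => f (z + h * y%:C)) (fun y => f' (z + h * y%:C) * h)
  0 1 (M * cabs h) ler01 (fun x _ _ => rder_line (D _)).
rewrite mulr1 mulr0 addr0 subr0 mulr1; apply => x x0 x1.
by rewrite cabsM; rewrite ler_wpM2r ?cabs_ge0 // B.
Qed.

Lemma is_derive_eps (f : R -> R) (x l : R) : derivable f x 1 -> derive1 f x = l ->
  forall e, 0 < e -> exists2 d : R, 0 < d &
    forall h, `|h| < d -> `|f (x + h) - f x - l * h| <= e * `|h|.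
Proof.
move=> Df Dl e e0.
have /cvgrPdist_le /(_ e e0) : ((fun h : R => h^-1 *: (f (h *: (1 : R) + x) - f x))%R @
  0^' --> l)%classic.
  by rewrite -Dl derive1E; exact: Df.
rewrite near_withinE => -[d /= d0 H]; exists d => // h hd.
have [->|h0] := eqVneq h 0; first by rewrite addr0 subrr mulr0 subr0 normr0 mulr0.
have := H h; rewrite /= sub0r normrN => /(_ hd h0).
rewrite [h *: 1]mulr1 [h + x]addrC => H1.
have -> : f (x + h) - f x - l * h = - ((l - h^-1 *: (f (x + h) - f x)) * h).
  by rewrite /GRing.scale /=; field.
by rewrite normrN normrM; apply: ler_wpM2r.
Qed.

Lemma real_primitive_local (g : R -> R) (M : R) : continuous g -> 0 < M ->
  exists G : R -> R, forall x, - M < x -> x < M ->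
  forall e, 0 < e -> exists2 d : R, 0 < d &
    forall h, `|h| < d -> `|G (x + h) - G x - g x * h| <= e * `|h|.
Proof.
move=> gc M0; pose mu := @lebesgue_measure R.
have gi : mu.-integrable `[- M, M]%classic (constructive_ereal.EFin \o g).
  apply: continuous_compact_integrable; first exact: segment_compact.
  by apply: continuous_subspaceT => x; exact: gc.
eexists=> x Mx xM.
have [D1 D2] := @continuous_FTC1_closed R g (- M) x M xM gi Mx (gc x).
exact: is_derive_eps D1 D2.
Qed.

Lemma real_primitive_complex_local (f : R -> R[i]) (M : R) :
  (forall x e, 0 < e -> exists2 d : R, 0 < d &
    forall h : R, `|h| < d -> cabs (f (x + h) - f x) <= e) -> 0 < M ->
  exists F : R -> R[i], forall x, - M < x -> x < M -> rder F x (f x).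
Proof.
move=> fc M0.
have cRe : continuous (fun x => complex.Re (f x)).
  move=> x; apply/cvgrPdist_le => e /= e0; have [d d0 H] := fc x e e0.
  exists d => //= y yd; have := H (y - x); rewrite [x + _]addrC subrK distrC => /(_ yd).
  by apply: le_trans; rewrite distrC; have := cabs_Re (f y - f x); rewrite raddfB.
have cIm : continuous (fun x => complex.Im (f x)).
  move=> x; apply/cvgrPdist_le => e /= e0; have [d d0 H] := fc x e e0.
  exists d => //= y yd; have := H (y - x); rewrite [x + _]addrC subrK distrC => /(_ yd).
  by apply: le_trans; rewrite distrC; have := cabs_Im (f y - f x); rewrite raddfB.
have [G HG] := real_primitive_local cRe M0.
have [K HK] := real_primitive_local cIm M0.
exists (fun x => G x +i* K x) => x Mx xM e e0.
have e2 : 0 < e / 2 by rewrite divr_gt0.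
have [d d0 Hd] := HG x Mx xM _ e2; have [d' d'0 Hd'] := HK x Mx xM _ e2.
exists (Num.min d d'); first by rewrite lt_min d0.
move=> h; rewrite lt_min => /andP[/Hd {}Hd /Hd' {}Hd'].
apply: le_trans (cabs_ReIm _) _.
case: (f x) Hd Hd' => a b /= Hd Hd'.
rewrite !(mulr0, mul0r, subr0, add0r, addr0); lra.
Qed.

(** Integration gives primitives on the intervals [(- M, M)] only. Normalised to vanish at 0, they
    agree wherever two of them are defined. *)
Lemma real_primitive_complex (f : R -> R[i]) :
  (forall x e, 0 < e -> exists2 d : R, 0 < d &
    forall h : R, `|h| < d -> cabs (f (x + h) - f x) <= e) ->
  exists F : R -> R[i], forall x, rder F x (f x).
Proof.
move=> fc.
have /choice [F HF] : forall M : R, exists F : R -> R[i], 0 < M ->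
    forall x, - M < x -> x < M -> rder F x (f x).
  move=> M; have [M0|_] := ltP 0 M; last by exists (fun=> 0).
  by have [F HF] := real_primitive_complex_local fc M0; exists F.
have FE M N y : `|y| < M -> M <= N -> F M y - F M 0 = F N y - F N 0.
  move=> yM MN; apply/eqP; rewrite -subr_eq0 -cabs_eq0 eq_le cabs_ge0 andbT.
  have M0 : 0 < M by apply: le_lt_trans yM.
  have /ltr_normlP [y1 y2] := yM.
  have D x : - M < x -> x < M -> rder (fun z => F M z - F N z) x 0.
    move=> x1 x2; rewrite -(subrr (f x)); apply: rderB; first exact: HF.
    by apply: HF; lra.
  have -> : F M y - F M 0 - (F N y - F N 0) = (F M y - F N y) - (F M 0 - F N 0) by ring.
  have [y0|/ltW y0] := leP 0 y.
    have := @path_mvi (fun z => F M z - F N z) (fun=> 0) 0 y 0 y0; rewrite mul0r.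
    apply=> [x x0 xy|x _ _]; last by rewrite cabs0.
    by apply: D; lra.
  have := @path_mvi (fun z => F M z - F N z) (fun=> 0) y 0 0 y0; rewrite mul0r cabsBC.
  apply=> [x x0 xy|x _ _]; last by rewrite cabs0.
  by apply: D; lra.
(* The interval varies with the point, but by [FE] the single radius [|x| + 2] describes this
   function at all points within distance 1 of [x]. *)
exists (fun x => F (`|x| + 1) x - F (`|x| + 1) 0) => x.
have E y : `|y| < `|x| + 2 -> F (`|x| + 2) y - F (`|x| + 2) 0 = F (`|y| + 1) y - F (`|y|
  + 1) 0.
  move=> yx; have [h|/ltW h] := leP (`|y| + 1) (`|x| + 2).
    by rewrite (FE (`|y| + 1) (`|x| + 2)) //; lra.
  by rewrite (FE (`|x| + 2) (`|y| + 1)).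
have /ltr_normlP [x1 x2] : `|x| < `|x| + 2 by lra.
have Dx : rder (F (`|x| + 2)) x (f x) by apply: HF; have := normr_ge0 x; lra.
move=> e e0; have [d d0 H] := Dx e e0.
exists (Num.min d 1); first by rewrite lt_min d0 ltr01.
move=> h; rewrite lt_min => /andP[/H {}H h1].
rewrite -!E; last 2 first.
- lra.
- by have := ler_normD x h; lra.
by move: H; congr (is_true (_ <= _)); congr cabs; ring.
Qed.

End Paths.

Section Goursat.
Context {R : realType}.

Lemma nested_point (u v : nat -> R) :
  (forall n, u n <= u n.+1) -> (forall n, v n.+1 <= v n) ->
  (forall n, u n <= v n) -> exists c, forall n, u n <= c /\ c <= v n.
Proof.
move=> uS vS uv.
have um n k : u n <= u (n + k)%N.
  by elim: k => [|k IH]; rewrite ?addn0 // addnS; apply: le_trans IH (uS _).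
have vm n k : v (n + k)%N <= v n.
  by elim: k => [|k IH]; rewrite ?addn0 // addnS; apply: le_trans (vS _) IH.
have uvnm n m : u n <= v m.
  apply: le_trans (um n m) _; apply: le_trans (uv _) _.
  by rewrite addnC; apply: vm.
exists (sup (range u)) => n; split.
  by apply: ub_le_sup; [exists (v 0%N) => _ [m _ <-] | exists n].
by apply: ge_sup; [exists (u 0%N), 0%N | move=> _ [m _ <-]].
Qed.

(** Compactness by bisection: quarters satisfying [P] shrink to a point, around which small
    rectangles satisfying [P] are excluded. *)
Lemma rectangle_principle (P : R -> R -> R -> R -> Prop) :
  (forall x1 x2 y1 y2, x1 <= x2 -> y1 <= y2 -> P x1 x2 y1 y2 ->
    let xm := (x1 + x2) / 2 in let ym := (y1 + y2) / 2 in
    [\/ P x1 xm y1 ym, P xm x2 y1 ym, P x1 xm ym y2 | P xm x2 ym y2]) ->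
  (forall x0 y0, exists2 d : R, 0 < d & forall x1 x2 y1 y2,
    x1 <= x0 -> x0 <= x2 -> y1 <= y0 -> y0 <= y2 ->
    x2 - x1 + (y2 - y1) < d -> ~ P x1 x2 y1 y2) ->
  forall x1 x2 y1 y2, x1 <= x2 -> y1 <= y2 -> ~ P x1 x2 y1 y2.
Proof.
move=> Hsplit Hloc a1 a2 b1 b2 a12 b12 P0.
pose T := (R * R * (R * R))%type.
pose good (q : T) := [/\ q.1.1 <= q.1.2, q.2.1 <= q.2.2 & P q.1.1 q.1.2 q.2.1 q.2.2].
pose sub (q q' : T) := [/\ [/\ q.1.1 <= q'.1.1, q'.1.2 <= q.1.2,
   q.2.1 <= q'.2.1 & q'.2.2 <= q.2.2], q'.1.2 - q'.1.1 = (q.1.2 - q.1.1) / 2 &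
   q'.2.2 - q'.2.1 = (q.2.2 - q.2.1) / 2].
have /choice [step Hstep] : forall q : T, exists q', good q -> good q' /\ sub q q'.
  move=> [[x1 x2] [y1 y2]].
  have [|ng] := pselect (good ((x1, x2), (y1, y2))); last first.
    by exists ((x1, x2), (y1, y2)) => g; case: ng.
  move=> [/= x12 y12 HP].
  have [H|H|H|H] := Hsplit _ _ _ _ x12 y12 HP.
  - exists ((x1, (x1 + x2) / 2), (y1, (y1 + y2) / 2)) => _.
    by split; split => //=; try split; lra.
  - exists (((x1 + x2) / 2, x2), (y1, (y1 + y2) / 2)) => _.
    by split; split => //=; try split; lra.
  - exists ((x1, (x1 + x2) / 2), ((y1 + y2) / 2, y2)) => _.
    by split; split => //=; try split; lra.
  - exists (((x1 + x2) / 2, x2), ((y1 + y2) / 2, y2)) => _.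
    by split; split => //=; try split; lra.
pose q n := iter n step ((a1, a2), (b1, b2)).
have Gq n : good (q n).
  by elim: n => [//|n IH]; rewrite /q iterS; case: (Hstep _ IH).
have Sq n : sub (q n) (q n.+1).
  by rewrite /q iterS; case: (Hstep _ (Gq n)).
have [x0 Hx] : exists c, forall n, (q n).1.1 <= c /\ c <= (q n).1.2.
  by apply: nested_point => n; [case: (Sq n) => -[] | case: (Sq n) => -[] | case: (Gq n)].
have [y0 Hy] : exists c, forall n, (q n).2.1 <= c /\ c <= (q n).2.2.
  by apply: nested_point => n; [case: (Sq n) => -[] | case: (Sq n) => -[] | case: (Gq n)].
have size n : (q n).1.2 - (q n).1.1 + ((q n).2.2 - (q n).2.1) =
    (a2 - a1 + (b2 - b1)) / 2 ^+ n.
  elim: n => [|n IH]; first by rewrite expr0 divr1.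
  case: (Sq n) => _ -> ->; rewrite -mulrDl IH exprS invfM; ring.
have [d d0 Hd] := Hloc x0 y0.
pose L := a2 - a1 + (b2 - b1).
have [n Hn] : exists n : nat, L / 2 ^+ n < d.
  have [n Hn] : exists n : nat, L / d < n%:R.
    exists (Num.bound `|L / d|); apply: le_lt_trans (ler_norm _) _.
    by apply: archi_boundP.
  exists n; rewrite ltr_pdivrMr ?exprn_gt0 // mulrC -ltr_pdivrMr //.
  apply: lt_le_trans Hn _; rewrite -natrX ler_nat; apply: ltnW; exact: ltn_expl.
case: (Hx n) (Hy n) (Gq n) => x1 x2 [y1 y2] [_ _].
by apply: Hd => //; rewrite size.
Qed.

Variables (f f' : R[i] -> R[i]).
Hypothesis ff' : hd f f'.
Variables (A B : R -> R -> R[i]).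
Hypothesis HA : forall x y, rder (A y) x (f (x +i* y)).
Hypothesis HB : forall x y, rder (B x) y (f (x +i* y) * 'i%C).

(** The integral of [f] along the positively oriented boundary of the rectangle, expressed by
    primitives along the four sides. *)
Let I x1 x2 y1 y2 := (A y1 x2 - A y1 x1) + (B x2 y2 - B x2 y1)
   - (A y2 x2 - A y2 x1) - (B x1 y2 - B x1 y1).

Lemma horizontal_line (g g' : R[i] -> R[i]) x y : hd g g' ->
  rder (fun t => g (t +i* y)) x (g' (x +i* y)).
Proof.
move=> H.
have E (t : R) : 'i%C * y%:C + 1 * t%:C = t +i* y.
  by rewrite mul1r addrC; apply/eqP; rewrite eq_complex /=; apply/andP; split; apply/eqP;
    ring.
have := rder_line (H ('i%C * y%:C + 1 * x%:C)); rewrite E mulr1.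
by apply: rder_ext => t; rewrite E.
Qed.

Lemma vertical_line (g g' : R[i] -> R[i]) x y : hd g g' ->
  rder (fun t => g (x +i* t)) y (g' (x +i* y) * 'i%C).
Proof.
move=> H.
have E (t : R) : x%:C + 'i%C * t%:C = x +i* t.
  by apply/eqP; rewrite eq_complex /=; apply/andP; split; apply/eqP; ring.
have := rder_line (H (x%:C + 'i%C * y%:C)); rewrite E.
by apply: rder_ext => t; rewrite E.
Qed.

(** The affine part [a] of [f] at [z0] has the primitive [P] and contributes nothing. What remains
    is at most [e * s] on the rectangle, [s] being half the perimeter, and the sides have total
    length [2 * s]. *)
Lemma goursat_local x0 y0 (e : R) : 0 < e ->
  exists2 d : R, 0 < d & forall x1 x2 y1 y2,
    x1 <= x0 -> x0 <= x2 -> y1 <= y0 -> y0 <= y2 ->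
    x2 - x1 + (y2 - y1) < d ->
    cabs (I x1 x2 y1 y2) <= 2 * e * (x2 - x1 + (y2 - y1)) ^+ 2.
Proof.
move=> e0; pose z0 := x0 +i* y0.
have [d d0 Hd] := ff' z0 e0; exists d => // x1 x2 y1 y2 X1 X2 Y1 Y2 Hs.
pose s := x2 - x1 + (y2 - y1).
pose a z := f z0 + f' z0 * (z - z0).
pose P z := f z0 * z + f' z0 / 2 * ((z - z0) * (z - z0)).
have DP : hd P a.
  move=> z; have Dz : cder (fun w => w - z0) z 1.
    by have := cderB (cder_id z) (cder_cst z0 z); rewrite subr0.
  have := cderD (cderZ (f z0) (cder_id z)) (cderZ (f' z0 / 2) (cderM Dz Dz)).
  rewrite mulr1; have -> : f z0 + f' z0 / 2 * (1 * (z - z0) + (z - z0) * 1) = a z.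
    by rewrite /a; field.
  exact.
have Ba x y : x1 <= x -> x <= x2 -> y1 <= y -> y <= y2 ->
    cabs (f (x +i* y) - a (x +i* y)) <= e * s.
  move=> xa xb ya yb; pose h := (x +i* y) - z0.
  have hs : cabs h <= s.
    apply: le_trans (cabs_ReIm _) _; rewrite /s; apply: lerD => /=; apply/ler_normlP;
      split; lra.
  have -> : f (x +i* y) - a (x +i* y) = f (z0 + h) - f z0 - f' z0 * h.
    by rewrite /a /h [z0 + _]addrC subrK; ring.
  apply: le_trans (Hd _ _) _; first exact: le_lt_trans hs _.
  by rewrite ler_pM2l.
have S1 y : y1 <= y -> y <= y2 ->
    cabs ((A y x2 - P (x2 +i* y)) - (A y x1 - P (x1 +i* y))) <= e * s * (x2 - x1).
  move=> ya yb.
  apply: (@path_mvi _ (fun x => A y x - P (x +i* y)) (fun x => f (x +i* y) - a (x +i* y))).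
  - lra.
  - by move=> x xa xb; apply: rderB; [exact: HA | exact: horizontal_line].
  - by move=> x xa xb; apply: Ba.
have S2 x : x1 <= x -> x <= x2 ->
    cabs ((B x y2 - P (x +i* y2)) - (B x y1 - P (x +i* y1))) <= e * s * (y2 - y1).
  move=> xa xb.
  apply: (@path_mvi _ (fun y => B x y - P (x +i* y))
    (fun y => f (x +i* y) * 'i%C - a (x +i* y) * 'i%C)).
  - lra.
  - by move=> y ya yb; apply: rderB; [exact: HB | exact: vertical_line].
  - by move=> y ya yb; rewrite -mulrBl cabsM cabs_i mulr1; apply: Ba.
have -> : I x1 x2 y1 y2 = ((A y1 x2 - P (x2 +i* y1)) - (A y1 x1 - P (x1 +i* y1)))
  + ((B x2 y2 - P (x2 +i* y2)) - (B x2 y1 - P (x2 +i* y1)))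
  - ((A y2 x2 - P (x2 +i* y2)) - (A y2 x1 - P (x1 +i* y2)))
  - ((B x1 y2 - P (x1 +i* y2)) - (B x1 y1 - P (x1 +i* y1))).
  by rewrite /I; ring.
apply: le_trans (cabsB _ _) _.
apply: le_trans (lerD (cabsB _ _) (lexx _)) _.
apply: le_trans (lerD (lerD (cabsD _ _) (lexx _)) (lexx _)) _.
have := S1 y1 (lexx _) ltac:(lra); have := S1 y2 ltac:(lra) (lexx _).
have := S2 x1 (lexx _) ltac:(lra); have := S2 x2 ltac:(lra) (lexx _).
rewrite -/s.
have -> : 2 * e * s ^+ 2 = e * s * (x2 - x1) + e * s * (y2 - y1) + e * s * (x2 - x1) + e
  * s * (y2 - y1).
  by rewrite /s; ring.
lra.
Qed.

(** Each quarter has half the perimeter, so the four bounds [2 e (S / 2)^2] add up to [2 e S^2]: if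
    the bound fails on a rectangle, it fails on one of the quarters. *)
Lemma goursat_ordered x1 x2 y1 y2 : x1 <= x2 -> y1 <= y2 -> I x1 x2 y1 y2 = 0.
Proof.
move=> X Y; apply/eqP; rewrite -cabs_eq0 eq_le cabs_ge0 andbT.
pose S x1 x2 y1 y2 := x2 - x1 + (y2 - y1) : R.
suff H e : 0 < e -> cabs (I x1 x2 y1 y2) <= 2 * e * (S x1 x2 y1 y2) ^+ 2.
  apply/ler_addgt0Pr => e e0; rewrite add0r.
  have c0 : 0 < (S x1 x2 y1 y2) ^+ 2 + 1 by have := sqr_ge0 (S x1 x2 y1 y2); lra.
  apply: le_trans (H (e / 2 / ((S x1 x2 y1 y2) ^+ 2 + 1)) _) _; first by rewrite !divr_gt0.
  set c := S x1 x2 y1 y2 ^+ 2 + 1 in c0 *.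
  have -> : 2 * (e / 2 / c) * S x1 x2 y1 y2 ^+ 2 = e * (S x1 x2 y1 y2 ^+ 2 / c).
    by field; rewrite gt_eqF.
  by rewrite ger_pMr // ler_pdivrMr // /c; lra.
move=> e0.
have := @rectangle_principle
  (fun x1 x2 y1 y2 => 2 * e * (S x1 x2 y1 y2) ^+ 2 < cabs (I x1 x2 y1 y2)).
move=> /(_ _ _ x1 x2 y1 y2 X Y) H; rewrite leNgt; apply/negP; apply: H.
- move=> {X Y} {}x1 {}x2 {}y1 {}y2 X Y H xm ym.
  have [h1|h1] := ltP (2 * e * (S x1 xm y1 ym) ^+ 2) (cabs (I x1 xm y1 ym));
    first by constructor 1.
  have [h2|h2] := ltP (2 * e * (S xm x2 y1 ym) ^+ 2) (cabs (I xm x2 y1 ym));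
    first by constructor 2.
  have [h3|h3] := ltP (2 * e * (S x1 xm ym y2) ^+ 2) (cabs (I x1 xm ym y2));
    first by constructor 3.
  constructor 4; rewrite ltNge; apply/negP => h4; move: H; rewrite ltNge => /negP; apply.
  have -> : I x1 x2 y1 y2 = I x1 xm y1 ym + I xm x2 y1 ym + I x1 xm ym y2 + I xm x2 ym y2.
    by rewrite /I; ring.
  apply: le_trans (cabsD _ _) _.
  apply: le_trans (lerD (cabsD _ _) (lexx _)) _.
  apply: le_trans (lerD (lerD (cabsD _ _) (lexx _)) (lexx _)) _.
  have -> : 2 * e * S x1 x2 y1 y2 ^+ 2 = 2 * e * S x1 xm y1 ym ^+ 2 +
     2 * e * S xm x2 y1 ym ^+ 2 + 2 * e * S x1 xm ym y2 ^+ 2 + 2 * e * S xm x2 ym y2 ^+ 2.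
    by rewrite /S /xm /ym; field; rewrite ?pnatr_eq0.
  lra.
- move=> x0 y0; have [d d0 Hd] := goursat_local x0 y0 e0.
  exists d => // {X Y} {}x1 {}x2 {}y1 {}y2 X1 X2 Y1 Y2 Hs.
  by apply/negP; rewrite -leNgt; apply: Hd.
Qed.

Lemma goursat x1 x2 y1 y2 : I x1 x2 y1 y2 = 0.
Proof.
have [X|/ltW X] := leP x1 x2; have [Y|/ltW Y] := leP y1 y2.
- exact: goursat_ordered.
- by rewrite -[RHS]oppr0 -(goursat_ordered X Y) /I; ring.
- by rewrite -[RHS]oppr0 -(goursat_ordered X Y) /I; ring.
- by rewrite -(goursat_ordered X Y) /I; ring.
Qed.

(** The function integrates [f] along the real axis and then vertically. By [goursat] its increment
    from [x + i y] may be computed along the horizontal segment at height [y] followed by a vertical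
    one, and on this path [f] is close to its value at [x + i y]. *)
Lemma primitive_of_sides : hd (fun z => A 0 (complex.Re z) - A 0 0
   + (B (complex.Re z) (complex.Im z) - B (complex.Re z) 0)) f.
Proof.
move=> [x y] e e0 /=.
have e2 : 0 < e / 2 by rewrite divr_gt0.
have [d d0 Hd] := cder_cont (ff' (x +i* y)) e2.
exists (d / 2); first by rewrite divr_gt0.
move=> [p q] hd /=.
have pd : `|p| < d / 2 by apply: le_lt_trans hd; exact: (cabs_Re (p +i* q)).
have qd : `|q| < d / 2 by apply: le_lt_trans hd; exact: (cabs_Im (p +i* q)).
have C u v : `|u - x| <= `|p| -> `|v - y| <= `|q| -> cabs (f (u +i* v) - f (x +i* y)) <=
  e / 2.
  move=> hu hv; have -> : u +i* v = (x +i* y) + ((u - x) +i* (v - y)).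
    by apply/eqP; rewrite eq_complex /=; apply/andP; split; apply/eqP; ring.
  apply: Hd; apply: le_lt_trans (cabs_ReIm _) _ => /=; lra.
have S1 : cabs ((A y (x + p) - f (x +i* y) * (x + p)%:C) - (A y x - f (x +i* y) * x%:C))
  <= e / 2 * `|p|.
  have {3}-> : p = x + p - x by ring.
  apply: (@path_mvi_dist _ (fun u => A y u - f (x +i* y) * u%:C) (fun u => f (u +i* y) -
    f (x +i* y))).
    move=> u; apply: rderB; first exact: HA.
    have := @rder_line _ (fun z => z) 0 (f (x +i* y)) 1 u.
    rewrite mul1r => /(_ (cder_id _)); apply: rder_ext => t; exact: add0r.
  move=> u; rewrite [x + p - x]addrAC subrr add0r => hu; apply: C => //.
  by rewrite subrr normr0.
have S2 : cabs ((B (x + p) (y + q) - f (x +i* y) * 'i%C * (y + q)%:C)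
    - (B (x + p) y - f (x +i* y) * 'i%C * y%:C)) <= e / 2 * `|q|.
  have {3}-> : q = y + q - y by ring.
  apply: (@path_mvi_dist _ (fun v => B (x + p) v - f (x +i* y) * 'i%C * v%:C)
     (fun v => f ((x + p) +i* v) * 'i%C - f (x +i* y) * 'i%C)).
    move=> v; apply: rderB; first exact: HB.
    have := @rder_line _ (fun z => z) 0 (f (x +i* y) * 'i%C) 1 v.
    rewrite mul1r => /(_ (cder_id _)); apply: rder_ext => t; exact: add0r.
  move=> v; rewrite [y + q - y]addrAC subrr add0r => hv; rewrite -mulrBl cabsM cabs_i mulr1.
  by apply: C => //; rewrite [x + p - x]addrAC subrr add0r.
have -> : p +i* q = p%:C + 'i%C * q%:C by rewrite [LHS]complexE.
have Gx : A 0 (x + p) - A 0 x = A y (x + p) - A y x - (B (x + p) y - B (x + p) 0) + (B x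
  y - B x 0).
  apply/eqP; rewrite -subr_eq0; apply/eqP; rewrite -(goursat x (x + p) 0 y) /I; ring.
set lhs := (X in cabs X).
have -> : lhs = ((A y (x + p) - f (x +i* y) * (x + p)%:C) - (A y x - f (x +i* y) * x%:C))
  + ((B (x + p) (y + q) - f (x +i* y) * 'i%C * (y + q)%:C)
    - (B (x + p) y - f (x +i* y) * 'i%C * y%:C)).
  rewrite /lhs; have -> : A 0 (x + p) = A y (x + p) - A y x - (B (x + p) y - B (x + p) 0)
    + (B x y - B x 0) + A 0 x.
    by rewrite -Gx; ring.
  by rewrite !rmorphD; ring.
apply: le_trans (cabsD _ _) _; apply: le_trans (lerD S1 S2) _.
rewrite -mulrDr; have := cabs_Re (p%:C + 'i%C * q%:C); have := cabs_Im (p%:C + 'i%C * q%:C).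
rewrite /= !(mul0r, mulr0, mul1r, addr0, add0r, subr0, oppr0) => hq hp.
rewrite -mulrA ler_pM2l //; lra.
Qed.

End Goursat.

Theorem primitive_exists (R : realType) (f f' : R[i] -> R[i]) :
  hd f f' -> exists F, hd F f.
Proof.
move=> D.
have Cx (y x e : R) : 0 < e -> exists2 d : R, 0 < d &
    forall h : R, `|h| < d -> cabs (f ((x + h) +i* y) - f (x +i* y)) <= e.
  move=> e0; have [d d0 Hd] := cder_cont (D (x +i* y)) e0; exists d => // h hd.
  have -> : (x + h) +i* y = (x +i* y) + h%:C.
    by apply/eqP; rewrite eq_complex /= addr0 !eqxx.
  by apply: Hd; rewrite cabsR.
have Cy (x y e : R) : 0 < e -> exists2 d : R, 0 < d &
    forall h : R, `|h| < d -> cabs (f (x +i* (y + h)) * 'i%C - f (x +i* y) * 'i%C) <= e.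
  move=> e0; have [d d0 Hd] := cder_cont (D (x +i* y)) e0; exists d => // h hd.
  rewrite -mulrBl cabsM cabs_i mulr1.
  have -> : x +i* (y + h) = (x +i* y) + 'i%C * h%:C.
    by apply/eqP; rewrite eq_complex /=; apply/andP; split; apply/eqP; ring.
  by apply: Hd; rewrite cabsM cabs_i mul1r cabsR.
have /choice [A HA] y := real_primitive_complex (fun x e => @Cx y x e).
have /choice [B HB] x := real_primitive_complex (fun y e => @Cy x y e).
by eexists; apply: (@primitive_of_sides R f f' D A B) => x y; [exact: HA | exact: HB].
Qed.

(** * Cauchy estimates *)

Section Cauchy.
Context {R : realType}.
Implicit Types (z w : R[i]).

Lemma cexpD z w : cexp (z + w) = cexp z * cexp w.
Proof.
case: z w => [a b] [c d]; rewrite /cexp /= expRD cosD sinD.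
apply/eqP; rewrite eq_complex /=; apply/andP; split; apply/eqP; ring.
Qed.

Lemma cexp0 : cexp (0 : R[i]) = 1.
Proof. by rewrite /cexp /= expR0 cos0 sin0 mul1r. Qed.

Lemma cexpN z : cexp (- z) * cexp z = 1.
Proof. by rewrite -cexpD addNr cexp0. Qed.

Lemma cexp_neq0 z : cexp z != 0.
Proof.
by apply/eqP => h; have /eqP := cexpN z; rewrite h mulr0 eq_sym oner_eq0.
Qed.

Lemma cabs_cexp z : cabs (cexp z) = expR (complex.Re z).
Proof.
rewrite /cexp cabsM cabsR ger0_norm ?expR_ge0 //.
by rewrite /cabs /= cos2Dsin2 sqrtr1 mulr1.
Qed.

Lemma cexpM_nat z n : cexp (n%:R * z) = cexp z ^+ n.
Proof.
elim: n => [|n IH]; first by rewrite mul0r cexp0 expr0.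
by rewrite -[n.+1]addn1 natrD mulrDl mul1r cexpD IH addn1 exprSr.
Qed.

Lemma cexp_period z : cexp (z + 'i%C * (2 * pi)%:C) = cexp z.
Proof.
rewrite cexpD; have -> : cexp ('i%C * (2 * pi)%:C : R[i]) = 1; last by rewrite mulr1.
have -> : 'i%C * (2 * pi)%:C = 0 +i* (pi *+ 2) :> R[i].
  by apply/eqP; rewrite eq_complex /=; apply/andP; split; apply/eqP; ring.
by rewrite /cexp /= expR0 cos2pi sin2pi mul1r.
Qed.

Lemma cexp_near0 (e : R) : 0 < e -> exists2 d : R, 0 < d &
  forall h : R[i], cabs h < d -> cabs (cexp h - 1 - h) <= e * cabs h.
Proof.
move=> e0.
(* The errors [r1], [t1], [t3] and [t2] below contribute [1 + 3 + 2 + 3 = 9] times [e1]. *)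
have [e1 e10 [e11 e19]] : exists2 e1 : R, 0 < e1 & e1 <= 1 /\ 9 * e1 <= e.
  exists (Num.min (e / 9) 1); first by rewrite lt_min divr_gt0 //= ltr01.
  split; first by rewrite ge_min lexx orbT.
  by rewrite mulrC -ler_pdivlMr // ge_min lexx.
have [d1 d10 H1] : exists2 d : R, 0 < d & forall h : R, `|h| < d -> `|expR h - 1 - h| <=
  e1 * `|h|.
  have [d d0 H] := @is_derive_eps R expR 0 1 ltac:(exact: ex_derive) ltac:(by rewrite
    derive1E derive_val expR0) e1 e10.
  by exists d => // h /H; rewrite add0r expR0 mul1r.
have [d2 d20 H2] : exists2 d : R, 0 < d & forall h : R, `|h| < d -> `|cos h - 1| <= e1 *
  `|h|.
  have [d d0 H] := @is_derive_eps R cos 0 0 ltac:(exact: ex_derive) ltac:(by rewrite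
    derive1E derive_val sin0 oppr0) e1 e10.
  by exists d => // h /H; rewrite add0r cos0 mul0r subr0.
have [d3 d30 H3] : exists2 d : R, 0 < d & forall h : R, `|h| < d -> `|sin h - h| <= e1 *
  `|h|.
  have [d d0 H] := @is_derive_eps R sin 0 1 ltac:(exact: ex_derive) ltac:(by rewrite
    derive1E derive_val cos0) e1 e10.
  by exists d => // h /H; rewrite add0r sin0 mul1r subr0.
exists (Num.min (Num.min d1 d2) (Num.min d3 e1)); first by rewrite !lt_min d10 d20 d30 e10.
move=> [x y]; rewrite !lt_min => /andP[/andP[h1 h2] /andP[h3 h4]].
have hx := cabs_Re (x +i* y); have hy := cabs_Im (x +i* y); rewrite /= in hx hy.
have {}H1 := H1 x (le_lt_trans hx h1).
have {}H2 := H2 y (le_lt_trans hy h2).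
have {}H3 := H3 y (le_lt_trans hy h3).
apply: le_trans (_ : 9 * e1 * cabs (x +i* y) <= _); last by apply: ler_wpM2r => //;
  exact: cabs_ge0.
set A := cabs _ in hx hy h4 *.
apply: le_trans (cabs_ReIm _) _; rewrite /cexp /=.
set r1 := expR x - 1 - x in H1; set r2 := cos y - 1 in H2; set r3 := sin y - y in H3.
have -> : expR x * cos y - 0 * sin y - 1 - x = r1 + (1 + x + r1) * r2.
  by rewrite /r1 /r2; ring.
have -> : expR x * sin y + 0 * cos y - 0 - y = (x + r1) * y + (1 + x + r1) * r3.
  by rewrite /r1 /r3; ring.
have xe : `|x| <= e1 by apply: ltW; apply: le_lt_trans h4.
have re : `|r1| <= e1.
  by apply: le_trans H1 _; rewrite -[leRHS]mulr1 ler_pM2l //; lra.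
have r3' : `|1 + x + r1| <= 3.
  by apply: le_trans (ler_normD _ _) _;
    apply: le_trans (lerD (ler_normD _ _) (lexx _)) _; rewrite normr1; lra.
have t1 : `|(1 + x + r1) * r2| <= 3 * (e1 * `|y|) by rewrite normrM; apply: ler_pM.
have t2 : `|(1 + x + r1) * r3| <= 3 * (e1 * `|y|) by rewrite normrM; apply: ler_pM.
have t3 : `|(x + r1) * y| <= 2 * e1 * `|y|.
  rewrite normrM; apply: ler_wpM2r => //; apply: le_trans (ler_normD _ _) _; lra.
apply: le_trans (lerD (ler_normD _ _) (ler_normD _ _)) _.
have e1x : e1 * `|x| <= e1 * A by rewrite ler_pM2l.
have e1y : e1 * `|y| <= e1 * A by rewrite ler_pM2l.
lra.
Qed.

Lemma cder_cexp z : cder (@cexp R) z (cexp z).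
Proof.
move=> e e0; have c0 : 0 < cabs (cexp z) by rewrite cabs_gt0 cexp_neq0.
have [d d0 H] := cexp_near0 (divr_gt0 e0 c0).
exists d => // h /H {}H; rewrite cexpD.
have -> : cexp z * cexp h - cexp z - cexp z * h = cexp z * (cexp h - 1 - h) by ring.
by rewrite cabsM mulrC -ler_pdivlMr // mulrAC.
Qed.

Lemma cder_cexp_lin (c z : R[i]) :
  cder (fun w => cexp (c * w)) z (c * cexp (c * z)).
Proof.
have := @cder_shift R (@cexp R) 0 c z _ (cder_cexp _); rewrite add0r mulrC.
by apply: cder_ext => w; rewrite add0r.
Qed.

Lemma hd0_cst (f f' : R[i] -> R[i]) : hd f f' -> (forall z, f' z = 0) ->
  forall z w, f z = f w.
Proof.
move=> D E z w; apply/eqP; rewrite -subr_eq0 -cabs_eq0 eq_le cabs_ge0 andbT.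
have := @mvi R f f' w (z - w) 0 D; rewrite mul0r [w + _]addrC subrK.
by apply=> x _ _; rewrite E cabs0.
Qed.

(* A primitive of w |-> f (z + e^w) e^(-w) grows by the same amount along all
   vertical segments of length 2 pi.  Letting Re w tend to -oo identifies this
   amount as 2 pi i f'(z); taking Re w = ln r bounds it. *)
Theorem cauchy_estimate (f f' : R[i] -> R[i]) (z : R[i]) (r M : R) :
  hd f f' -> 0 < r -> (forall h, cabs h = r -> cabs (f (z + h)) <= M) ->
  cabs (f' z) <= M / r.
Proof.
move=> D r0 B.
(* The substitution [h = e^w] turns the Cauchy integral of [f (z + h) / h^2] over a circle about 0
   into the integral of the entire function [g] over a vertical segment. *)
pose g w := f (z + cexp w) * cexp (- w).
have Dm w : cder (fun w => cexp (- w)) w (- cexp (- w)).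
  have := cder_cexp_lin (-1) w; rewrite !mulN1r.
  by apply: cder_ext => v; rewrite mulN1r.
have [g' Dg] : exists g', hd g g'.
  eexists => w; apply: cderM (Dm w).
  apply: (@cder_comp R f (fun w => z + cexp w)); first exact: D.
  exact: cderD (cder_cst z w) (cder_cexp w).
have [G DG] := primitive_exists Dg.
pose t : R[i] := 'i%C * (2 * pi)%:C.
have pi0 : 0 < 2 * pi :> R by rewrite mulr_gt0 // pi_gt0.
have tE : cabs t = 2 * pi by rewrite cabsM cabs_i mul1r cabsR gtr0_norm.
have gper w : g (w + t) = g w.
  have E := cexp_period w; rewrite -/t in E.
  have E' : cexp (- (w + t)) = cexp (- w).
    by rewrite -(cexp_period (- (w + t))) -/t opprD subrK.
  by rewrite /g E E'.
have Cst w w' : G (w + t) - G w = G (w' + t) - G w'.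
  apply: (@hd0_cst (fun w => G (w + t) - G w) (fun w => g (w + t) - g w)).
    move=> v; apply: cderB (DG v).
    have := @cder_shift R G t 1 v _ (DG _); rewrite mulr1 mul1r addrC.
    by apply: cder_ext => u; rewrite mul1r addrC.
  by move=> v; rewrite gper subrr.
have ReL x (c : R) : complex.Re (c%:C + t * x%:C) = c.
  by rewrite /t /=; ring.
have K1 : cabs (G ((ln r)%:C + t) - G (ln r)%:C) <= M / r * cabs t.
  apply: (mvi DG) => x _ _.
  have cr : cabs (cexp ((ln r)%:C + t * x%:C)) = r by rewrite cabs_cexp ReL lnK.
  have cr' : cabs (cexp (- ((ln r)%:C + t * x%:C))) = r^-1.
    by rewrite cabs_cexp raddfN /= -[LHS]/(expR (- complex.Re ((ln r)%:C + t * x%:C)))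
      ReL expRN lnK.
  by rewrite /g cabsM cr' ler_pM2r ?invr_gt0 //; apply: B.
apply/ler_addgt0Pr => e e0.
have [d d0 Hd] := D z e e0.
pose a : R := ln (d / 2).
have K2 : cabs ((G (a%:C + t) - G a%:C) - f' z * t) <= e * cabs t.
  (* A primitive of the first-order Taylor remainder at [z] divided by [e^w]; this quotient has
     modulus at most [e] where [|e^w| = d / 2]. The summand with [f z] is periodic and does not
     affect the increment. *)
  pose G1 w := (G w + f z * cexp (- w)) - f' z * w.
  pose g1 w := (g w + f z * - cexp (- w)) - f' z * 1.
  have D1 : hd G1 g1.
    move=> w; apply: cderB; first by apply: cderD (DG w) _; apply: cderZ.
    exact: cderZ (cder_id w).
  have -> : G (a%:C + t) - G a%:C - f' z * t = G1 (a%:C + t) - G1 a%:C.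
    rewrite /G1; have -> : cexp (- (a%:C + t)) = cexp (- a%:C).
      by rewrite -(cexp_period (- (a%:C + t))) -/t opprD subrK.
    by ring.
  apply: (mvi D1) => x _ _; set w := a%:C + t * x%:C.
  have cr : cabs (cexp w) = d / 2 by rewrite cabs_cexp ReL lnK // posrE divr_gt0.
  have c0 : 0 < cabs (cexp w) by rewrite cr divr_gt0.
  have := Hd (cexp w); rewrite cr => /(_ ltac:(lra)).
  rewrite -ler_pdivrMr ?divr_gt0 //; apply: le_trans.
  rewrite -cr -cabsV -cabsM /g1 /g.
  have -> : cexp (- w) = (cexp w)^-1.
    by apply: (mulIf (cexp_neq0 w)); rewrite cexpN mulVf ?cexp_neq0.
  rewrite le_eqVlt; apply/orP; left; apply/eqP; congr cabs; field; exact: cexp_neq0.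
rewrite -(@ler_pM2r _ (cabs t)) ?tE // -tE -cabsM mulrDl.
have -> : f' z * t = (G (a%:C + t) - G a%:C) - ((G (a%:C + t) - G a%:C) - f' z * t) by ring.
apply: le_trans (cabsB _ _) _; apply: lerD => //.
by rewrite (Cst _ (ln r)%:C).
Qed.

End Cauchy.

(** * Second-order expansions and differentiability of derivatives *)

Section SecondOrder.
Context {R : realType}.
Implicit Types (z h : R[i]).

(** A second derivative is not at hand yet. The Lipschitz bound for [f'] comes from the Cauchy
    estimate for the difference [f (w + h) - f w], itself small by the bound on [f']. *)
Lemma taylor_order2 (f f' : R[i] -> R[i]) z (r M : R) : hd f f' -> 0 < r ->
  (forall h, cabs h <= 3 * r -> cabs (f (z + h)) <= M) ->
  forall h, cabs h <= r ->
  cabs (f (z + h) - f z - f' z * h) <= M / r ^+ 2 * cabs h ^+ 2.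
Proof.
move=> D r0 B.
have B' h : cabs h <= 2 * r -> cabs (f' (z + h)) <= M / r.
  move=> hr; apply: (cauchy_estimate D r0) => k kr; rewrite -addrA; apply: B.
  by apply: le_trans (cabsD _ _) _; rewrite kr; lra.
have L h : cabs h <= r -> cabs (f' (z + h) - f' z) <= M / r ^+ 2 * cabs h.
  move=> hr.
  have D1 : hd (fun w => f (w + h) - f w) (fun w => f' (w + h) - f' w).
    move=> w; apply: cderB (D w).
    have := @cder_shift R f h 1 w _ (D _); rewrite mulr1 mul1r addrC.
    by apply: cder_ext => u; rewrite mul1r addrC.
  have -> : M / r ^+ 2 * cabs h = M / r * cabs h / r by field; rewrite gt_eqF.
  apply: (cauchy_estimate D1 r0) => k kr.
  apply: (mvi D) => x x0 x1; rewrite -addrA; apply: B'.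
  apply: le_trans (cabsD _ _) _; rewrite kr cabsM cabsR ger0_norm //.
  have : cabs h * x <= r * 1 by apply: ler_pM => //; exact: cabs_ge0.
  lra.
move=> h hr.
have D2 : hd (fun w => f w - f' z * w) (fun w => f' w - f' z * 1).
  by move=> w; apply: cderB (D w) _; apply: cderZ (cder_id w).
have -> : f (z + h) - f z - f' z * h = f (z + h) - f' z * (z + h) - (f z - f' z * z) by
  ring.
rewrite [cabs h ^+ 2]expr2 mulrA; apply: (mvi D2) => x x0 x1; rewrite mulr1.
have hx : cabs (h * x%:C) <= cabs h.
  by rewrite cabsM cabsR ger0_norm // ler_piMr // cabs_ge0.
apply: le_trans (L _ _) _; first exact: le_trans hr.
apply: ler_wpM2l => //; apply: divr_ge0; last by rewrite sqr_ge0.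
by apply: le_trans (cabs_ge0 _) (B 0 _); rewrite cabs0; lra.
Qed.

(** The limit of [u] at 0 is the supremum of the lower bounds [u h - c |h|], each of which lies
    below every [u k + c |k|]. *)
Lemma real_limit_of_cauchy (u : R[i] -> R) (r c : R) : 0 < r ->
  (forall h k, h != 0 -> k != 0 -> cabs h <= r -> cabs k <= r ->
    u h - u k <= c * (cabs h + cabs k)) ->
  exists L, forall h, h != 0 -> cabs h <= r -> `|u h - L| <= c * cabs h.
Proof.
move=> r0 H.
pose S := [set x | exists h, [/\ h != 0, cabs h <= r & x = u h - c * cabs h]]%classic.
have r1 : (r%:C : R[i]) != 0 by rewrite -cabs_gt0 cabsR gtr0_norm.
have r2 : cabs (r%:C : R[i]) <= r by rewrite cabsR gtr0_norm.
have ubS k : k != 0 -> cabs k <= r -> ubound S (u k + c * cabs k).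
  move=> k0 kr _ [h [h0 hr ->]]; have := H h k h0 k0 hr kr; lra.
exists (sup S) => h h0 hr; apply/ler_normlP; split.
  have : sup S <= u h + c * cabs h by apply: ge_sup (ubS h h0 hr);
    exists (u r%:C - c * cabs (r%:C : R[i])), r%:C.
  lra.
have : u h - c * cabs h <= sup S.
  by apply: ub_le_sup; [exists (u h + c * cabs h); exact: ubS | exists h].
lra.
Qed.

Lemma complex_limit_of_cauchy (u : R[i] -> R[i]) (r c : R) : 0 < r ->
  (forall h k, h != 0 -> k != 0 -> cabs h <= r -> cabs k <= r ->
    cabs (u h - u k) <= c * (cabs h + cabs k)) ->
  exists L, forall h, h != 0 -> cabs h <= r -> cabs (u h - L) <= 2 * c * cabs h.
Proof.
move=> r0 H.
have [a Ha] : exists L, forall h, h != 0 -> cabs h <= r -> `|complex.Re (u h) - L| <= c *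
  cabs h.
  apply: (real_limit_of_cauchy r0) => h k h0 k0 hr kr.
  apply: le_trans (H h k h0 k0 hr kr); rewrite -raddfB.
  by apply: le_trans (ler_norm _) (cabs_Re _).
have [b Hb] : exists L, forall h, h != 0 -> cabs h <= r -> `|complex.Im (u h) - L| <= c *
  cabs h.
  apply: (real_limit_of_cauchy r0) => h k h0 k0 hr kr.
  apply: le_trans (H h k h0 k0 hr kr); rewrite -raddfB.
  by apply: le_trans (ler_norm _) (cabs_Im _).
exists (a +i* b) => h h0 hr; apply: le_trans (cabs_ReIm _) _.
have := Ha h h0 hr; have := Hb h h0 hr; case: (u h) => x y /=; lra.
Qed.

(* The difference quotients of G in t are Cauchy uniformly in s, and the Cauchy
   estimate in s passes this on to their s-derivatives at 0. *)
Lemma mixed_derivative (G G1 : R[i] -> R[i] -> R[i]) (t0 : R[i]) (r M : R) :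
  (forall t, hd (fun s => G s t) (fun s => G1 s t)) ->
  (forall s, exists g, hd (G s) g) -> 0 < r ->
  (forall s h, cabs s <= r -> cabs h <= 3 * r -> cabs (G s (t0 + h)) <= M) ->
  exists l, cder (G1 0) t0 l.
Proof.
move=> HG1 HG2 r0 B.
have M0 : 0 <= M.
  apply: le_trans (cabs_ge0 _) (B 0 0 _ _); rewrite cabs0; lra.
have Q (g : R[i] -> R[i]) l h : h != 0 -> g t0 + l * h + (g (t0 + h) - g t0 - l * h) = g
  (t0 + h).
  by move=> _; ring.
pose c := M / r ^+ 2.
have c0 : 0 <= c by rewrite divr_ge0 // sqr_ge0.
pose q h s := h^-1 * (G s (t0 + h) - G s t0).
have qc h k s : h != 0 -> k != 0 -> cabs h <= r -> cabs k <= r -> cabs s <= r ->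
    cabs (q h s - q k s) <= c * (cabs h + cabs k).
  move=> h0 k0 hr kr sr; have [g Dg] := HG2 s.
  have T := taylor_order2 Dg r0 (fun h => B s h sr).
  have T' k' : k' != 0 -> cabs k' <= r -> cabs (q k' s - g t0) <= c * cabs k'.
    move=> k'0 k'r; have k'p : 0 < cabs k' by rewrite cabs_gt0.
    rewrite -(ler_pM2r k'p) -mulrA -expr2 -cabsM.
    by apply: le_trans (T _ k'r); rewrite le_eqVlt; apply/orP; left; apply/eqP;
      congr cabs; rewrite /q; field.
  have -> : q h s - q k s = (q h s - g t0) - (q k s - g t0) by ring.
  by apply: le_trans (cabsB _ _) _; rewrite mulrDr; apply: lerD; apply: T'.
pose d h := h^-1 * (G1 0 (t0 + h) - G1 0 t0).
have Dq h : hd (q h) (fun s => h^-1 * (G1 s (t0 + h) - G1 s t0)).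
  by move=> s; apply: cderZ; apply: cderB; exact: HG1.
have dc h k : h != 0 -> k != 0 -> cabs h <= r -> cabs k <= r ->
    cabs (d h - d k) <= c / r * (cabs h + cabs k).
  move=> h0 k0 hr kr; rewrite mulrAC.
  apply: (@cauchy_estimate R _ _ 0 r _ (fun s => cderB (Dq h s) (Dq k s)) r0).
  by move=> s sr; rewrite add0r; apply: qc => //; rewrite sr.
have [L HL] := complex_limit_of_cauchy r0 dc.
exists L => e e0.
pose c2 := 2 * (c / r) + 1.
have c20 : 0 < c2.
  have : 0 <= c / r by rewrite divr_ge0 // ltW.
  rewrite /c2; lra.
exists (Num.min r (e / c2)); first by rewrite lt_min r0 divr_gt0.
move=> h; rewrite lt_min => /andP[/ltW hr].
rewrite ltr_pdivlMr // => /ltW he.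
have [->|h0] := eqVneq h 0.
  by rewrite mulr0 addr0 !subrr cabs0 mulr0.
have -> : G1 0 (t0 + h) - G1 0 t0 - L * h = (d h - L) * h by rewrite /d; field.
rewrite cabsM; apply: ler_wpM2r (cabs_ge0 h) _ _ _; apply: le_trans (HL _ h0 hr) _.
have : 0 <= cabs h := cabs_ge0 h.
move: he; rewrite /c2 mulrDr mulr1; lra.
Qed.

Lemma local_bound (f f' : R[i] -> R[i]) z : hd f f' ->
  exists r M, 0 < r /\ forall h, cabs h <= r -> cabs (f (z + h)) <= M.
Proof.
move=> D; have [d d0 H] := cder_cont (D z) ltr01.
exists (d / 2), (cabs (f z) + 1); split; first by rewrite divr_gt0.
move=> h hd; have := H h ltac:(lra) => H1.
by rewrite -[f (z + h)](subrK (f z)) addrC [leRHS]addrC addrC;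
  apply: le_trans (cabsD _ _) _; apply: lerD.
Qed.

(** For [G s t = f (s + t)] the s-derivative at 0 is [f'], and [mixed_derivative] differentiates it
    in [t]. *)
Lemma hd_derivable (f f' : R[i] -> R[i]) : hd f f' -> exists f'', hd f' f''.
Proof.
move=> D.
suff H : forall t0, exists l, cder f' t0 l by have [f'' H'] := choice H; exists f''.
move=> t0; have [r [M [r0 B]]] := local_bound t0 D.
have Ds t : hd (fun s => f (s + t)) (fun s => f' (s + t)).
  move=> s; have := @cder_shift R f t 1 s _ (D _); rewrite mulr1 mul1r addrC.
  by apply: cder_ext => u; rewrite mul1r addrC.
have [||||l Hl] := @mixed_derivative (fun s t => f (s + t)) (fun s t => f' (s + t)) t0 (r
  / 4) M.
- exact: Ds.
- move=> s; exists (fun t => f' (t + s)); by apply: (hd_ext _ _ (Ds s)) => // w;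
  rewrite addrC.
- by rewrite divr_gt0.
- move=> s h sr hr; rewrite addrCA; apply: B; apply: le_trans (cabsD _ _) _; lra.
- by exists l; apply: cder_ext Hl => w; rewrite add0r.
Qed.

End SecondOrder.

(** * Entire functions of several variables and their growth *)

Definition rnorm (R : realType) (m : nat) (z : 'rV[R[i]]_m) : R :=
  \sum_(k < m) cabs (z 0 k).

(* Holomorphic along complex lines and locally bounded: unlike Frechet
   differentiability, this passes to partial derivatives with the estimates of
   one variable alone. *)
Definition ent (R : realType) (m : nat) (g : 'rV[R[i]]_m -> R[i]) : Prop :=
  (forall z v, exists g', hd (fun t => g (z + t *: v)) g') /\
  (forall z, exists r M, 0 < r /\ forall w, rnorm w <= r -> cabs (g (z + w)) <= M).

Section Entire.
Context {R : realType} {m : nat}.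
Implicit Types (z w v : 'rV[R[i]]_m) (g : 'rV[R[i]]_m -> R[i]).

Lemma rnorm_ge0 z : 0 <= rnorm z.
Proof. by apply: sumr_ge0 => k _; apply: cabs_ge0. Qed.

Lemma rnormD z w : rnorm (z + w) <= rnorm z + rnorm w.
Proof.
rewrite /rnorm -big_split /=; apply: ler_sum => k _; rewrite mxE; exact: cabsD.
Qed.

Lemma rnormZ (t : R[i]) z : rnorm (t *: z) = cabs t * rnorm z.
Proof. by rewrite /rnorm mulr_sumr; apply: eq_bigr => k _; rewrite mxE cabsM. Qed.

Lemma rnorm0 : rnorm (0 : 'rV[R[i]]_m) = 0.
Proof. by rewrite -(scale0r 0) rnormZ cabs0 mul0r. Qed.

Lemma rnorm_delta k : rnorm (delta_mx 0 k : 'rV[R[i]]_m) = 1.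
Proof.
rewrite /rnorm (bigD1 k) //= mxE !eqxx cabs1 big1 ?addr0 // => j jk.
by rewrite mxE (negbTE jk) andbF cabs0.
Qed.

Lemma cabs_coord z k : cabs (z 0 k) <= rnorm z.
Proof.
by rewrite /rnorm (bigD1 k) //= lerDl sumr_ge0 // => j _; apply: cabs_ge0.
Qed.

Lemma derivable_cder (g : 'rV[R[i]]_m -> R[i]^o) z v : derivable g z v ->
  cder (fun t => g (z + t *: v)) 0 ('D_v g z).
Proof.
move=> /cvgrPdist_le H e e0.
have /H : 0 < e%:C :> R[i] by rewrite ltcR.
rewrite near_withinE => -[d /= d0 {}H].
have dE : d = (complex.Re d)%:C by rewrite RRe_real // gtr0_real.
exists (complex.Re d); first by rewrite -ltcR -dE.
move=> h hd; have [->|h0] := eqVneq h 0.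
  by rewrite addr0 scale0r addr0 mulr0 !subrr cabs0 mulr0.
have := H h; rewrite /= sub0r normrN normE dE ltcR => /(_ hd h0).
rewrite normE lecR add0r scale0r addr0 [h *: v + z]addrC => H1.
set l := 'D_v g z.
have -> : g (z + h *: v) - g z - l * h = - ((l - h^-1 *: (g (z + h *: v) - g z)) * h).
  by rewrite /GRing.scale /=; field.
by rewrite cabsN cabsM ler_wpM2r ?cabs_ge0.
Qed.

Lemma cder_derive (g : 'rV[R[i]]_m -> R[i]^o) z v (l : R[i]) :
  cder (fun t => g (z + t *: v)) 0 l -> 'D_v g z = l.
Proof.
move=> H; apply: cvg_lim; first exact: norm_hausdorff.
apply/cvgrPdist_le => e e0.
have eE : e = (complex.Re e)%:C by rewrite RRe_real // gtr0_real.
have [d d0 {}H] : exists2 d : R, 0 < d & forall h, cabs h < d ->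
    cabs (g (z + (0 + h) *: v) - g (z + 0 *: v) - l * h) <= complex.Re e * cabs h.
  by apply: H; rewrite -ltcR -eE.
rewrite near_withinE; exists d%:C; first by rewrite /= ltcR.
move=> h /=; rewrite sub0r normrN normE ltcR => hd h0.
have := H h hd; rewrite add0r scale0r addr0 [h *: v + z]addrC => H1.
rewrite normE eE lecR -(@ler_pM2r _ (cabs h)) ?cabs_gt0 // -cabsM.
apply: le_trans H1; rewrite -cabsN le_eqVlt; apply/orP; left; apply/eqP.
by congr cabs; rewrite /GRing.scale /=; field.
Qed.

Lemma cder_at0 (g : R[i] -> R[i]) (t l : R[i]) :
  cder (fun s => g (t + s)) 0 l -> cder g t l.
Proof.
move=> H e e0; have [d d0 {}H] := H e e0.
by exists d => // h /H; rewrite add0r addr0.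
Qed.

Lemma entire_ent (f : 'rV[R[i]]_m -> R[i]^o) : entire f -> ent f.
Proof.
move=> Ef; split => [z v|z].
  suff /choice [g' Hg] : forall t, exists l, cder (fun t => f (z + t *: v)) t l.
    by exists g'.
  move=> t; exists ('D_v f (z + t *: v)); apply: cder_at0.
  have /derivable_cder : derivable f (z + t *: v) v by apply: diff_derivable; exact: Ef.
  by apply: cder_ext => s; rewrite scalerDl addrA.
have := differentiable_continuous (Ef z) => /cvgrPdist_le /(_ 1 ltr01).
move=> /nbhs_ballP [d /= d0 Hd].
have dE : d = (complex.Re d)%:C by rewrite RRe_real // gtr0_real.
have d'0 : 0 < complex.Re d by rewrite -ltcR -dE.
exists (complex.Re d / 2), (cabs (f z) + 1); split; first by rewrite divr_gt0.
move=> w wr; have : cabs (f z - f (z + w)) <= 1.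
  rewrite -lecR -normE; apply: Hd.
  split=> [//|i j]; rewrite ord1 /ball /= normE dE ltcR mxE opprD addrA subrr add0r cabsN.
  apply: le_lt_trans (cabs_coord _ _) _; lra.
move=> H; have -> : f (z + w) = f z - (f z - f (z + w)) by ring.
by apply: le_trans (cabsB _ _) _; rewrite lerD2l.
Qed.

Lemma ent_line_hd g z v : ent g -> exists2 g', hd (fun t => g (z + t *: v)) g' &
  forall t, g' t = 'D_v (g : _ -> R[i]^o) (z + t *: v).
Proof.
move=> [/(_ z v) [g' Hg] _]; exists g' => // t; apply/esym/cder_derive.
have := @cder_shift R _ t 1 0 _ (Hg _); rewrite mulr1 mulr0 addr0.
by apply: cder_ext => s; rewrite mul1r scalerDl addrA.
Qed.

Lemma ent_derive_bound g z v (r M : R) : ent g -> 0 < r -> rnorm v <= 1 ->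
  (forall w, rnorm w <= r -> cabs (g (z + w)) <= M) ->
  cabs ('D_v (g : _ -> R[i]^o) z) <= M / r.
Proof.
move=> Eg r0 v1 B; have [g' Hg E] := ent_line_hd z v Eg.
have := E 0; rewrite scale0r addr0 => <-.
apply: (cauchy_estimate Hg r0) => h hr; rewrite add0r; apply: B.
by rewrite rnormZ hr ler_piMr // ltW.
Qed.

(** On a line in direction [u], the derivative of [g] along [v] is the s-derivative at 0 of
    [g (z + t u + s v)], to which [mixed_derivative] applies. Local boundedness is a Cauchy estimate
    on half the radius. *)
Lemma ent_derive g v : ent g -> ent ('D_v (g : _ -> R[i]^o)).
Proof.
move=> Eg; have [_ lb] := Eg; split.
- move=> z u.
  suff /choice [g' Hg] : forall t, exists l, cder (fun t => 'D_v (g : _ -> R[i]^o) (z + t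
    *: u)) t l.
    by exists g'.
  move=> t0; have [r [M [r0 B]]] := lb (z + t0 *: u).
  have c0 : 0 < rnorm u + rnorm v + 1 by have := rnorm_ge0 u; have := rnorm_ge0 v; lra.
  (* With this radius, [h] up to three times as large and [s], the displacement [h u + s v] stays
     within [r]. *)
  have [||||l Hl] := @mixed_derivative R (fun s t => g ((z + t *: u) + s *: v))
    (fun s t => 'D_v (g : _ -> R[i]^o) ((z + t *: u) + s *: v)) t0 (r / 3 / (rnorm u +
      rnorm v + 1)) M.
  + move=> t; have [g' Hg E] := ent_line_hd (z + t *: u) v Eg.
    by apply: hd_ext Hg => // s; rewrite E.
  + move=> s; have [g' Hg _] := ent_line_hd (z + s *: v) u Eg; exists g'.
    by apply: hd_ext Hg => // t; rewrite addrAC.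
  + by rewrite !divr_gt0.
  + move=> s h hs hh.
    have -> : z + (t0 + h) *: u + s *: v = z + t0 *: u + (h *: u + s *: v).
      by rewrite scalerDl !addrA.
    apply: B; apply: le_trans (rnormD _ _) _; rewrite !rnormZ.
    have x0 := rnorm_ge0 u; have y0 := rnorm_ge0 v.
    have h1 := ler_wpM2r x0 hh; have h2 := ler_wpM2r y0 hs.
    apply: le_trans (lerD h1 h2) _.
    set c := r / 3 / _.
    have cE : c * (rnorm u + rnorm v + 1) = r / 3 by rewrite /c divfK // gt_eqF.
    have cp : 0 <= c by rewrite /c !divr_ge0 // ltW.
    have := mulr_ge0 cp x0; have := mulr_ge0 cp y0.
    have : c * (rnorm u + rnorm v + 1) = c * rnorm u + c * rnorm v + c by ring.
    lra.
  exists l; apply: cder_ext Hl => t; by rewrite scale0r addr0.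
- move=> z; have [r [M [r0 B]]] := lb z.
  have c0 : 0 < rnorm v + 1 by have := rnorm_ge0 v; lra.
  have r2 : 0 < r / 2 / (rnorm v + 1) by rewrite !divr_gt0.
  exists (r / 2), (M / (r / 2 / (rnorm v + 1))); split; first by rewrite divr_gt0.
  move=> w wr; have [g' Hg E] := ent_line_hd (z + w) v Eg.
  have := E 0; rewrite scale0r addr0 => <-.
  apply: (cauchy_estimate Hg r2) => h hr; rewrite add0r -addrA; apply: B.
  apply: le_trans (rnormD _ _) _; rewrite rnormZ hr.
  have : r / 2 / (rnorm v + 1) * rnorm v <= r / 2.
    rewrite mulrAC ler_pdivrMr // ler_pM2l ?divr_gt0 //; lra.
  lra.
Qed.

Lemma ent_mpderiv (I : multinom m) g : ent g -> ent (mpderiv I g).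
Proof.
move=> Eg; rewrite /mpderiv; elim: (enum 'I_m) => [//|k s IH] /=.
by elim: (I k) => [//|n IHn] /=; apply: ent_derive.
Qed.

(** The iterated Cauchy estimate for a derivative [D] of [g], with constants independent of the
    point and explicit in the radius; [growth_solution] needs this because its radii tend to 0. *)
Definition derive_bound (g D : 'rV[R[i]]_m -> R[i]) : Prop :=
  exists2 c, 0 <= c & exists L, forall z (r M : R), 0 < r -> r <= 1 ->
  (forall w, rnorm w <= r -> cabs (g (z + w)) <= M) -> cabs (D z) <= c / r ^+ L * M.

Lemma derive_bound_id g : derive_bound g g.
Proof.
exists 1 => //; exists 0%N => z r M r0 _ B; rewrite expr0 divr1 mul1r.
by have := B 0; rewrite addr0; apply; rewrite rnorm0 ltW.
Qed.

(** Half of the radius is spent on one more Cauchy estimate and half is left for the bound on [D],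
    whence the factor [2 ^ L.+1]. *)
Lemma derive_bound_derive g D v : rnorm v <= 1 -> ent D -> derive_bound g D ->
  derive_bound g ('D_v (D : _ -> R[i]^o)).
Proof.
move=> v1 ED [c c0 [L H]]; exists (c * 2 ^+ L.+1); first by rewrite mulr_ge0 // exprn_ge0.
exists L.+1 => z r M r0 r1 B.
have r2 : 0 < r / 2 by rewrite divr_gt0.
have -> : c * 2 ^+ L.+1 / r ^+ L.+1 * M = c / (r / 2) ^+ L * M / (r / 2).
  by rewrite expr_div_n !exprS; field; rewrite !expf_neq0 ?gt_eqF.
apply: (ent_derive_bound ED r2 v1) => w wr.
have r21 : r / 2 <= 1 by lra.
apply: H => // u ur; rewrite -addrA; apply: B; apply: le_trans (rnormD _ _) _; lra.
Qed.

Lemma derive_bound_mpderiv (I : multinom m) g : ent g -> derive_bound g (mpderiv I g).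
Proof.
move=> Eg; rewrite /mpderiv.
suff [] : (ent (foldr (fun k g => iter (I k) (pderiv k) g) g (enum 'I_m)) /\
  derive_bound g (foldr (fun k g => iter (I k) (pderiv k) g) g (enum 'I_m)))%type by [].
elim: (enum 'I_m) => [|k s IH] /=; first by split => //; exact: derive_bound_id.
elim: (I k) => [//|n [E B]] /=; split; first exact: ent_derive.
by apply: derive_bound_derive => //; rewrite rnorm_delta.
Qed.



End Entire.

(** Growth [e^w] up to a polynomial in the size [s]. Both are parameters, so that one calculus
    serves functions on the whole space and functions on complex lines. *)
Definition growth (R : realType) (T : Type) (s w : T -> R) (F : T -> R[i]) :=
  exists C K, 0 <= C /\ forall t, cabs (F t) <= C * (1 + s t) ^+ K * expR (w t).

Section Growth.
Context {R : realType} {T : Type}.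
Variable s : T -> R.
Hypothesis s0 : forall t, 0 <= s t.
Implicit Types (w : T -> R) (F G : T -> R[i]).

Lemma pow_size_mono t K L : (K <= L)%N -> (1 + s t) ^+ K <= (1 + s t) ^+ L.
Proof. by move=> KL; apply: ler_weXn2l => //; rewrite lerDl. Qed.

Lemma pow_size_ge0 t K : 0 <= (1 + s t) ^+ K.
Proof. by rewrite exprn_ge0 // addr_ge0. Qed.

Lemma growth_ext w F G : (forall t, F t = G t) -> growth s w F -> growth s w G.
Proof.
by move=> E [C [K [C0 H]]]; exists C, K; split => // t; rewrite -E.
Qed.

Lemma growth_le w w' F : (forall t, w t <= w' t) -> growth s w F -> growth s w' F.
Proof.
move=> ww [C [K [C0 H]]]; exists C, K; split => // t; apply: le_trans (H t) _.
by apply: ler_wpM2l; [rewrite mulr_ge0 // pow_size_ge0 | rewrite ler_expR].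
Qed.

Lemma growth_dom w F G (c : R) : 0 <= c -> (forall t, cabs (G t) <= c * cabs (F t)) ->
  growth s w F -> growth s w G.
Proof.
move=> c0 FG [C [K [C0 H]]]; exists (c * C), K; split => [|t]; first exact: mulr_ge0.
by apply: le_trans (FG t) _; rewrite -!mulrA ler_wpM2l // mulrA.
Qed.

Lemma growthM w w' F G : growth s w F -> growth s w' G ->
  growth s (fun t => w t + w' t) (fun t => F t * G t).
Proof.
move=> [C [K [C0 H]]] [C' [K' [C'0 H']]]; exists (C * C'), (K + K')%N.
split => [|t]; first exact: mulr_ge0.
rewrite cabsM exprD expRD.
have -> : C * C' * ((1 + s t) ^+ K * (1 + s t) ^+ K') * (expR (w t) * expR (w' t)) =
  (C * (1 + s t) ^+ K * expR (w t)) * (C' * (1 + s t) ^+ K' * expR (w' t)) by ring.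
by apply: ler_pM => //; apply: cabs_ge0.
Qed.

Lemma growthD w F G : growth s w F -> growth s w G ->
  growth s w (fun t => F t + G t).
Proof.
move=> [C [K [C0 H]]] [C' [K' [C'0 H']]]; exists (C + C'), (maxn K K').
split => [|t]; first exact: addr_ge0.
apply: le_trans (cabsD _ _) _; rewrite !mulrDl; apply: lerD.
  apply: le_trans (H t) _; apply: ler_wpM2r; first exact: expR_ge0.
  by apply: ler_wpM2l => //; apply: pow_size_mono; rewrite leq_maxl.
apply: le_trans (H' t) _; apply: ler_wpM2r; first exact: expR_ge0.
by apply: ler_wpM2l => //; apply: pow_size_mono; rewrite leq_maxr.
Qed.

Lemma growth_cst (c : R[i]) : growth s (fun=> 0) (fun=> c).
Proof.
exists (cabs c), 0%N; split; first exact: cabs_ge0.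
by move=> t; rewrite expr0 expR0 !mulr1.
Qed.

Lemma growthB w F G : growth s w F -> growth s w G ->
  growth s w (fun t => F t - G t).
Proof.
move=> HF HG; apply: growthD => //; apply: (growth_dom ler01 _ HG) => t.
by rewrite cabsN mul1r.
Qed.

Lemma growth0M w F G : growth s (fun=> 0) F -> growth s w G -> growth s w (fun t => F t *
  G t).
Proof. by move=> HF HG; apply: growth_le (growthM HF HG) => t; rewrite add0r. Qed.

Lemma growth_sum w (I : Type) (r : seq I) (F : I -> T -> R[i]) :
  (forall i, growth s w (F i)) -> growth s w (fun t => \sum_(i <- r) F i t).
Proof.
move=> H; elim: r => [|i r IH].
  exists 0, 0%N; split => // t; by rewrite big_nil cabs0 !mul0r.
by apply: growth_ext (growthD (H i) IH) => t; rewrite big_cons.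
Qed.

Lemma growthX w F n : growth s w F -> growth s (fun t => n%:R * w t) (fun t => F t ^+ n).
Proof.
move=> H; elim: n => [|n IH].
  by apply: growth_le (growth_cst 1) => t; rewrite mul0r.
apply: growth_ext (_ : growth s _ (fun t => F t * F t ^+ n)) => [t|];
  first by rewrite exprS.
by apply: growth_le (growthM H IH) => t; rewrite -[n.+1]addn1 natrD mulrDl mul1r addrC.
Qed.

(** No roots of the constants are taken: [C] is at most [(1 + C)^n], and the power [K] of the size
    at most [K * n]. *)
Lemma growth_root w F n : (0 < n)%N ->
  growth s (fun t => n%:R * w t) (fun t => F t ^+ n) -> growth s w F.
Proof.
move=> n0 [C [K [C0 H]]]; exists (1 + C), K; split => [|t]; first by rewrite addr_ge0.
have hC : 0 <= (1 + C) by rewrite addr_ge0.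
have h0 : 0 <= (1 + C) * (1 + s t) ^+ K * expR (w t).
  by rewrite !mulr_ge0 ?expR_ge0 // pow_size_ge0.
rewrite -(@ler_pXn2r _ n) ?nnegrE ?cabs_ge0 // -cabsX.
apply: le_trans (H t) _; rewrite expRM_natl !exprMn.
apply: ler_wpM2r; first by rewrite exprn_ge0 ?expR_ge0.
apply: ler_pM => //; first exact: pow_size_ge0.
  case: n n0 {H} => // n _; apply: le_trans (_ : 1 + C <= _); first by rewrite lerDr.
  by rewrite exprS ler_peMr // exprn_ege1 // lerDl.
by rewrite -exprM; apply: pow_size_mono; rewrite leq_pmulr.
Qed.

Lemma growth0_prod (I : Type) (r : seq I) (F : I -> T -> R[i]) :
  (forall i, growth s (fun=> 0) (F i)) ->
  growth s (fun=> 0) (fun t => \prod_(i <- r) F i t).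
Proof.
move=> H; elim: r => [|i r IH].
  by apply: growth_ext (growth_cst 1) => t; rewrite big_nil.
by apply: growth_ext (growth0M (H i) IH) => t; rewrite big_cons.
Qed.

Lemma growth0X F n : growth s (fun=> 0) F -> growth s (fun=> 0) (fun t => F t ^+ n).
Proof. by move=> /growthX H; apply: growth_le (H n) => t; rewrite mulr0. Qed.

End Growth.

(** * Pointwise bounds for differential polynomials *)

Section DifferentialPolynomial.
Context {R : realType} {m : nat}.
Implicit Types (z w : 'rV[R[i]]_m) (f D : 'rV[R[i]]_m -> R[i]).

Lemma evalp_growth (p : mpoly m R[i]) : growth (@rnorm R m) (fun=> 0) (evalp p).
Proof.
have r0 := @rnorm_ge0 R m.
apply: growth_ext (_ : growth _ _ (fun z => \sum_(u <- msupp p) mcoeff u p * \prod_(i <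
  m) z 0 i ^+ u i)) => [z|].
  by rewrite /evalp mevalE.
apply: growth_sum => // u; apply: growth0M => //; first exact: growth_cst.
apply: growth0_prod => // i; apply: growth0X => //.
exists 1, 1%N; split => // z; rewrite mul1r expR0 mulr1 expr1.
by apply: le_trans (cabs_coord z i) _; rewrite lerDr.
Qed.

(** What remains of a differential polynomial [D] of degree [d] in [f]: [K] accounts for the
    coefficients, [L] for the orders of the derivatives and [d] for the degree. With [r <= 1 <= S]
    the bound is monotone in all three exponents, so that sums of different terms fit under one
    bound. *)
Definition dbound f (d : nat) D : Prop :=
  exists c K L, 0 <= c /\ forall z (r S : R), 0 < r -> r <= 1 -> 1 <= S ->
  (forall w, rnorm w <= r -> cabs (f (z + w)) <= S) ->
  cabs (D z) <= c * (1 + rnorm z) ^+ K / r ^+ L * S ^+ d.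

Lemma dbound_weaken (c c' a r S : R) (K K' L L' d d' : nat) :
  0 <= c -> c <= c' -> 0 <= a -> 0 < r -> r <= 1 -> 1 <= S ->
  (K <= K')%N -> (L <= L')%N -> (d <= d')%N ->
  c * (1 + a) ^+ K / r ^+ L * S ^+ d <= c' * (1 + a) ^+ K' / r ^+ L' * S ^+ d'.
Proof.
move=> c0 cc' a0 r0 r1 S1 KK LL dd.
have a1 : 1 <= 1 + a by rewrite lerDl.
have rL n : 0 <= (r ^+ n)^-1 by rewrite invr_ge0 exprn_ge0 // ltW.
have S0 : 0 <= S by apply: le_trans S1.
apply: ler_pM.
- by rewrite !mulr_ge0 // exprn_ge0 // ltW // (lt_le_trans ltr01 a1).
- exact: exprn_ge0.
- apply: ler_pM => //.
  + by rewrite mulr_ge0 // exprn_ge0 // (le_trans ler01 a1).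
  + apply: ler_pM => //; first by rewrite exprn_ge0 // (le_trans ler01 a1).
    by apply: ler_weXn2l.
  + rewrite lef_pV2 ?posrE ?exprn_gt0 //; apply: ler_wiXn2l => //; exact: ltW.
- by apply: ler_weXn2l.
Qed.

Lemma dbound_le f d d' D : (d <= d')%N -> dbound f d D -> dbound f d' D.
Proof.
move=> dd [c [K [L [c0 H]]]]; exists c, K, L; split => // z r S r0 r1 S1 B.
by apply: le_trans (H z r S r0 r1 S1 B) _; apply: dbound_weaken => //; apply: rnorm_ge0.
Qed.

Lemma dboundM f d d' D D' : dbound f d D -> dbound f d' D' ->
  dbound f (d + d') (fun z => D z * D' z).
Proof.
move=> [c [K [L [c0 H]]]] [c' [K' [L' [c'0 H']]]].
exists (c * c'), (K + K')%N, (L + L')%N; split; first exact: mulr_ge0.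
move=> z r S r0 r1 S1 B; rewrite cabsM !exprD invfM.
have -> : c * c' * ((1 + rnorm z) ^+ K * (1 + rnorm z) ^+ K') *
    ((r ^+ L)^-1 * (r ^+ L')^-1) * (S ^+ d * S ^+ d') =
  (c * (1 + rnorm z) ^+ K / r ^+ L * S ^+ d) *
  (c' * (1 + rnorm z) ^+ K' / r ^+ L' * S ^+ d') by ring.
by apply: ler_pM; rewrite ?cabs_ge0 //; [exact: H | exact: H'].
Qed.

Lemma dboundD f d D D' : dbound f d D -> dbound f d D' ->
  dbound f d (fun z => D z + D' z).
Proof.
move=> [c [K [L [c0 H]]]] [c' [K' [L' [c'0 H']]]].
exists (c + c'), (maxn K K'), (maxn L L'); split; first exact: addr_ge0.
move=> z r S r0 r1 S1 B; apply: le_trans (cabsD _ _) _; rewrite !mulrDl.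
apply: lerD.
  apply: le_trans (H z r S r0 r1 S1 B) _.
  by apply: dbound_weaken => //; rewrite ?rnorm_ge0 ?leq_maxl.
apply: le_trans (H' z r S r0 r1 S1 B) _.
by apply: dbound_weaken => //; rewrite ?rnorm_ge0 ?leq_maxr.
Qed.

Lemma dbound_ext f d D D' : (forall z, D z = D' z) -> dbound f d D -> dbound f d D'.
Proof.
move=> E [c [K [L [c0 H]]]]; exists c, K, L; split => // z r S r0 r1 S1 B.
by rewrite -E; apply: H.
Qed.

Lemma dbound_cst f (a : R[i]) : dbound f 0 (fun=> a).
Proof.
exists (cabs a), 0%N, 0%N; split; first exact: cabs_ge0.
by move=> *; rewrite !expr0 divr1 !mulr1.
Qed.

Lemma dbound_growth f D : growth (@rnorm R m) (fun=> 0) D -> dbound f 0 D.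
Proof.
move=> [C [K [C0 H]]]; exists C, K, 0%N; split => // z r S _ _ _ _.
by have := H z; rewrite expR0 !expr0 divr1 !mulr1.
Qed.

Lemma dbound_id f : dbound f 1 f.
Proof.
exists 1, 0%N, 0%N; split => // z r S r0 _ _ B.
rewrite !expr0 divr1 !mul1r expr1; have := B 0; rewrite addr0 rnorm0; apply.
exact: ltW.
Qed.

Lemma dboundX f D n : dbound f 1 D -> dbound f n (fun z => D z ^+ n).
Proof.
move=> H; elim: n => [|n IH]; first by apply: dbound_ext (dbound_cst f 1) => z.
by apply: dbound_ext (dboundM H IH) => z; rewrite exprS.
Qed.

Lemma dbound_sum f d (I : Type) (r : seq I) (P : pred I) (D : I -> _ -> R[i]) :
  (forall i, P i -> dbound f d (D i)) -> dbound f d (fun z => \sum_(i <- r | P i) D i z).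
Proof.
move=> H; elim: r => [|i r IH].
  apply: (@dbound_ext _ _ (fun=> 0)) => [z|]; first by rewrite big_nil.
  by apply: dbound_le (dbound_cst f 0).
have [Pi|Pi] := boolP (P i).
  by apply: dbound_ext (dboundD (H i Pi) IH) => z; rewrite big_cons Pi.
by apply: dbound_ext IH => z; rewrite big_cons (negbTE Pi).
Qed.

Lemma dbound_prod f (I : Type) (r : seq I) (e : I -> nat) (D : I -> _ -> R[i]) :
  (forall i, dbound f (e i) (D i)) ->
  dbound f (\sum_(i <- r) e i) (fun z => \prod_(i <- r) D i z).
Proof.
move=> H; elim: r => [|i r IH].
  apply: (@dbound_ext _ _ (fun=> 1)) => [z|]; first by rewrite big_nil.
  by apply: dbound_le (dbound_cst f 1).
by rewrite big_cons; apply: dbound_ext (dboundM (H i) IH) => z; rewrite big_cons.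
Qed.

Lemma dbound_mpderiv (I : multinom m) f : ent f -> dbound f 1 (mpderiv I f).
Proof.
move=> /(derive_bound_mpderiv I) [c c0 [L H]]; exists c, 0%N, L; split => //.
by move=> z r S r0 r1 S1 B; rewrite expr0 mulr1 expr1; apply: H.
Qed.

Lemma dbound_dp_eval (P : diff_poly R m) f : ent f -> dbound f (dp_deg P) (dp_eval P f).
Proof.
move=> Ef.
(* Membership in [dp_I P] is recorded in the sum, since [mdeg i <= dp_deg P] is known only there. *)
rewrite (_ : dp_eval P f = fun z => \sum_(i <- dp_I P | i \in dp_I P)
   (evalp (dp_coef P i) z * f z ^+ i ord0 *
    \prod_(k < dp_N P) mpderiv (tnth (dp_nu P) k) f z ^+ i (lift ord0 k))); last first.
  by apply/funext => z; rewrite /dp_eval [LHS]big_seq_cond; apply: eq_bigl => i;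
    rewrite andbT.
apply: dbound_sum => i iP.
apply: (@dbound_le _ (0 + i ord0 + \sum_(k < dp_N P) i (lift ord0 k))%N).
  rewrite add0n -[leqLHS](big_ord_recl _ (fun k => i k)) -mdegE.
  by rewrite /dp_deg (big_rem i) //= leq_maxl.
apply: dboundM; first apply: dboundM.
- exact/dbound_growth/evalp_growth.
- by apply: dboundX; apply: dbound_id.
- by apply: dbound_prod => k; apply/dboundX/dbound_mpderiv.
Qed.

End DifferentialPolynomial.

(** * A priori growth of solutions *)

Section GrowthOfSolutions.
Context {R : realType} {m : nat}.
Implicit Types (z w : 'rV[R[i]]_m) (f D U : 'rV[R[i]]_m -> R[i]).

Lemma real_dyadic_limit (u : nat -> R) :
  (forall j, `|u j.+1 - u j| <= 2^-1 ^+ j) ->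
  exists c, forall j, `|u j - c| <= 2 * 2^-1 ^+ j.
Proof.
move=> H.
have hS j : 2^-1 ^+ j.+1 = 2^-1 ^+ j / 2 :> R by rewrite exprS mulrC.
have h0 j : 0 < 2^-1 ^+ j :> R by rewrite exprn_gt0 // invr_gt0.
have [c Hc] : exists c, forall j, u j - 2 * 2^-1 ^+ j <= c /\ c <= u j + 2 * 2^-1 ^+ j.
  apply: nested_point => j; have := H j; rewrite ?hS ler_norml; have := h0 j.
  - by move=> ? /andP[]; lra.
  - by move=> ? /andP[]; lra.
  - lra.
by exists c => j; have [h1 h2] := Hc j; rewrite ler_norml; apply/andP; split; lra.
Qed.

Lemma dyadic_limit (u : nat -> 'rV[R[i]]_m) :
  (forall j, rnorm (u j.+1 - u j) <= 2^-1 ^+ j) ->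
  exists c, forall e, 0 < e -> exists J, forall j, (J <= j)%N -> rnorm (u j - c) <= e.
Proof.
move=> H.
have Hc k j : cabs ((u j.+1 - u j) 0 k) <= 2^-1 ^+ j by apply: le_trans (H j);
  apply: cabs_coord.
have /choice [a Ha] k : exists c, forall j, `|complex.Re (u j 0 k) - c| <= 2 * 2^-1 ^+ j.
  apply: real_dyadic_limit => j; apply: le_trans (Hc k j); rewrite !mxE -raddfB.
  exact: cabs_Re.
have /choice [b Hb] k : exists c, forall j, `|complex.Im (u j 0 k) - c| <= 2 * 2^-1 ^+ j.
  apply: real_dyadic_limit => j; apply: le_trans (Hc k j); rewrite !mxE -raddfB.
  exact: cabs_Im.
exists (\row_k (a k +i* b k)) => e e0.
have [J HJ] : exists J : nat, 4 * m%:R / e < J%:R :> R.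
  by exists (Num.bound (4 * m%:R / e)); apply: archi_boundP;
    rewrite divr_ge0 ?mulr_ge0 // ltW.
exists J => j Jj.
have hj : 4 * m%:R * 2^-1 ^+ j <= e.
  rewrite exprVn ler_pdivrMr ?exprn_gt0 // [e * _]mulrC -ler_pdivrMr //.
  apply: ltW; apply: lt_le_trans HJ _; rewrite -natrX ler_nat.
  by apply: leq_trans Jj _; apply: ltnW; exact: ltn_expl.
apply: le_trans hj; rewrite /rnorm.
apply: (@le_trans _ _ (\sum_(k < m) 4 * 2^-1 ^+ j)).
  apply: ler_sum => k _; rewrite !mxE; apply: le_trans (cabs_ReIm _) _.
  have := Ha k j; have := Hb k j; case: (u j 0 k) => x y /=; lra.
rewrite sumr_const card_ord -mulr_natr; lra.
Qed.

(* If f is too large at z0, then D must compensate f^n there.  As D has degree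
   less than n and is controlled by Cauchy estimates on balls of radius 2^-j,
   this forces points z_j at summable distances where |f| grows geometrically,
   against local boundedness at their limit. *)
Lemma growth_solution (n d : nat) f D U (H : 'rV[R[i]]_m -> R) (A : R) :
  ent f -> dbound f d D -> (d < n)%N -> (forall z, 0 <= H z) -> 0 <= A ->
  (forall z w, H (z + w) <= H z + A * rnorm w) ->
  growth (@rnorm R m) H U -> (forall z, f z ^+ n + D z = U z) ->
  growth (@rnorm R m) (fun z => H z / n%:R) f.
Proof.
move=> [_ lb] [c [K [L [c0 HD]]]] dn H0 A0 HL [C1 [K1 [C10 HU]]] E.
have n0 : (0 < n)%N by apply: leq_ltn_trans dn.
(* [X1] makes [U] at most [X^n / 2] within distance 2 of [z0], where [1 + |z|] is at most [3 W];
   [X2] makes the upper bound for [D] too small. Since [B > L], the gain [2^B] of one step outweighs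
   the factor [2^L] lost when the radius is halved. *)
pose B := L.+1.
pose X1 := 2 * C1 * 3 ^+ K1 * expR (A * 2).
pose X2 := 2 * c * 3 ^+ K * 2 ^+ (B * n).
have X10 : 0 <= X1 by rewrite !mulr_ge0 ?expR_ge0 ?exprn_ge0.
have X20 : 0 <= X2 by rewrite !mulr_ge0 ?exprn_ge0.
exists (1 + X1 + X2), (K1 + K)%N; split; first lra.
move=> z0; rewrite leNgt; apply/negP.
set W := 1 + rnorm z0; set X := cabs (f z0) => HX.
have W1 : 1 <= W by rewrite lerDl rnorm_ge0.
have W0 : 0 < W by lra.
have eH : 1 <= expR (H z0 / n%:R) by rewrite -[leLHS]expR0 ler_expR divr_ge0 ?H0 ?ler0n.
have WK N : 1 <= W ^+ N by rewrite exprn_ege1.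
have XX : X1 * W ^+ K1 * expR (H z0 / n%:R) < X /\ X2 * W ^+ K < X /\ 1 <= X.
  have a1 : X1 * W ^+ K1 * expR (H z0 / n%:R) <= X1 * W ^+ (K1 + K) * expR (H z0 / n%:R).
    apply: ler_wpM2r; first exact: expR_ge0.
    by apply: ler_wpM2l => //; apply: ler_weXn2l => //; rewrite leq_addr.
  have a2 : X2 * W ^+ K <= X2 * W ^+ (K1 + K) * expR (H z0 / n%:R).
    apply: (@le_trans _ _ (X2 * W ^+ (K1 + K))).
      by apply: ler_wpM2l => //; apply: ler_weXn2l => //; rewrite leq_addl.
    by rewrite ler_peMr // mulr_ge0 // exprn_ge0 // ltW.
  have a3 : 1 <= W ^+ (K1 + K) * expR (H z0 / n%:R).
    by rewrite -[leLHS]mul1r; apply: ler_pM.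
  have a4 := mulr_ge0 X10 (le_trans ler01 a3).
  have a5 := mulr_ge0 X20 (le_trans ler01 a3).
  move: HX; rewrite !mulrDl mul1r; move: a1 a2; rewrite -!mulrA; rewrite -!mulrA in a4 a5.
  move=> a1 a2 HX; split; first lra.
  by split; lra.
case: XX => XX1 [XX2 X1p].
have X0 : 0 < X by lra.
have X0' : 0 <= X by lra.
have HU' z : rnorm (z - z0) <= 2 -> cabs (U z) <= X ^+ n / 2.
  move=> zz; apply: le_trans (HU z) _.
  have z3 : 1 + rnorm z <= 3 * W.
    have := rnormD z0 (z - z0); rewrite addrCA subrr addr0 /W; have := rnorm_ge0 z0; lra.
  have hz : H z <= H z0 + A * 2.
    have := HL z0 (z - z0); rewrite addrCA subrr addr0.
    have := ler_wpM2l A0 zz; lra.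
  apply: (@le_trans _ _ (C1 * (3 * W) ^+ K1 * (expR (H z0) * expR (A * 2)))).
    rewrite -expRD; apply: ler_pM => //; rewrite ?expR_ge0 //.
    - by rewrite mulr_ge0 // exprn_ge0 // addr_ge0 // rnorm_ge0.
    - apply: ler_wpM2l => //; apply: lerXn2r; rewrite ?nnegrE // ?addr_ge0 ?rnorm_ge0 //.
      by rewrite mulr_ge0 // ltW.
    - by rewrite ler_expR.
  rewrite ler_pdivlMr //.
  have -> : C1 * (3 * W) ^+ K1 * (expR (H z0) * expR (A * 2)) * 2 = X1 * W ^+ K1 * expR
    (H z0).
    by rewrite /X1 exprMn; ring.
  have -> : expR (H z0) = expR (H z0 / n%:R) * expR (H z0 / n%:R) ^+ n.-1.
    by rewrite -exprS prednK // -expRM_natl mulrC divfK // pnatr_eq0 -lt0n.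
  have -> : X ^+ n = X * X ^+ n.-1 by rewrite -exprS prednK.
  rewrite mulrA; apply: ler_pM.
  - by rewrite !mulr_ge0 ?expR_ge0 // exprn_ge0 // ltW.
  - by rewrite exprn_ge0 // expR_ge0.
  - exact: ltW.
  - apply: lerXn2r; rewrite ?nnegrE ?expR_ge0 //.
    apply: ltW; apply: le_lt_trans HX; rewrite ler_peMl ?expR_ge0 //.
    by rewrite -[leLHS]mul1r; apply: ler_pM => //; lra.
have hpos j : 0 < 2^-1 ^+ j :> R by rewrite exprn_gt0 // invr_gt0.
(* [2 - 2 * 2^-j] is the total length of the first [j] steps, so all points stay within distance 2
   of [z0]. *)
pose good (p : nat * 'rV[R[i]]_m) :=
  rnorm (p.2 - z0) <= 2 - 2 * 2^-1 ^+ p.1 /\ 2 ^+ (B * p.1) * X <= cabs (f p.2).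
have step p : exists q, good p -> good (p.1.+1, q) /\ rnorm (q - p.2) <= 2^-1 ^+ p.1.
  case: p => j z; have [|ng] := pselect (good (j, z)); last by exists z => g; case: ng.
  move=> [/= g1 g2].
  suff [w [w1 w2]] : exists w, rnorm w <= 2^-1 ^+ j /\ 2 ^+ (B * j.+1) * X <= cabs (f (z
    + w)).
    exists (z + w) => _ /=; rewrite addrAC subrr add0r; split => //; split => //=.
    rewrite addrAC; apply: le_trans (rnormD _ _) _; rewrite exprS mulrA mulfV ?mul1r //;
      lra.
  apply: contrapT => Hno.
  (* Without a next point, [S] bounds [f] on the ball of radius [2^-j] about [z]. This forces [D z]
     below half of [|f z|^n], whereas the equation and the bound on [U] force it above. *)
  pose S := 2 ^+ (B * j.+1) * X.
  have S1 : 1 <= S.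
    by rewrite -[leLHS]mul1r; apply: ler_pM => //; apply: exprn_ege1; rewrite ler1n.
  have BS w : rnorm w <= 2^-1 ^+ j -> cabs (f (z + w)) <= S.
    by move=> hw; apply: ltW; rewrite ltNge; apply/negP => h; apply: Hno; exists w.
  have hj1 : 2^-1 ^+ j <= 1 :> R by rewrite exprVn invf_le1 ?exprn_gt0 // exprn_ege1 //
    ler1n.
  have := HD z _ S (hpos j) hj1 S1 BS.
  apply/negP; rewrite -ltNge.
  have zz : rnorm (z - z0) <= 2 by have := hpos j; lra.
  have f0 : X <= cabs (f z).
    by apply: le_trans g2; rewrite ler_peMl // exprn_ege1 // ler1n.
  have DL : cabs (f z) ^+ n / 2 <= cabs (D z).
    have := HU' z zz; rewrite -E => h.
    have h1 : X ^+ n <= cabs (f z) ^+ n by apply: lerXn2r; rewrite ?nnegrE ?cabs_ge0.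
    have := cabs_subr_ge (f z ^+ n + D z) (D z).
    rewrite addrK => h2; have := cabsB (f z ^+ n + D z) (D z); rewrite addrK cabsX; lra.
  apply: lt_le_trans DL.
  rewrite ltr_pdivlMr //.
  have S0 : 0 <= S by lra.
  apply: (@le_lt_trans _ _ (2 * c * 3 ^+ K * W ^+ K * (2 ^+ j) ^+ L * S ^+ n.-1)).
    have -> : ((2^-1 ^+ j) ^+ L)^-1 = (2 ^+ j) ^+ L :> R by rewrite exprVn exprVn invrK.
    have -> : 2 * c * 3 ^+ K * W ^+ K * (2 ^+ j) ^+ L * S ^+ n.-1 =
      c * (3 * W) ^+ K * (2 ^+ j) ^+ L * S ^+ n.-1 * 2 by rewrite [(3 * W) ^+ K]exprMn;
        ring.
    apply: ler_wpM2r => //; apply: ler_pM.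
    - by rewrite !mulr_ge0 ?exprn_ge0 // addr_ge0 // rnorm_ge0.
    - exact: exprn_ge0.
    - apply: ler_wpM2r; first by rewrite exprn_ge0 // exprn_ge0.
      apply: ler_wpM2l => //; apply: lerXn2r; rewrite ?nnegrE ?addr_ge0 ?rnorm_ge0 //.
        by rewrite mulr_ge0 // ltW.
      have := rnormD z0 (z - z0); rewrite addrCA subrr addr0 /W; have := rnorm_ge0 z0; lra.
    - by apply: ler_weXn2l => //; rewrite -ltnS prednK.
  apply: (@lt_le_trans _ _ ((2 ^+ (B * j) * X) ^+ n)); last first.
    apply: lerXn2r g2; rewrite nnegrE ?cabs_ge0 //.
    by rewrite mulr_ge0 ?exprn_ge0 // ltW.
  have -> : (2 ^+ (B * j) * X) ^+ n = (2 ^+ (B * j) * X) ^+ n.-1 * (2 ^+ (B * j) * X).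
    by rewrite -exprSr prednK.
  have -> : S ^+ n.-1 = (2 ^+ (B * j) * X) ^+ n.-1 * 2 ^+ (B * n.-1).
    by rewrite /S mulnS exprD -mulrA exprMn -exprM mulrC.
  have P0 : 0 < (2 ^+ (B * j) * X) ^+ n.-1 by rewrite exprn_gt0 // mulr_gt0 // exprn_gt0.
  rewrite mulrCA ltr_pM2l //.
  apply: (@le_lt_trans _ _ (2 ^+ (B * j) * (X2 * W ^+ K))); last first.
    by rewrite ltr_pM2l // exprn_gt0.
  have -> : 2 * c * 3 ^+ K * W ^+ K * (2 ^+ j) ^+ L * 2 ^+ (B * n.-1) =
     (2 ^+ j) ^+ L * ((2 * c * 3 ^+ K * 2 ^+ (B * n.-1)) * W ^+ K) by ring.
  apply: ler_pM.
  - by rewrite exprn_ge0 // exprn_ge0.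
  - by rewrite !mulr_ge0 // ?exprn_ge0 // ltW.
  - by rewrite -exprM mulnC; apply: ler_weXn2l; rewrite ?ler1n // leq_mul2r leqnSn orbT.
  - apply: ler_wpM2r; first by rewrite exprn_ge0 // ltW.
    apply: ler_wpM2l; first by rewrite !mulr_ge0 // exprn_ge0.
    by apply: ler_weXn2l; rewrite ?ler1n // leq_mul2l leq_pred orbT.
have [nxt Hnxt] := choice step.
pose zs := fix zs j := if j is j'.+1 then nxt (j', zs j') else z0.
have Gz j : good (j, zs j).
  elim: j => [|j IH]; last by case: (Hnxt _ IH).
  by split => /=; rewrite ?subrr ?rnorm0 ?expr0 ?muln0 ?expr0 ?mul1r //; lra.
have [c1 Hc1] := @dyadic_limit zs (fun j => proj2 (Hnxt _ (Gz j))).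
have [r [M [r0 HM]]] := lb c1.
have [J HJ] := Hc1 r r0.
have [J2 HJ2] : exists J2 : nat, `|M| < J2%:R by exists (Num.bound `|M|);
  apply: archi_boundP.
pose j := maxn J J2.
have := HM _ (HJ j (leq_maxl _ _)); rewrite addrCA subrr addr0.
apply/negP; rewrite -ltNge.
have [_ /=] := Gz j; apply: lt_le_trans.
apply: le_lt_trans (ler_norm M) _; apply: lt_le_trans HJ2 _.
apply: (@le_trans _ _ (2 ^+ (B * j))); last by rewrite ler_peMr // exprn_ge0.
rewrite -natrX ler_nat; apply: leq_trans (leq_maxr J J2) _; rewrite -/j.
apply: ltnW; apply: leq_ltn_trans (ltn_expl _ (isT : 1 < 2)%N).
by rewrite leq_pmull.
Qed.

(** Once [f] has a growth bound, radius 1 suffices: on a unit ball [H] increases by at most [A],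
    which costs only constant factors. *)
Lemma growth_dbound (d : nat) f D (H : 'rV[R[i]]_m -> R) (A : R) :
  dbound f d D -> (forall z, 0 <= H z) -> 0 <= A ->
  (forall z w, H (z + w) <= H z + A * rnorm w) ->
  growth (@rnorm R m) H f -> growth (@rnorm R m) (fun z => d%:R * H z) D.
Proof.
move=> [c [K [L [c0 HD]]]] H0 A0 HL [C [N [C0 HF]]].
exists (c * ((1 + C) * 2 ^+ N * expR A) ^+ d), (K + N * d)%N; split.
  by rewrite mulr_ge0 // exprn_ge0 // !mulr_ge0 ?expR_ge0 ?exprn_ge0 // addr_ge0.
move=> z; set W := 1 + rnorm z.
have W1 : 1 <= W by rewrite lerDl rnorm_ge0.
pose S := (1 + C) * 2 ^+ N * expR A * (W ^+ N * expR (H z)).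
have S1 : 1 <= S.
  have a1 : 1 <= (1 + C) by rewrite lerDl.
  have a2 : 1 <= 2 ^+ N :> R by rewrite exprn_ege1 // ler1n.
  have a3 : 1 <= expR A by rewrite -expR0 ler_expR.
  have a4 : 1 <= expR (H z) by rewrite -expR0 ler_expR.
  have a5 : 1 <= W ^+ N by rewrite exprn_ege1.
  have mul1 (x y : R) : 1 <= x -> 1 <= y -> 1 <= x * y.
    by move=> x1 y1; rewrite -[leLHS]mul1r; apply: ler_pM.
  exact: (mul1 _ _ (mul1 _ _ (mul1 _ _ a1 a2) a3) (mul1 _ _ a5 a4)).
have := HD z 1 S ltr01 (lexx _) S1; rewrite expr1n divr1 => h.
apply: le_trans (h _) _.
  move=> w w1; apply: le_trans (HF _) _.
  apply: (@le_trans _ _ ((1 + C) * (2 * W) ^+ N * (expR (H z) * expR A))); last first.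
    by rewrite /S exprMn le_eqVlt; apply/orP; left; apply/eqP; ring.
  rewrite -expRD; apply: ler_pM.
  - by rewrite mulr_ge0 // exprn_ge0 // addr_ge0 // rnorm_ge0.
  - exact: expR_ge0.
  - apply: ler_pM => //; first by rewrite exprn_ge0 // addr_ge0 // rnorm_ge0.
      by rewrite lerDr.
    apply: lerXn2r; rewrite ?nnegrE ?addr_ge0 ?rnorm_ge0 //; first by lra.
    have := rnormD z w; rewrite /W; have := rnorm_ge0 z; lra.
  - rewrite ler_expR; apply: le_trans (HL z w) _.
    by rewrite lerD2l ler_piMr.
rewrite /S exprMn [(W ^+ N * _) ^+ d]exprMn expRM_natl exprD exprM.
by rewrite le_eqVlt; apply/orP; left; apply/eqP; ring.
Qed.

Lemma growth_derive_bound f D (H : 'rV[R[i]]_m -> R) (A : R) :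
  derive_bound f D -> 0 <= A -> (forall z w, H (z + w) <= H z + A * rnorm w) ->
  growth (@rnorm R m) H f -> growth (@rnorm R m) H D.
Proof.
move=> [c c0 [L HD]] A0 HL [C [N [C0 HF]]].
exists (c * (C * 2 ^+ N * expR A)), N; split.
  by rewrite !mulr_ge0 ?expR_ge0 ?exprn_ge0.
move=> z; set W := 1 + rnorm z.
have W1 : 1 <= W by rewrite lerDl rnorm_ge0.
have := HD z 1 (C * (2 * W) ^+ N * (expR (H z) * expR A)) ltr01 (lexx _).
rewrite expr1n divr1 => h.
apply: le_trans (h _) _; last by rewrite exprMn le_eqVlt; apply/orP; left; apply/eqP; ring.
move=> w w1; apply: le_trans (HF _) _.
rewrite -expRD; apply: ler_pM.
- by rewrite mulr_ge0 // exprn_ge0 // addr_ge0 // rnorm_ge0.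
- exact: expR_ge0.
- apply: ler_wpM2l => //.
  apply: lerXn2r; rewrite ?nnegrE ?addr_ge0 ?rnorm_ge0 //; first by lra.
  have := rnormD z w; rewrite /W; have := rnorm_ge0 z; lra.
- rewrite ler_expR; apply: le_trans (HL z w) _.
  by rewrite lerD2l ler_piMr.
Qed.

End GrowthOfSolutions.

(** * Growth on half-planes *)

Section RealExp.
Context {R : realType}.

Lemma expR_ge_poly (e : R) (K : nat) : 0 < e ->
  exists2 c, 0 < c & forall x, 0 <= x -> c * (1 + x) ^+ K <= expR (e * x).
Proof.
move=> e0; case: K => [|K].
  by exists 1 => // x x0; rewrite expr0 mulr1 -[leLHS]expR0 ler_expR mulr_ge0 // ltW.
pose a := Num.min 1 (e / K.+1%:R).
have a0 : 0 < a by rewrite lt_min ltr01 divr_gt0 // ltr0n.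
exists (a ^+ K.+1); first by rewrite exprn_gt0.
move=> x x0; rewrite -exprMn.
have -> : e * x = K.+1%:R * (e * x / K.+1%:R) by rewrite [RHS]mulrC divfK ?pnatr_eq0.
rewrite expRM_natl; apply: lerXn2r; rewrite ?nnegrE ?expR_ge0 //.
  by rewrite mulr_ge0 ?addr_ge0 // ltW.
apply: le_trans (expR_ge1Dx _); rewrite mulrDr mulr1; apply: lerD.
  by rewrite ge_min lexx.
by rewrite mulrAC ler_wpM2r // ge_min lexx orbT.
Qed.

Lemma exp_decay_eq0 (a C e : R) (K : nat) : 0 < e -> 0 <= a -> 0 <= C ->
  (forall x, 0 <= x -> a <= C * (1 + x) ^+ K * expR (- (e * x))) -> a = 0.
Proof.
move=> e0 a0 C0 H; have [c c0 Hc] := expR_ge_poly K.+1 e0.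
apply: le_anti; rewrite a0 andbT; apply/ler_addgt0Pr => d d0; rewrite add0r.
pose x := C / (c * d).
have x0 : 0 <= x by rewrite divr_ge0 // mulr_ge0 // ltW.
have x1 : 0 < 1 + x by lra.
apply: le_trans (H x x0) _; rewrite expRN ler_pdivrMr ?expR_gt0 //.
apply: (@le_trans _ _ (d * (c * (1 + x) ^+ K.+1))); last by rewrite ler_pM2l // Hc.
rewrite exprS !mulrA ler_pM2r ?exprn_gt0 //.
have -> : C = d * c * x by rewrite /x; field; rewrite !gt_eqF.
by rewrite ler_pM2l ?mulr_gt0 // lerDr.
Qed.

End RealExp.

Definition hol (R : realType) (F : R[i] -> R[i]) : Prop := exists F', hd F F'.

Section Hol.
Context {R : realType}.
Implicit Types (F G : R[i] -> R[i]).

Lemma hol_ext F G : (forall t, F t = G t) -> hol F -> hol G.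
Proof. by move=> E [F' H]; exists F'; apply: hd_ext H. Qed.

Lemma hol_cst (c : R[i]) : hol (fun=> c).
Proof. by exists (fun=> 0) => z; apply: cder_cst. Qed.

Lemma holM F G : hol F -> hol G -> hol (fun t => F t * G t).
Proof. by move=> [F' HF] [G' HG]; eexists => z; apply: cderM. Qed.

Lemma holD F G : hol F -> hol G -> hol (fun t => F t + G t).
Proof. by move=> [F' HF] [G' HG]; eexists => z; apply: cderD. Qed.

Lemma holB F G : hol F -> hol G -> hol (fun t => F t - G t).
Proof. by move=> [F' HF] [G' HG]; eexists => z; apply: cderB. Qed.

Lemma holX F n : hol F -> hol (fun t => F t ^+ n).
Proof. by move=> [F' HF]; eexists => z; apply: cderX. Qed.

Lemma hol_exp (c : R[i]) : hol (fun t => cexp (c * t)).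
Proof. by eexists => z; apply: cder_cexp_lin. Qed.

Lemma hd_poly (p : {poly R[i]}) : hd (fun t => p.[t]) (fun t => (deriv p).[t]).
Proof.
move=> z; elim/poly_ind: p => [|p c IH].
  by rewrite deriv0 horner0; apply: cder_ext (cder_cst 0 z) => t; rewrite horner0.
have := cderD (cderM IH (cder_id z)) (cder_cst c z).
have -> : (deriv (p * 'X + c%:P)).[z] = (deriv p).[z] * z + p.[z] * 1 + 0.
  by rewrite derivMXaddC !hornerE; ring.
by apply: cder_ext => t; rewrite !hornerE.
Qed.

Lemma hol_poly (p : {poly R[i]}) : hol (fun t => p.[t]).
Proof. by eexists; apply: hd_poly. Qed.

Lemma hol_prod (I : Type) (r : seq I) (F : I -> R[i] -> R[i]) :
  (forall i, hol (F i)) -> hol (fun t => \prod_(i <- r) F i t).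
Proof.
move=> H; elim: r => [|i r IH].
  by apply: hol_ext (hol_cst 1) => t; rewrite big_nil.
by apply: hol_ext (holM (H i) IH) => t; rewrite big_cons.
Qed.

Lemma hol_sum (I : Type) (r : seq I) (P : pred I) (F : I -> R[i] -> R[i]) :
  (forall i, hol (F i)) -> hol (fun t => \sum_(i <- r | P i) F i t).
Proof.
move=> H; elim: r => [|i r IH].
  by apply: hol_ext (hol_cst 0) => t; rewrite big_nil.
have [Pi|Pi] := boolP (P i).
  by apply: hol_ext (holD (H i) IH) => t; rewrite big_cons Pi.
by apply: hol_ext IH => t; rewrite big_cons (negbTE Pi).
Qed.

End Hol.

(** * Polynomials in one variable *)

Section Poly.
Context {R : realType}.
Implicit Types (p q : {poly R[i]}).

Lemma poly_lower_bound p : p != 0 -> exists c r : R, [/\ 0 < c, 0 < r &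
  forall t, r <= cabs t -> c <= cabs p.[t]].
Proof.
elim/poly_ind: p => [|p a IH]; first by rewrite eqxx.
have [->|p0] := eqVneq p 0.
  rewrite mul0r add0r polyC_eq0 => a0; exists (cabs a), 1; rewrite cabs_gt0 a0 ltr01.
  by split => // t _; rewrite hornerC.
move=> _; have [c [r [c0 r0 H]]] := IH p0.
have A0 := cabs_ge0 a.
have x0 : 0 <= cabs a / c by rewrite divr_ge0 // ltW.
exists c, (r + 1 + cabs a / c); split => //; first lra.
move=> t ht; rewrite !hornerE.
have h1 : c <= cabs p.[t] by apply: H; lra.
have h2 := cabs_subr_ge (p.[t] * t + a) a; rewrite addrK cabsM in h2.
have h3 : c * (1 + cabs a / c) <= cabs p.[t] * cabs t.
  by apply: ler_pM => //; [exact: ltW | lra | lra].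
have -> : c = c * (1 + cabs a / c) - cabs a by field; rewrite gt_eqF.
have h4 := cabsB (p.[t] * t + a) a; rewrite addrK cabsM in h4.
lra.
Qed.

(** Induction along Horner's scheme. The displacement may be proportional to [|t|], which is what
    [near_zero] produces; there the polynomial coefficients can be treated as constants. *)
Lemma poly_slow_variation p (e : R) : p != 0 -> 0 < e -> exists d r : R, [/\ 0 < d, 0 < r &
  forall t u, r <= cabs t -> cabs u <= d * cabs t -> cabs (p.[t + u] - p.[t]) <= e * cabs
    p.[t]].
Proof.
elim/poly_ind: p e => [|p a IH] e; first by rewrite eqxx.
have [->|p0] := eqVneq p 0.
  move=> _ e0; exists 1, 1; split => // t u _ _; rewrite mul0r add0r !hornerC subrr cabs0.
  by rewrite mulr_ge0 ?cabs_ge0 // ltW.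
move=> _ e0.
have e80 : 0 < Num.min (e / 8) 1 by rewrite lt_min divr_gt0 //= ltr01.
have [d [r [d0 r0 H]]] := IH _ p0 e80.
have [c [r' [c0 r'0 H']]] := poly_lower_bound p0.
have A0 := cabs_ge0 a.
have x0 : 0 <= 2 * cabs a / c by rewrite divr_ge0 ?mulr_ge0 // ltW.
exists (Num.min d (Num.min (e / 8) 1)), (r + r' + 2 * cabs a / c); split.
- by rewrite lt_min d0.
- lra.
move=> t u ht; rewrite minr_pMl ?cabs_ge0 // le_min => /andP[u1 u2].
have c1 : c <= cabs p.[t] by apply: H'; lra.
have {}H := H t u ltac:(lra) u1.
set E := Num.min (e / 8) 1 in e80 u2 H.
have E1 : E <= 1 by rewrite ge_min lexx orbT.
have E8 : E <= e / 8 by rewrite ge_min lexx.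
rewrite !hornerE.
have -> : p.[t + u] * (t + u) + a - (p.[t] * t + a) =
  (p.[t + u] - p.[t]) * (t + u) + p.[t] * u by ring.
have P0 := cabs_ge0 p.[t]; have T0 := cabs_ge0 t.
have h1 : cabs (p.[t + u] - p.[t]) * cabs (t + u) <= (E * cabs p.[t]) * (2 * cabs t).
  apply: ler_pM; rewrite ?cabs_ge0 //; apply: le_trans (cabsD _ _) _.
  have : E * cabs t <= 1 * cabs t by apply: ler_wpM2r.
  lra.
have h2 : cabs p.[t] * cabs u <= cabs p.[t] * (E * cabs t) by apply: ler_wpM2l.
have h3 : cabs p.[t] * cabs t / 2 <= cabs (p.[t] * t + a).
  have := cabsB (p.[t] * t + a) a; rewrite addrK cabsM => h3.
  have h4 : c * (2 * cabs a / c) <= cabs p.[t] * cabs t by apply: ler_pM => //;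
    [exact: ltW | lra].
  have h5 : c * (2 * cabs a / c) = 2 * cabs a by field; rewrite gt_eqF.
  rewrite h5 in h4; lra.
apply: le_trans (cabsD _ _) _; rewrite !cabsM.
have PT : 0 <= cabs p.[t] * cabs t by rewrite mulr_ge0.
have h6 : E * (cabs p.[t] * cabs t) <= e / 8 * (cabs p.[t] * cabs t) by apply: ler_wpM2r.
have h7 : e * (cabs p.[t] * cabs t / 2) <= e * cabs (p.[t] * t + a) by rewrite ler_pM2l.
have h8 : 0 <= e * (cabs p.[t] * cabs t) by rewrite mulr_ge0 // ltW.
lra.
Qed.

(** If [g t] were nonzero, [g] would be nonzero near [t], and [p] would vanish at all the points
    [t + d / (j + 2)]. *)
Lemma poly_mul_eq0 p (g : R[i] -> R[i]) : p != 0 -> (forall t, ccont g t) ->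
  (forall t, p.[t] * g t = 0) -> forall t, g t = 0.
Proof.
move=> p0 gc H t; apply/eqP; apply: contraT => gt0.
have c0 : 0 < cabs (g t) / 2 by rewrite divr_gt0 // cabs_gt0.
have [d d0 Hd] := gc t _ c0.
pose x j : R[i] := t + (d / j.+2%:R)%:C.
have xj j : root p (x j).
  have := H (x j); move/eqP; rewrite mulf_eq0 => /orP[//|/eqP gx].
  have /Hd : cabs ((d / j.+2%:R)%:C : R[i]) < d.
    rewrite cabsR gtr0_norm ?divr_gt0 ?ltr0n // ltr_pdivrMr ?ltr0n //.
    by rewrite ltr_pMr // ltr1n.
  by rewrite -/(x j) gx add0r cabsN; move: c0; lra.
have := @max_poly_roots _ p [seq x j | j <- iota 0 (size p)] p0.
rewrite size_map size_iota ltnn => -> //.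
  by apply/allP => _ /mapP[j _ ->].
rewrite map_inj_uniq ?iota_uniq // => i j /addrI /complexI /(mulfI (lt0r_neq0 d0))
  /invr_inj /eqP.
by rewrite eqr_nat => /eqP [].
Qed.

End Poly.

(* Different exponential rates are allowed on the two half-planes: p where
   Re t >= 0 and l where Re t < 0, so that p < l forces decay after division by
   a suitable exponential. *)
Definition wt (R : realType) (p l : R) (t : R[i]) : R :=
  (if 0 <= complex.Re t then p else l) * complex.Re t.

Definition Gr (R : realType) (p l : R) (F : R[i] -> R[i]) : Prop :=
  growth (@cabs R) (wt p l) F.

Section HalfPlaneGrowth.
Context {R : realType}.
Implicit Types (F G : R[i] -> R[i]) (p l c : R).

Lemma wt_lip p l (t h : R[i]) : wt p l (t + h) <= wt p l t + (`|p| + `|l|) * cabs h.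
Proof.
rewrite /wt raddfD /=; have := cabs_Re h.
set x := complex.Re t; set y := complex.Re h; rewrite ler_norml => /andP[y1 y2].
have H0 := cabs_ge0 h.
have := ler_norm p; have := ler_norm l; have := ler_norm (- p); have := ler_norm (- l).
rewrite !normrN.
set P := `|p|; set L := `|l| => a1 a2 a3 a4.
have [xy|xy] := leP 0 (x + y); have [x0|x0] := leP 0 x; nra.
Qed.

Lemma Gr_le p l p' l' F : p <= p' -> l' <= l -> Gr p l F -> Gr p' l' F.
Proof.
move=> pp ll; apply: growth_le; first exact: cabs_ge0.
move=> t; rewrite /wt; have [x0|x0] := leP 0 (complex.Re t).
  exact: ler_wpM2r.
by rewrite ler_wnM2r // ltW.
Qed.

(** The right rate comes from one bound and the left rate from the other. A right rate below the
    left one typically arises from two different expressions of the same function. *)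
Lemma Gr_mix p l p' l' F : Gr p l' F -> Gr p' l F -> Gr p l F.
Proof.
move=> [C [K [C0 H]]] [C' [K' [C'0 H']]]; exists (C + C'), (maxn K K').
split => [|t]; first exact: addr_ge0.
have s0 := @cabs_ge0 R.
have e0 := expR_ge0 (wt p l t).
have a0 : 0 <= C * (1 + cabs t) ^+ maxn K K' by rewrite mulr_ge0 // pow_size_ge0.
have b0 : 0 <= C' * (1 + cabs t) ^+ maxn K K' by rewrite mulr_ge0 // pow_size_ge0.
rewrite mulrDl mulrDl; have [x0|x0] := leP 0 (complex.Re t).
  apply: le_trans (H t) _.
  have -> : wt p l' t = wt p l t by rewrite /wt x0.
  apply: (@le_trans _ _ (C * (1 + cabs t) ^+ maxn K K' * expR (wt p l t)));
    last by rewrite lerDl mulr_ge0.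
  apply: ler_wpM2r => //; apply: ler_wpM2l => //; apply: pow_size_mono => //;
    exact: leq_maxl.
apply: le_trans (H' t) _.
have -> : wt p' l t = wt p l t by rewrite /wt leNgt x0.
apply: (@le_trans _ _ (C' * (1 + cabs t) ^+ maxn K K' * expR (wt p l t)));
  last by rewrite lerDr mulr_ge0.
apply: ler_wpM2r => //; apply: ler_wpM2l => //; apply: pow_size_mono => //; exact: leq_maxr.
Qed.

Lemma GrM p l p' l' F G : Gr p l F -> Gr p' l' G -> Gr (p + p') (l + l') (fun t => F t *
  G t).
Proof.
move=> HF HG; apply: growth_le (growthM HF HG); first exact: cabs_ge0.
by move=> t; rewrite /wt -mulrDl; case: ifP.
Qed.

Lemma GrD p l F G : Gr p l F -> Gr p l G -> Gr p l (fun t => F t + G t).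
Proof. exact: growthD (@cabs_ge0 R) _ _ _. Qed.

Lemma GrB p l F G : Gr p l F -> Gr p l G -> Gr p l (fun t => F t - G t).
Proof. exact: growthB (@cabs_ge0 R) _ _ _. Qed.

Lemma Gr_ext p l F G : (forall t, F t = G t) -> Gr p l F -> Gr p l G.
Proof. exact: growth_ext. Qed.

Lemma Gr_cst (a : R[i]) : Gr 0 0 (fun=> a).
Proof.
apply: growth_le (growth_cst (@cabs R) a); first exact: cabs_ge0.
by move=> t; rewrite /wt if_same mul0r.
Qed.

Lemma Gr_poly (q : {poly R[i]}) : Gr 0 0 (fun t => q.[t]).
Proof.
elim/poly_ind: q => [|q c IH].
  by apply: Gr_ext (Gr_cst 0) => t; rewrite horner0.
apply: Gr_ext (_ : Gr 0 0 (fun t => q.[t] * t + c)) => [t|]; first by rewrite !hornerE.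
apply: GrD; last exact: Gr_cst.
have := @GrM 0 0 0 0 _ id IH; rewrite !addr0; apply.
exists 1, 1%N; split => // t; rewrite /wt if_same mul0r expR0 mulr1 mul1r expr1.
by rewrite lerDr.
Qed.

Lemma Gr_exp c : Gr c c (fun t => cexp (c%:C * t)).
Proof.
exists 1, 0%N; split => // t; rewrite /wt if_same expr0 !mul1r cabs_cexp.
by case: t => x y /=; rewrite mul0r subr0.
Qed.

Lemma GrX p l F n : Gr p l F -> Gr (n%:R * p) (n%:R * l) (fun t => F t ^+ n).
Proof.
move=> H; apply: growth_le (growthX _ n H); try exact: cabs_ge0.
by move=> t; rewrite /wt mulrA; case: ifP.
Qed.

Lemma Gr_deriv p l F F' : hd F F' -> Gr p l F -> Gr p l F'.
Proof.
move=> D [C [K [C0 H]]]; pose A := `|p| + `|l|.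
exists (C * 2 ^+ K * expR A), K; split; first by rewrite !mulr_ge0 ?expR_ge0 ?exprn_ge0.
move=> t; have T0 := cabs_ge0 t.
have := @cauchy_estimate R F F' t 1 (C * 2 ^+ K * expR A * (1 + cabs t) ^+ K * expR (wt p
  l t)) D ltr01.
rewrite divr1; apply => h h1; apply: le_trans (H _) _.
have -> : C * 2 ^+ K * expR A * (1 + cabs t) ^+ K * expR (wt p l t) =
   C * (2 * (1 + cabs t)) ^+ K * (expR (wt p l t) * expR A) by rewrite exprMn; ring.
rewrite -expRD; apply: ler_pM; rewrite ?expR_ge0 //.
- by rewrite mulr_ge0 // pow_size_ge0 //; exact: cabs_ge0.
- apply: ler_wpM2l => //; apply: lerXn2r; rewrite ?nnegrE ?addr_ge0 ?cabs_ge0 //;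
  first by lra.
  have := cabsD t h; rewrite h1; lra.
- by rewrite ler_expR; have := wt_lip p l t h; rewrite h1 mulr1.
Qed.

Lemma Gr_cst_eq0 e l (a : R[i]) : 0 < e -> Gr (- e) l (fun=> a) -> a = 0.
Proof.
move=> e0 [C [K [C0 H]]]; apply/eqP; rewrite -cabs_eq0; apply/eqP.
apply: (@exp_decay_eq0 _ _ C e K) => //; first exact: cabs_ge0.
by move=> x x0; have := H x%:C;
  rewrite /wt -[complex.Re x%:C]/x x0 cabsR ger0_norm // mulNr.
Qed.

(** Liouville's theorem by induction on the degree [K] of a polynomial bound: [F'] decays likewise
    and has a bound of degree one less, so it vanishes, and a constant that decays along the
    positive axis is 0. *)
Lemma decay_eq0 e F F' : 0 < e -> hd F F' -> Gr (- e) e F -> forall t, F t = 0.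
Proof.
move=> e0 D G.
have [C [K [C0 H]]] : exists C K, 0 <= C /\ forall t, cabs (F t) <= C * (1 + cabs t) ^+ K.
  case: (G) => C [K [C0 H]]; exists C, K; split => // t; apply: le_trans (H t) _.
  rewrite ler_piMr ?mulr_ge0 ?pow_size_ge0 //; try exact: cabs_ge0.
  rewrite -expR0 ler_expR /wt; have [x0|x0] := leP 0 (complex.Re t); nra.
elim: K F F' D G C C0 H => [|K IH] F F' D G C C0 H.
  have F'0 t : F' t = 0.
    apply/eqP; rewrite -cabs_eq0 eq_le cabs_ge0 andbT; apply/ler_addgt0Pr => d d0;
      rewrite add0r.
    have r0 : 0 < (C + 1) / d by rewrite divr_gt0 //; lra.
    apply: le_trans (cauchy_estimate (M := C) D r0 _) _.
      by move=> h _; apply: le_trans (H _) _; rewrite expr0 mulr1.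
    rewrite ler_pdivrMr // mulrC divfK ?gt_eqF //; lra.
  move=> t; apply: (@Gr_cst_eq0 e e) => //.
  by apply: Gr_ext G => s; exact: hd0_cst D F'0 _ _.
have [F'' D'] := hd_derivable D.
have F'0 : forall t, F' t = 0.
  apply: (IH F' F'' D' (Gr_deriv D G) (C * 2 ^+ K.+1));
    first by rewrite mulr_ge0 // exprn_ge0.
  move=> t; have T0 := cabs_ge0 t; have r0 : 0 < 1 + cabs t by lra.
  have -> : C * 2 ^+ K.+1 * (1 + cabs t) ^+ K = C * (2 * (1 + cabs t)) ^+ K.+1 / (1 +
    cabs t).
    by rewrite exprMn [(1 + cabs t) ^+ K.+1]exprS; set a := 2 ^+ _;
      set b := (1 + cabs t) ^+ K; field; rewrite gt_eqF.
  apply: (cauchy_estimate D r0) => h hr; apply: le_trans (H _) _.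
  apply: ler_wpM2l => //; apply: lerXn2r; rewrite ?nnegrE ?addr_ge0 ?cabs_ge0 //;
    first by lra.
  have := cabsD t h; rewrite hr; lra.
move=> t; apply: (@Gr_cst_eq0 e e) => //.
by apply: Gr_ext G => s; exact: hd0_cst D F'0 _ _.
Qed.

(** Multiplication by [e^(- c t)], with [c] the mean of the two rates, makes the rates opposite, so
    that the product decays on both sides of the imaginary axis. *)
Theorem Gr_eq0 p l F : hol F -> Gr p l F -> p < l -> forall t, F t = 0.
Proof.
move=> hF G pl t; pose c := (p + l) / 2; pose e := (l - p) / 2.
have [F' D] := holM hF (hol_exp ((- c)%:C)).
have := GrM G (Gr_exp (- c)).
have -> : p + - c = - e by rewrite /c /e; field.
have -> : l + - c = e by rewrite /c /e; field.
move=> G'; have e0 : 0 < e by rewrite divr_gt0 // subr_gt0.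
have /eqP := decay_eq0 e0 D G' t.
by rewrite mulf_eq0 (negbTE (cexp_neq0 _)) orbF => /eqP.
Qed.

End HalfPlaneGrowth.

(** * Eliminating exponential polynomials by differentiation *)

Section Chains.
Context {R : realType}.
Implicit Types (F G : R[i] -> R[i]) (p q : {poly R[i]}).

Lemma hol_ccont F : hol F -> forall t, ccont F t.
Proof. by move=> [F' D] t; apply: cder_cont (D t). Qed.

Lemma poly_fun_eq0 p : (forall t, p.[t] = 0) -> p = 0.
Proof.
move=> H; apply: contrapT => /eqP p0.
have := poly_mul_eq0 p0 (hol_ccont (hol_cst 1)) (fun t => _ : p.[t] * 1 = 0) 0.
move=> /(_ (fun t => ltac:(by rewrite H mul0r))) /eqP; by rewrite oner_eq0.
Qed.

Lemma hd_exp (c : R) : hd (fun t => cexp (c%:C * t)) (fun t => c%:C * cexp (c%:C * t)).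
Proof. by move=> z; apply: cder_cexp_lin. Qed.

Lemma cexpcD (a b : R) (t : R[i]) :
  cexp (a%:C * t) * cexp (b%:C * t) = cexp ((a + b)%:C * t).
Proof. by rewrite -cexpD rmorphD mulrDl. Qed.

Lemma GrZ (a : R[i]) (x l : R) F : Gr x l F -> Gr x l (fun t => a * F t).
Proof. by move=> H; have := GrM (Gr_cst a) H; rewrite !add0r. Qed.

Lemma Gr_polyM p (x l : R) F : Gr x l F -> Gr x l (fun t => p.[t] * F t).
Proof. by move=> H; have := GrM (Gr_poly p) H; rewrite !add0r. Qed.

Lemma Gr_widen F (x l x' l' : R) : Gr x l F -> Gr (Num.max x x') (Num.min l l') F.
Proof. by apply: Gr_le; rewrite ?le_max ?ge_min lexx. Qed.

Lemma Gr_narrow (x l x' l' : R) F : Gr x l F -> Gr (Num.max x' x) (Num.min l' l) F.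
Proof. by apply: Gr_le; rewrite ?le_max ?ge_min lexx orbT. Qed.

(** Backwards along the chain: if the next function is 0, then [r k] is a constant times
    [e^(lam k t)]. As [lam k >= 0] and [r k] inherits the negative right rate [x], the constant is
    0. *)
Lemma chain_eq0 (x l : R) (lam : nat -> R) (r r' : nat -> R[i] -> R[i]) k :
  x < 0 -> (forall j, 0 <= lam j) -> (forall j, hd (r j) (r' j)) ->
  (forall j t, r j.+1 t = r' j t - (lam j)%:C * r j t) ->
  Gr x l (r 0%N) -> (forall t, r k t = 0) -> forall t, r 0%N t = 0.
Proof.
move=> x0 lam0 D E G.
have Gj j : Gr x l (r j).
  elim: j => [//|j IH]; apply: Gr_ext (_ : Gr x l (fun t => r' j t - (lam j)%:C * r j t))
    => [t|].
    by rewrite E.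
  by apply: GrB; [exact: Gr_deriv (D j) IH | exact: GrZ].
elim: k => [//|k IH] rk; apply: IH => t.
pose g s := r k s * cexp ((- lam k)%:C * s).
have Dg : hd g (fun=> 0).
  move=> s; have := cderM (D k s) (hd_exp (- lam k) s).
  have -> : r' k s * cexp ((- lam k)%:C * s) + r k s * ((- lam k)%:C * cexp ((- lam k)%:C
    * s)) =
     r k.+1 s * cexp ((- lam k)%:C * s) by rewrite E rmorphN; ring.
  by rewrite rk mul0r.
have Gg : Gr (- (lam k - x)) (l - lam k) (fun=> g t).
  have -> : - (lam k - x) = x + - lam k by ring.
  apply: Gr_ext (GrM (Gj k) (Gr_exp (- lam k))) => s.
  exact: (hd0_cst Dg (fun _ => erefl) s t).
have /eqP : g t = 0 by apply: Gr_cst_eq0 Gg; have := lam0 k; lra.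
by rewrite mulf_eq0 (negbTE (cexp_neq0 _)) orbF => /eqP.
Qed.

(** [V] is no zero divisor among entire functions of bounded rate; this replaces division by [V]. *)
Definition cancellable (V : R[i] -> R[i]) : Prop := forall g (x l : R),
  hol g -> Gr x l g -> (forall t, V t * g t = 0) -> forall t, g t = 0.

Lemma cancellable_poly p : p != 0 -> cancellable (fun t => p.[t]).
Proof. by move=> p0 g x l hg _ H; apply: (poly_mul_eq0 p0 (hol_ccont hg) H). Qed.

Lemma cancellable_ext V W : (forall t, V t = W t) -> cancellable V -> cancellable W.
Proof. by move=> E H g x l hg Gg Wg; apply: (H g x l hg Gg) => t; rewrite E. Qed.

(* If V g = 0 then p1 g = - e^(- sg t) p2 g, and iterating this lowers the
   growth rate of p1^k g on the right half-plane below its rate on the left. *)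
Lemma cancellable_exp p1 p2 (sg : R) : 0 < sg -> p1 != 0 ->
  cancellable (fun t => p1.[t] * cexp (sg%:C * t) + p2.[t]).
Proof.
move=> sg0 p10 g x l hg Gg H.
have E t : p1.[t] * g t = - (p2.[t] * (g t * cexp ((- sg)%:C * t))).
  have : p1.[t] * (cexp (sg%:C * t) * cexp ((- sg)%:C * t)) * g t =
      - (p2.[t] * (g t * cexp ((- sg)%:C * t))).
    have := H t; move=> /(congr1 (fun u => u * cexp ((- sg)%:C * t))).
    rewrite mul0r => h; apply/eqP; rewrite -subr_eq0 -h; apply/eqP; ring.
  by rewrite cexpcD subrr mul0r cexp0 mulr1.
have K k : exists l', Gr (x - k%:R * sg) l' (fun t => (p1 ^+ k).[t] * g t).
  elim: k => [|k [l' IH]].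
    by exists l; rewrite mul0r subr0; apply: Gr_ext Gg => t; rewrite expr0 hornerC mul1r.
  have := Gr_polyM (- p2) (GrM IH (Gr_exp (- sg))).
  have -> : x - k%:R * sg + - sg = x - k.+1%:R * sg by rewrite -[k.+1]addn1 natrD; ring.
  move=> h; exists (l' + - sg); apply: Gr_ext h => t.
  rewrite exprS hornerM hornerN; have -> : p1.[t] * (p1 ^+ k).[t] * g t = (p1 ^+ k).[t] *
    (p1.[t] * g t) by ring.
  by rewrite E; ring.
pose k := Num.bound `|(x - l) / sg|.
have kx : x - k%:R * sg < l.
  have : `|(x - l) / sg| < k%:R by apply: archi_boundP.
  move=> /(le_lt_trans (ler_norm _)); rewrite ltr_pdivrMr //; lra.
have [l' Gk] := K k.
have Gk' : Gr x l (fun t => (p1 ^+ k).[t] * g t) by apply: Gr_polyM.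
have hk : hol (fun t => (p1 ^+ k).[t] * g t) by apply: holM hg; exact: hol_poly.
have Z := Gr_eq0 hk (Gr_mix Gk Gk') kx.
exact: (poly_mul_eq0 (expf_neq0 k p10) (hol_ccont hg) Z).
Qed.

(** With [V = p1 e^(sg t) + p2], the last hypothesis reads [V S' = V' S]: formally [S / V] is
    constant. Differentiating [size p2] times and then applying [d/dt - sg] often enough annihilates
    [V]. The same operators act on [S], and the relation [V s_j = v_j S] carries the annihilation
    over, so [chain_eq0] applies to the decaying [S]. *)
Lemma wronskian_eq0 p1 p2 (sg x l : R) S S' : 0 <= sg -> x < 0 ->
  cancellable (fun t => p1.[t] * cexp (sg%:C * t) + p2.[t]) ->
  hd S S' -> Gr x l S ->
  (forall t, (p1.[t] * cexp (sg%:C * t) + p2.[t]) * S' t =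
     ((deriv p1 + sg%:C *: p1).[t] * cexp (sg%:C * t) + (deriv p2).[t]) * S t) ->
  forall t, S t = 0.
Proof.
move=> sg0 x0 cV DS GS HV.
pose A := size p2; pose lam j := if (j < A)%N then 0 else sg.
have lam0 j : 0 <= lam j by rewrite /lam; case: ifP.
pose a := fix a j := if j is i.+1 then deriv (a i) + (sg - lam i)%:C *: a i else p1.
pose b := fix b j := if j is i.+1 then deriv (b i) - (lam i)%:C *: b i else p2.
have bE j : (j <= A)%N -> b j = derivn j p2.
  elim: j => [//|j IH] jA.
  by rewrite derivnS [LHS]/= IH ?(ltnW jA) // /lam jA scale0r subr0.
have bA i : b (A + i)%N = 0.
  elim: i => [|i IH]; first by rewrite addn0 bE // derivn_poly0.
  by rewrite addnS /= IH scaler0 subr0 deriv0.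
have aA i : a (A + i)%N = derivn i (a A).
  elim: i => [|i IH]; first by rewrite addn0.
  by rewrite addnS derivnS [LHS]/= IH /lam ltnNge leq_addr /= subrr scale0r addr0.
pose k := (A + size (a A))%N.
have ak : a k = 0 by rewrite aA derivn_poly0.
pose v j t := (a j).[t] * cexp (sg%:C * t) + (b j).[t].
pose v' j t := (deriv (a j) + sg%:C *: a j).[t] * cexp (sg%:C * t) + (deriv (b j)).[t].
have Dv j : hd (v j) (v' j).
  move=> z; rewrite /v' hornerD hornerZ.
  have := cderD (cderM (hd_poly (a j) z) (hd_exp sg z)) (hd_poly (b j) z).
  by congr (cder _ _ _); ring.
have vS j t : v j.+1 t = v' j t - (lam j)%:C * v j t.
  rewrite -[LHS]/((deriv (a j) + (sg - lam j)%:C *: a j).[t] * cexp (sg%:C * t)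
    + (deriv (b j) - (lam j)%:C *: b j).[t]).
  by rewrite /v /v' !(hornerD, hornerN, hornerZ) rmorphB; ring.
have Gv j : Gr sg 0 (v j).
  apply: GrD; last by apply: Gr_le (Gr_poly _).
  by apply: Gr_polyM; apply: Gr_le (Gr_exp sg).
have /choice [nx Hnx] : forall G, exists G', hol G -> hd G G'.
  by move=> G; have [[G' H]|h] := pselect (hol G); [exists G' | exists G].
pose s := fix s j := if j is i.+1 then (fun t => nx (s i) t - (lam i)%:C * s i t) else S.
have hs j : hol (s j).
  elim: j => [|j IH]; first by exists S'.
  apply: holB; last by apply: holM => //; exact: hol_cst.
  by have [f'' H] := hd_derivable (Hnx _ IH); exists f''.
have Ds j : hd (s j) (nx (s j)) by apply: Hnx; exact: hs.
have Gs j : Gr x l (s j).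
  elim: j => [//|j IH]; apply: GrB; last exact: GrZ.
  exact: Gr_deriv (Ds j) IH.
have S'E t : nx S t = S' t by apply: hd_uniq (Ds 0%N) DS t.
have Vs j t : v 0%N t * s j t = v j t * S t.
  elim: j t => [//|j IH] t.
  have hv i : hol (v i) by exists (v' i).
  have [S'' DS'] := hd_derivable DS.
  have hv' : hol (v' 0%N) by have [f'' H] := hd_derivable (Dv 0%N); exists f''.
  have Gv' : Gr sg 0 (v' 0%N) by apply: Gr_deriv (Dv 0%N) (Gv 0%N).
  have HVt u : v 0%N u * S' u = v' 0%N u * S u by rewrite /v /v' /= HV.
  have C1 u : v' 0%N u * s j u - v j u * S' u = 0.
    apply: (cV (fun u => v' 0%N u * s j u - v j u * S' u) (sg + x) (0 + l)).
    - by apply: holB; apply: holM => //; exists S''.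
    - by apply: GrB; apply: GrM => //; apply: Gr_deriv GS.
    - move=> w; rewrite -/(v 0%N w).
      have -> : v 0%N w * (v' 0%N w * s j w - v j w * S' w) =
        v' 0%N w * (v 0%N w * s j w) - v j w * (v 0%N w * S' w) by ring.
      by rewrite IH HVt; ring.
  have D1 := cderM (Dv 0%N t) (Ds j t).
  have D2 := cderM (Dv j t) (DS t).
  have D1' := cder_ext IH D1.
  have := cder_uniq D1' D2; have := C1 t.
  move=> /eqP; rewrite subr_eq0 => /eqP -> /eqP.
  rewrite addrC => /eqP /addIr h.
  by rewrite vS /= mulrBr mulrBl h -!mulrA -IH; ring.
have sk t : s k t = 0.
  apply: (cV (s k) x l (hs k) (Gs k)) => u; rewrite -[LHS]/(v 0%N u * s k u) Vs.
  by rewrite /v ak bA !horner0 mul0r addr0 mul0r.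
exact: (chain_eq0 x0 lam0 Ds _ GS sk).
Qed.

End Chains.

(** * The equation on a line, real ratio of the frequencies *)

Section RealRatio.
Context {R : realType}.
Variables (n : nat) (n4 : (4 <= n)%N) (p1 p2 : {poly R[i]}) (rho : R).
Hypotheses (p10 : p1 != 0) (p20 : p2 != 0).
Hypotheses (rho1 : -1 < rho) (rho2 : rho < 1) (rho0 : rho != 0).
Variables (F F' Q Q' : R[i] -> R[i]).
Hypotheses (DF : hd F F') (DQ : hd Q Q').
(** The exponent [max (0, Re t, rho Re t)] has rate 1 on the right and [mu = min (0, rho)] on the
    left; [nu = 1 / n] is the share of [F]. *)
Variables (nu mu : R).
Hypotheses (nuE : nu = n%:R^-1) (muE : mu = Num.min 0 rho).
Hypotheses (nu0 : 0 < nu) (nu4 : nu <= 1 / 4) (mu0 : mu <= 0) (mu1 : -1 < mu).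
Hypotheses (GF : Gr nu (mu * nu) F) (GQ : Gr (1 - 3 * nu) ((1 - 3 * nu) * mu) Q).
Let ex (c : R) (t : R[i]) : R[i] := cexp (c%:C * t).
Let U t := p1.[t] * ex 1 t + p2.[t] * ex rho t.
Hypothesis HE : forall t, F t ^+ n + Q t = U t.

Let q1 := deriv p1 + p1.
Let q2 := deriv p2 + rho%:C *: p2.
Let U' t := q1.[t] * ex 1 t + q2.[t] * ex rho t.
Let N : R[i] := n%:R.

Let n0 : (0 < n)%N. Proof. exact: leq_trans n4. Qed.

Lemma exD a b t : ex a t * ex b t = ex (a + b) t.
Proof. exact: cexpcD. Qed.

Lemma ex0 t : ex 0 t = 1.
Proof. by rewrite /ex mul0r cexp0. Qed.

Lemma hd_ex a : hd (ex a) (fun t => a%:C * ex a t).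
Proof. exact: hd_exp. Qed.

Lemma Gr_ex a : Gr a a (ex a).
Proof. exact: Gr_exp. Qed.

Lemma ex_neq0 a t : ex a t != 0.
Proof. exact: cexp_neq0. Qed.

Lemma DU : hd U U'.
Proof.
move=> z.
have := cderD (cderM (hd_poly p1 z) (hd_ex 1 z)) (cderM (hd_poly p2 z) (hd_ex rho z)).
by congr (cder _ _ _); rewrite /U' /q1 /q2 !(hornerD, hornerZ) rmorph1; ring.
Qed.

Let FnS t : F t ^+ n = F t ^+ n.-1 * F t.
Proof. by rewrite -exprSr prednK. Qed.

Lemma deriv_equation t : N * F t ^+ n.-1 * F' t + Q' t = U' t.
Proof.
have := cderD (cderX n (DF t)) (DQ t).
by move=> /(cder_ext HE) /cder_uniq H; apply: H; exact: DU.
Qed.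

(** Obtained by eliminating [F^n] between the equation and its derivative. The powers of [F] cancel,
    and [Phi] is only as large as [Q F'], although [U] alone has right rate 1. *)
Let Phi t := N * U t * F' t - U' t * F t.

Lemma PhiE t : Phi t = N * (Q t * F' t) - Q' t * F t.
Proof. by rewrite /Phi -HE -deriv_equation FnS; ring. Qed.

Let GF' : Gr nu (mu * nu) F'. Proof. exact: Gr_deriv DF GF. Qed.
Let GQ' : Gr (1 - 3 * nu) ((1 - 3 * nu) * mu) Q'. Proof. exact: Gr_deriv DQ GQ. Qed.

Lemma GPhi : Gr (1 - 2 * nu) ((1 - 2 * nu) * mu) Phi.
Proof.
have E1 : 1 - 2 * nu = 1 - 3 * nu + nu by ring.
have E2 : (1 - 2 * nu) * mu = (1 - 3 * nu) * mu + mu * nu by ring.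
apply: (@Gr_ext _ _ _ (fun t => N * (Q t * F' t) - Q' t * F t)) => [t|];
  first by rewrite PhiE.
rewrite E2 {1}E1; apply: GrB; last exact: GrM.
by apply: GrZ; apply: GrM.
Qed.

Let Phi1 t := N * (p1.[t] * F' t) - q1.[t] * F t.
Let Phi2 t := N * (p2.[t] * F' t) - q2.[t] * F t.

Lemma Phi_split t : Phi t = Phi1 t * ex 1 t + Phi2 t * ex rho t.
Proof. by rewrite /Phi /Phi1 /Phi2 /U /U'; ring. Qed.

Let GPhi1 : Gr nu (mu * nu) Phi1.
Proof. by apply: GrB; [apply: GrZ|]; exact: Gr_polyM. Qed.
Let GPhi2 : Gr nu (mu * nu) Phi2.
Proof. by apply: GrB; [apply: GrZ|]; exact: Gr_polyM. Qed.

(* Phi1 = n p1 F' - (p1' + p1) F decays too fast not to vanish, which makes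
   F^n e^(- t) a multiple of p1. *)
Lemma power_eq_of_small_ratio : rho < 1 - nu -> forall t, F t ^+ n = p1.[t] * ex 1 t.
Proof.
move=> rs; have [nu0' nu4'] := (nu0, nu4); have [mu0' mu1'] := (mu0, mu1);
  have [rho1' rho2'] := (rho1, rho2).
have hF' : hol F' by have [f H] := hd_derivable DF; exists f.
have hF : hol F by exists F'.
have P1 t : Phi1 t = (Phi t - Phi2 t * ex rho t) * ex (-1) t.
  by rewrite Phi_split addrK -mulrA exD subrr ex0 mulr1.
have Z1 : forall t, Phi1 t = 0.
  (* On the right [Phi1] is bounded through [P1], on the left directly; the left rate [L - 1] that
     comes with [P1] is discarded by [Gr_mix]. The right rate [M - 1] is below [mu * nu] because
     [mu > -2] and, for [rho >= 0], because [rho < 1 - nu]; for [rho < 0] the product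
     [(1 - nu) (1 - rho)] is positive. *)
  pose M := Num.max (1 - 2 * nu) (nu + rho).
  pose L := Num.min ((1 - 2 * nu) * mu) (mu * nu + rho).
  apply: (@Gr_eq0 _ (M + - 1) (mu * nu)).
  - apply: holB; apply: holM.
    + exact: hol_cst.
    + by apply: holM => //; exact: hol_poly.
    + exact: hol_poly.
    + exact: hF.
  - apply: (@Gr_mix _ _ _ _ (L + -1) _ _ GPhi1).
    apply: (Gr_ext (fun t => esym (P1 t))); apply: GrM; last exact: Gr_ex.
    apply: GrB; first exact: Gr_widen GPhi.
    exact/Gr_narrow/GrM/Gr_ex.
  - rewrite ltrBlDr gt_max; apply/andP; split.
      have : 0 < nu * (mu + 2) by apply: mulr_gt0; lra.
      lra.
    have [r0|r0] := leP 0 rho; first by rewrite muE min_l //; lra.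
    rewrite muE min_r ?(ltW r0) //.
    have : 0 < (1 - nu) * (1 - rho) by apply: mulr_gt0; lra.
    lra.
(* By [Z1], [r = F^n e^(- t) - p1] satisfies the Wronskian relation with [p1]. Written through [Q]
   it decays on the right, so [wronskian_eq0] with [sg = 0] shows that it vanishes. *)
pose r t := p2.[t] * ex (rho - 1) t - Q t * ex (-1) t.
have rE t : r t = F t ^+ n * ex (-1) t - p1.[t].
  rewrite -[F t ^+ n](addrK (Q t)) HE /r /U -!exD.
  have := exD 1 (-1) t; rewrite subrr ex0 => e.
  transitivity (p1.[t] * (ex 1 t * ex (-1) t) + p2.[t] * (ex rho t * ex (-1) t) - Q t *
    ex (-1) t - p1.[t]); last by ring.
  by rewrite e; ring.
pose y' t := (N * F t ^+ n.-1 * F' t) * ex (-1) t + F t ^+ n * ((-1)%:C * ex (-1) t) -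
  (deriv p1).[t].
have Dr : hd r y'.
  move=> z; apply: (cder_ext (fun t => esym (rE t))).
  apply: cderB (hd_poly p1 z); apply: cderM (cderX n (DF z)) (hd_ex (-1) z).
have Z : forall t, r t = 0.
  pose x := Num.max (rho - 1) (1 - 3 * nu + - 1).
  apply: (@wronskian_eq0 _ p1 0 0 x (Num.min (rho - 1) ((1 - 3 * nu) * mu + -1)) r y') =>
    //.
  - rewrite gt_max; apply/andP; split; lra.
  - apply: cancellable_ext (cancellable_poly p10) => t.
    by rewrite /= rmorph0 mul0r cexp0 horner0 addr0 mulr1.
  - apply: GrB; first by apply: Gr_widen; apply: Gr_polyM; exact: Gr_ex.
    apply: Gr_narrow; exact/GrM/Gr_ex.
  - move=> t; rewrite rmorph0 mul0r cexp0 deriv0 !horner0 !addr0 !mulr1 scale0r addr0.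
    rewrite rE /y' rmorphN rmorph1 FnS.
    have := Z1 t; rewrite /Phi1 /q1 hornerD => /eqP; rewrite subr_eq0 => /eqP h.
    transitivity (F t ^+ n.-1 * (N * (p1.[t] * F' t)) * ex (-1) t - p1.[t] * F t ^+ n.-1
      * F t * ex (-1) t - p1.[t] * (deriv p1).[t]); first by ring.
    by rewrite h; ring.
move=> t; have := Z t; rewrite rE => /eqP; rewrite subr_eq0 => /eqP <-.
by rewrite -mulrA exD addNr ex0 mulr1.
Qed.

(* Here Phi itself vanishes, hence Q = 0 and F^n = U; but the exponential
   polynomial U e^(- rho t) is not an n-th power. *)
Lemma large_ratio_absurd : 1 - nu <= rho -> False.
Proof.
move=> rl; have [nu0' nu4'] := (nu0, nu4); have [mu0' mu1'] := (mu0, mu1);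
  have [rho1' rho2'] := (rho1, rho2).
have r0 : 0 < rho by lra.
have mu_0 : mu = 0 by rewrite muE min_l // ltW.
pose sg := 1 - rho.
have sg0 : 0 < sg by rewrite /sg; lra.
have hF' : hol F' by have [f H] := hd_derivable DF; exists f.
have hF : hol F by exists F'.
have hU : hol U by exists U'; exact: DU.
have hU' : hol U' by have [f H] := hd_derivable DU; exists f.
have GU : Gr 1 rho U.
  apply: GrD; apply: Gr_polyM; first by apply: Gr_le (Gr_ex 1); lra.
  by apply: Gr_le (Gr_ex rho); lra.
have GU' : Gr 1 rho U' by apply: Gr_deriv GU; exact: DU.
(* The right rate [1 - 2 nu] comes from [GPhi], the left rate [rho] from the definition of [Phi]
   with [mu = 0]; the former is smaller since [1 - nu <= rho]. *)
have PhiZ : forall t, Phi t = 0.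
  apply: (@Gr_eq0 _ (1 - 2 * nu) rho); last lra.
    by apply: holB; apply: holM => //; apply: holM => //; exact: hol_cst.
  apply: (@Gr_mix _ _ _ (1 + nu) _ _ GPhi).
  have Er : rho = rho + mu * nu by rewrite mu_0; ring.
  rewrite [X in Gr _ X]Er; apply: GrB; last exact: GrM.
  by apply: GrM => //; exact: GrZ.
pose V t := p1.[t] * ex sg t + p2.[t].
have VE t : V t = U t * ex (- rho) t.
  transitivity (p1.[t] * (ex 1 t * ex (- rho) t) + p2.[t] * (ex rho t * ex (- rho) t));
    last by rewrite /U; ring.
  by rewrite !exD subrr ex0 mulr1.
pose q1s := deriv p1 + sg%:C *: p1.
pose V' t := q1s.[t] * ex sg t + (deriv p2).[t].
have DV : hd V V'.
  move=> z; have := cderD (cderM (hd_poly p1 z) (hd_ex sg z)) (hd_poly p2 z).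
  by congr (cder _ _ _); rewrite /V' /q1s !(hornerD, hornerZ); ring.
have DV2 : hd V (fun t => U' t * ex (- rho) t + U t * ((- rho)%:C * ex (- rho) t)).
  move=> z; apply: (cder_ext (fun t => esym (VE t))).
  exact: cderM (DU z) (hd_ex (- rho) z).
have V'E := hd_uniq DV DV2.
(* [Phi = 0] gives [U Q' = U' Q], hence [V s' = V' s], and [s] has the negative right rate
   [1 - 3 nu - rho]. *)
pose s t := Q t * ex (- rho) t.
pose s' t := Q' t * ex (- rho) t + Q t * ((- rho)%:C * ex (- rho) t).
have Ds : hd s s' by move=> z; apply: cderM (DQ z) (hd_ex (- rho) z).
have UQ t : U t * Q' t = U' t * Q t.
  have h1 := deriv_equation t; have h2 := HE t; have := PhiZ t.
  rewrite /Phi => /eqP; rewrite subr_eq0 => /eqP h3.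
  have -> : Q' t = U' t - N * F t ^+ n.-1 * F' t by rewrite -h1; ring.
  have -> : Q t = U t - F t ^+ n by rewrite -h2; ring.
  transitivity (U t * U' t - F t ^+ n.-1 * (N * U t * F' t)); first by ring.
  by rewrite h3 FnS; ring.
have cV := @cancellable_exp R p1 p2 sg sg0 p10.
have sZ : forall t, s t = 0.
  apply: (@wronskian_eq0 _ p1 p2 sg (1 - 3 * nu + - rho) _ s s' (ltW sg0) _ cV Ds).
  - lra.
  - apply: GrM GQ _; exact: Gr_ex.
  - move=> t; rewrite -[LHS]/(V t * s' t) -[RHS]/(V' t * s t) V'E VE /s /s'.
    transitivity (U t * Q' t * (ex (- rho) t * ex (- rho) t) + U t * ex (- rho) t * Q t *
      ((- rho)%:C * ex (- rho) t)); first by ring.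
    by rewrite UQ; ring.
have QZ t : Q t = 0.
  by have /eqP := sZ t; rewrite mulf_eq0 (negbTE (ex_neq0 _ _)) orbF => /eqP.
pose G t := F t * ex (- (rho * nu)) t.
have GnV t : G t ^+ n = V t.
  rewrite /G exprMn -[F t ^+ n](addrK (Q t)) HE QZ subr0 VE; congr (_ * _).
  rewrite /ex -cexpM_nat; congr cexp.
  have -> : (n%:R : R[i]) = (n%:R : R)%:C by rewrite rmorph_nat.
  rewrite mulrA -rmorphM; congr (_%:C * _).
  by rewrite nuE; field; rewrite pnatr_eq0 -lt0n.
pose G' t := F' t * ex (- (rho * nu)) t + F t * ((- (rho * nu))%:C * ex (- (rho * nu)) t).
have DG : hd G G' by move=> z; apply: cderM (DF z) (hd_ex _ z).
have hG : hol G by exists G'.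
have hG' : hol G' by have [f H] := hd_derivable DG; exists f.
have GG : Gr (sg * nu) 0 G.
  apply: (@growth_root _ _ (@cabs R) (@cabs_ge0 R) _ _ n n0).
  apply: growth_ext (fun t => esym (GnV t)) _.
  apply: growth_le (_ : growth _ (wt sg 0) V); first exact: cabs_ge0.
    move=> t; rewrite /wt; have [t0|t0] := leP 0 (complex.Re t);
      last by rewrite !mul0r mulr0.
    by rewrite mulrA nuE [sg * _]mulrC mulrA divff ?mul1r // pnatr_eq0 -lt0n.
  apply: GrD; first by apply: Gr_polyM; apply: Gr_le (Gr_ex sg) => //; exact: ltW.
  by apply: Gr_le (Gr_poly p2) => //; exact: ltW.
have GG' : Gr (sg * nu) 0 G' by apply: Gr_deriv GG.
have VG t : N * V t * G' t = V' t * G t.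
  have h : N * G t ^+ n.-1 * G' t = V' t.
    by have := cder_ext GnV (cderX n (DG t)); move=> /cder_uniq; apply; exact: DV.
  have e : G t ^+ n = G t ^+ n.-1 * G t by rewrite -exprSr prednK.
  by rewrite -h -GnV e; ring.
(* The coefficients of [e^(sg t)] and 1 in [n V G' - V' G = 0]. Hence [Psi1 = - Psi2 e^(- sg t)] has
   right rate [sg nu - sg < 0], while its left rate is 0. *)
pose Psi1 t := N * (p1.[t] * G' t) - q1s.[t] * G t.
pose Psi2 t := N * (p2.[t] * G' t) - (deriv p2).[t] * G t.
have PsiE t : Psi1 t = - (Psi2 t * ex (- sg) t).
  have : (Psi1 t * ex sg t + Psi2 t) * ex (- sg) t = 0.
    have -> : Psi1 t * ex sg t + Psi2 t = N * V t * G' t - V' t * G t.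
      by rewrite /Psi1 /Psi2 /V /V'; ring.
    by rewrite VG subrr mul0r.
  by rewrite mulrDl -mulrA exD subrr ex0 mulr1 => /eqP; rewrite addr_eq0 => /eqP.
have Psi1Z : forall t, Psi1 t = 0.
  apply: (@Gr_eq0 _ (sg * nu + - sg) 0).
  - apply: holB; apply: holM; [exact: hol_cst | | exact: hol_poly | exact: hG].
    by apply: holM hG'; exact: hol_poly.
  - apply: (@Gr_mix _ _ _ (sg * nu) (0 + - sg)).
      apply: (Gr_ext (fun t => esym (PsiE t))).
      apply: (Gr_ext (_ : forall t, -1 * (Psi2 t * ex (- sg) t) = _)) => [t|];
        first by rewrite mulN1r.
      apply: GrZ; apply: GrM; last exact: Gr_ex.
      by apply: GrB; [apply: GrZ|]; exact: Gr_polyM.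
    by apply: GrB; [apply: GrZ|]; exact: Gr_polyM.
  - nra.
have Psi2Z t : Psi2 t = 0.
  have := PsiE t; rewrite Psi1Z => /eqP; rewrite eq_sym oppr_eq0 mulf_eq0.
  by rewrite (negbTE (ex_neq0 _ _)) orbF => /eqP.
(* The determinant of the system [Psi1 = Psi2 = 0] in [G'] and [G], up to constants. Its part
   [sg p1 p2] has larger degree than the parts with a derivative, so [W] is nonzero and [G]
   vanishes. *)
pose W := p2 * q1s - p1 * deriv p2.
have W0 : W != 0.
  apply/eqP => W0.
  have sE : sg%:C *: (p1 * p2) = p1 * deriv p2 - deriv p1 * p2.
    apply/eqP; rewrite -subr_eq0 -W0 /W /q1s; apply/eqP.
    by rewrite -!mul_polyC; ring.
  have sgC : sg%:C != 0 :> R[i] by rewrite -cabs_gt0 cabsR normr_gt0 gt_eqF.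
  have := congr1 (fun q : {poly R[i]} => size q) sE.
  rewrite size_scale // size_mul // => sz.
  have l1 : (size (p1 * deriv p2)%R < (size p1 + size p2).-1)%N.
    apply: leq_ltn_trans (size_polyMleq _ _) _.
    have := lt_size_deriv p20; have : (0 < size p1)%N by rewrite size_poly_gt0.
    by case: (size p1) => // a _ /=; rewrite ltn_add2l.
  have l2 : (size (deriv p1 * p2)%R < (size p1 + size p2).-1)%N.
    apply: leq_ltn_trans (size_polyMleq _ _) _.
    have := lt_size_deriv p10; have : (0 < size p2)%N by rewrite size_poly_gt0.
    by case: (size p2) => // a _ /=; rewrite !addnS /= ltn_add2r.
  have := size_polyD (p1 * deriv p2) (- (deriv p1 * p2)).
  by rewrite -sz size_polyN leqNgt gtn_max l1 l2.
have GZ : forall t, G t = 0.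
  apply: (poly_mul_eq0 W0 (hol_ccont hG)) => t.
  rewrite /W hornerD hornerN !hornerM; have := Psi1Z t; have := Psi2Z t;
    rewrite /Psi1 /Psi2.
  move=> /eqP; rewrite subr_eq0 => /eqP h1 /eqP; rewrite subr_eq0 => /eqP h2.
  transitivity (p2.[t] * (q1s.[t] * G t) - p1.[t] * ((deriv p2).[t] * G t)); first by ring.
  by rewrite -h1 -h2; ring.
have VZ t : V t = 0 by rewrite -GnV GZ expr0n eqn0Ngt n0.
(* Now [V = G^n = 0], so [p1 = - p2 e^(- sg t)] decays on the right. *)
move/negP: p10; apply; apply/eqP; apply: poly_fun_eq0.
apply: (@Gr_eq0 _ (0 + - sg) 0); first exact: hol_poly.
- apply: (@Gr_mix _ _ _ 0 (0 + - sg)); last exact: Gr_poly.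
  apply: (Gr_ext (_ : forall t, (- p2).[t] * ex (- sg) t = _)) => [t|]; last first.
    by apply: GrM; [exact: Gr_poly | exact: Gr_ex].
  have := VZ t; rewrite /V => /eqP; rewrite addrC addr_eq0 => /eqP h.
  by rewrite hornerN h opprK -mulrA exD subrr ex0 mulr1.
- by rewrite add0r oppr_lt0.
Qed.

Lemma real_ratio_aux : 0 < rho /\ forall t, F t ^+ n = p1.[t] * cexp t.
Proof.
have [nu0' nu4'] := (nu0, nu4); have [mu0' mu1'] := (mu0, mu1);
  have [rho1' rho2'] := (rho1, rho2).
have [rs|rl] := ltP rho (1 - nu); last by case: (large_ratio_absurd rl).
have FE := power_eq_of_small_ratio rs.
have FE' t : F t ^+ n = p1.[t] * cexp t by rewrite FE /ex mul1r.
(* For negative [rho], the equation leaves [Q = p2 e^(rho t)], and the left rate [(1 - 3 nu) rho] of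
   [Q] is too weak for this: [p2] would have the positive left rate [- 3 nu rho]. *)
split => //; rewrite lt_neqAle eq_sym rho0 /= leNgt; apply/negP => r0.
have mu_r : mu = rho by rewrite muE min_r // ltW.
move/negP: p20; apply; apply/eqP; apply: poly_fun_eq0.
apply: (@Gr_eq0 _ 0 ((1 - 3 * nu) * rho + - rho)); first exact: hol_poly.
- apply: (@Gr_mix _ _ _ (1 - 3 * nu + - rho) 0); first exact: Gr_poly.
  have E t : Q t * ex (- rho) t = p2.[t].
    have := HE t; rewrite FE /U => /addrI ->.
    by rewrite -mulrA exD subrr ex0 mulr1.
  by apply: (Gr_ext E); rewrite -mu_r; apply: GrM GQ _; rewrite mu_r; exact: Gr_ex.
- nra.
Qed.

End RealRatio.

Theorem real_ratio (R : realType) (n : nat) (p1 p2 : {poly R[i]}) (rho : R)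
  (F F' Q Q' : R[i] -> R[i]) : (4 <= n)%N -> p1 != 0 -> p2 != 0 ->
  -1 < rho -> rho < 1 -> rho != 0 -> hd F F' -> hd Q Q' ->
  Gr n%:R^-1 (Num.min 0 rho * n%:R^-1) F ->
  Gr (1 - 3 * n%:R^-1) ((1 - 3 * n%:R^-1) * Num.min 0 rho) Q ->
  (forall t, F t ^+ n + Q t = p1.[t] * cexp (1%:C * t) + p2.[t] * cexp (rho%:C * t)) ->
  0 < rho /\ forall t, F t ^+ n = p1.[t] * cexp t.
Proof.
move=> n4 p10 p20 r1 r2 r0 DF DQ GF GQ HE.
have n0 : (0 < n)%N by apply: leq_trans n4.
apply: (real_ratio_aux n4 p10 p20 r1 r2 r0 DF DQ erefl erefl _ _ _ _ GF GQ HE).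
- by rewrite invr_gt0 ltr0n.
- by rewrite mul1r lef_pV2 ?posrE ?ltr0n // ler_nat.
- by rewrite ge_min lexx.
- by rewrite lt_min r1 andbT; lra.
Qed.

(** * The equation on a line, nonreal ratio of the frequencies *)

Section NonrealRatio.
Context {R : realType}.
Implicit Types (p : {poly R[i]}).

(** A logarithm with argument in [[- pi, pi]]; the bound serves to control the displacement in
    [near_zero]. *)
Lemma cexp_log (y : R[i]) : y != 0 ->
  exists2 v, cexp v = y & cabs v <= `|ln (cabs y)| + pi.
Proof.
move=> y0; have Y0 : 0 < cabs y by rewrite cabs_gt0.
pose z := y / (cabs y)%:C.
have z1 : cabs z = 1 by rewrite cabsM cabsV cabsR gtr0_norm // divff ?gt_eqF.
have yE : y = (cabs y)%:C * z.
  by rewrite /z mulrC divfK // -cabs_gt0 cabsR normr_gt0 gt_eqF.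
have [th [th4 zE]] : exists th : R, `|th| <= pi /\ z = cos th +i* sin th.
  have pi0 := pi_ge0 R.
  case: z z1 {yE} => a b; rewrite /cabs /= => z1.
  have ab : a ^+ 2 + b ^+ 2 = 1.
    rewrite -(@sqr_sqrtr _ (a ^+ 2 + b ^+ 2)) ?addr_ge0 ?sqr_ge0 // z1 expr1n //.
  have a1 : -1 <= a <= 1.
    have : a ^+ 2 <= 1 by have := sqr_ge0 b; lra.
    by move=> h; apply/andP; split; nra.
  have a1' : a \in `[(-1), 1] by rewrite in_itv.
  have s2 : sin (acos a) ^+ 2 = b ^+ 2.
    by have := cos2Dsin2 (acos a); rewrite (acosK a1'); lra.
  have A0 := acos_ge0 a1; have A1 := acos_lepi a1.
  have /eqP := s2; rewrite eqf_sqr => /orP[/eqP h|/eqP h].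
    exists (acos a); rewrite ger0_norm // (acosK a1') h; by split.
  exists (- acos a); rewrite normrN ger0_norm // cosN sinN (acosK a1') h opprK; by split.
exists (ln (cabs y) +i* th).
  by rewrite /cexp /= lnK ?posrE // -zE -yE.
by apply: le_trans (cabs_ReIm _) _; rewrite /= lerD2l.
Qed.

Lemma poly_subexponential p (e : R) : p != 0 -> 0 < e -> exists B r : R,
  [/\ 1 <= B, 0 < r & forall t, r <= cabs t ->
    cabs p.[t] <= B * expR (e * cabs t) /\ 1 <= B * cabs p.[t]].
Proof.
move=> p0 e0; have [C [K [C0 H]]] := Gr_poly p.
have [c c0 Hc] := expR_ge_poly K e0.
have [c' [r [c'0 r0 H']]] := poly_lower_bound p0.
have a0 : 0 <= C / c by rewrite divr_ge0 // ltW.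
have b0 : 0 < c'^-1 by rewrite invr_gt0.
exists (1 + C / c + c'^-1), r; split => //; first by lra.
move=> t rt; split.
  apply: le_trans (H t) _; rewrite /wt if_same mul0r expR0 mulr1.
  apply: (@le_trans _ _ (C / c * expR (e * cabs t))).
    rewrite -mulrA; apply: ler_wpM2l => //.
    by rewrite mulrC ler_pdivlMr // mulrC; apply: Hc; exact: cabs_ge0.
  apply: ler_wpM2r; [exact: expR_ge0 | lra].
have h := H' t rt.
have : c'^-1 * c' <= (1 + C / c + c'^-1) * cabs p.[t].
  by apply: ler_pM => //; [exact: ltW | exact: ltW | lra].
by rewrite mulVf // gt_eqF.
Qed.

(** With the polynomials frozen at [T], solving for [u] means taking a logarithm of
    [y = - (p1 / p2)(T) e^(- c T)]. Since [Re (c T) = 0], its modulus is that of [p1 / p2] at [T],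
    whose logarithm is small compared with [|T|]. *)
Lemma near_zero (p1 p2 : {poly R[i]}) (c : R[i]) (d : R) :
  p1 != 0 -> p2 != 0 -> c != 0 -> 0 < d -> exists2 r, 0 < r &
  forall T, r <= cabs T -> complex.Re (c * T) = 0 ->
  exists2 u, cabs u <= d * cabs T & p2.[T] * cexp (c * (T + u)) = - p1.[T].
Proof.
move=> p10 p20 c0 d0; have C0 : 0 < cabs c by rewrite cabs_gt0.
(* Half of the allowance [d |c| |T|] absorbs the growth of the polynomials, the other half the
   constant [L + pi]. *)
pose e := d * cabs c / 2.
have e0 : 0 < e by rewrite divr_gt0 // mulr_gt0.
have [B1 [r1 [B11 r10 H1]]] := poly_subexponential p10 e0.
have [B2 [r2 [B21 r20 H2]]] := poly_subexponential p20 e0.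
pose L := ln (B1 * B2).
have BB1 : 1 <= B1 * B2 by rewrite -[leLHS]mul1r; apply: ler_pM.
have BB0 : 0 < B1 * B2 by lra.
have L0 : 0 <= L by rewrite ln_ge0.
have pi0 := pi_gt0 R.
exists (r1 + r2 + (L + pi) / e); first by rewrite !addr_gt0 // divr_gt0 //; lra.
move=> T hT cT.
have q0 : 0 < (L + pi) / e by rewrite divr_gt0 //; lra.
have [a1 a2] := H1 T ltac:(lra); have [b1 b2] := H2 T ltac:(lra).
have P1 : 0 < cabs p1.[T] by rewrite -(@pmulr_rgt0 _ B1); lra.
have P2 : 0 < cabs p2.[T] by rewrite -(@pmulr_rgt0 _ B2); lra.
pose y := - (p1.[T] / p2.[T]) * cexp (- (c * T)).
have yE : cabs y = cabs p1.[T] / cabs p2.[T].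
  by rewrite /y cabsM cabsN cabsM cabsV cabs_cexp raddfN /= cT oppr0 expR0 mulr1.
have y0 : y != 0 by rewrite -cabs_gt0 yE divr_gt0.
have [v vE vb] := cexp_log y0.
have E0 : 0 < expR (e * cabs T) by exact: expR_gt0.
have lnE : ln (B1 * B2 * expR (e * cabs T)) = L + e * cabs T.
  by rewrite lnM ?posrE // expRK.
have lb : `|ln (cabs y)| <= L + e * cabs T.
  rewrite -lnE ler_norml; apply/andP; split.
    rewrite lerNl -lnV ?posrE ?cabs_gt0 // ler_ln ?posrE ?invr_gt0 ?cabs_gt0 //;
      last exact: mulr_gt0.
    rewrite yE invf_div ler_pdivrMr //.
    apply: (@le_trans _ _ (B2 * expR (e * cabs T) * 1)); first by rewrite mulr1.
    have -> : B1 * B2 * expR (e * cabs T) * cabs p1.[T] = B2 * expR (e * cabs T) * (B1 *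
      cabs p1.[T]) by ring.
    by apply: ler_wpM2l => //; rewrite mulr_ge0 //; lra.
  rewrite ler_ln ?posrE ?cabs_gt0 //; last exact: mulr_gt0.
  rewrite yE ler_pdivrMr //.
  apply: (@le_trans _ _ (B1 * expR (e * cabs T) * 1)); first by rewrite mulr1.
  have -> : B1 * B2 * expR (e * cabs T) * cabs p2.[T] = B1 * expR (e * cabs T) * (B2 *
    cabs p2.[T]) by ring.
  by apply: ler_wpM2l => //; rewrite mulr_ge0 //; lra.
exists (v / c).
  rewrite cabsM cabsV ler_pdivrMr //.
  have h : L + pi <= e * cabs T by rewrite -ler_pdivrMl // mulrC; lra.
  have -> : d * cabs T * cabs c = e * cabs T + e * cabs T by rewrite /e; field.
  lra.
have -> : c * (T + v / c) = c * T + v by field.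
have p2T : p2.[T] != 0 by rewrite -cabs_gt0.
have ce := cexpN (c * T).
rewrite cexpD vE /y.
transitivity (- p1.[T] * (cexp (- (c * T)) * cexp (c * T))); first by field.
by rewrite ce mulr1.
Qed.

Lemma exp_decay_small (C e eta : R) (K : nat) : 0 < e -> 0 <= C -> 0 < eta ->
  exists2 r, 0 < r & forall x, r <= x -> C * (1 + x) ^+ K * expR (- (e * x)) <= eta.
Proof.
move=> e0 C0 h0; have [c c0 H] := expR_ge_poly K.+1 e0.
have a0 : 0 <= C / (eta * c) by rewrite divr_ge0 // mulr_ge0 // ltW.
exists (1 + C / (eta * c)); first lra.
move=> x hx; have x0 : 0 <= x by lra.
have x1 : 0 < 1 + x by lra.
rewrite expRN ler_pdivrMr ?expR_gt0 //.
apply: (@le_trans _ _ (eta * (c * (1 + x) ^+ K.+1))); last by rewrite ler_pM2l // H.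
rewrite exprS !mulrA ler_pM2r ?exprn_gt0 //.
have -> : C = eta * c * (C / (eta * c)) by field; rewrite !gt_eqF.
by rewrite ler_pM2l ?mulr_gt0 //; lra.
Qed.

(** [w] is [i] times the conjugate of [c], with the sign that puts it into the right half-plane. For
    [c = b - 1], the functions [e^t] and [e^(b t)] have equal modulus on this ray. *)
Lemma critical_direction (c : R[i]) : complex.Im c != 0 ->
  exists2 w : R[i], 0 < complex.Re w & forall x : R, complex.Re (c * (w * x%:C)) = 0.
Proof.
case: c => a d /= d0.
have [dp|dn] := ltP 0 d.
  by exists (d +i* a) => //= x; ring.
have dn' : d < 0 by rewrite lt_neqAle d0.
by exists ((- d) +i* (- a)) => /= [|x]; [rewrite oppr_gt0 | ring].
Qed.

Lemma nth_root_exists (n : nat) (y : R) : (0 < n)%N -> 0 < y ->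
  exists2 x, 0 <= x & x ^+ n = y.
Proof.
move=> n0 y0; exists (expR (ln y / n%:R)); first exact: expR_ge0.
by rewrite -expRM_natl mulrC divfK ?lnK // pnatr_eq0 -lt0n.
Qed.

(** Used with [g = |b - 1|] and [|b|] for [b]: the third condition yields the lower bound for the
    derivative of [F^n], the last one contradicts the upper bound. *)
Lemma small_parameter (g b D : R) (n : nat) : 0 < g -> 0 <= b -> 0 < D ->
  exists eta, [/\ 0 < eta, eta <= 1 / 2, eta * (g + 2 * b + 3) <= g / 2 &
    D * eta < (g / 2) ^+ n].
Proof.
move=> g0 b0 D0.
have s0 : 0 < g + 2 * b + 3 by lra.
have P0 : 0 < (g / 2) ^+ n by rewrite exprn_gt0 // divr_gt0.
exists (Num.min (1 / 2) (Num.min (g / 2 / (g + 2 * b + 3)) ((g / 2) ^+ n / (2 * D)))).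
split.
- by rewrite !lt_min !divr_gt0 // mulr_gt0.
- by rewrite ge_min lexx.
- by rewrite -ler_pdivlMr // !ge_min lexx orbT.
- apply: (@le_lt_trans _ _ (D * ((g / 2) ^+ n / (2 * D)))).
    by rewrite ler_pM2l // !ge_min lexx !orbT.
  have -> : D * ((g / 2) ^+ n / (2 * D)) = (g / 2) ^+ n / 2 by field; rewrite gt_eqF.
  lra.
Qed.

Lemma large_real (l : seq R) : exists2 x, 0 < x & forall y, y \in l -> y <= x.
Proof.
elim: l => [|a l [x x0 H]]; first by exists 1.
exists (Num.max a x); first by rewrite lt_max x0 orbT.
move=> y; rewrite in_cons le_max => /predU1P[->|/H ->]; by rewrite ?lexx ?orbT.
Qed.

Lemma near_zero_points (p1 p2 : {poly R[i]}) (c w : R[i]) (eta : R) :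
  p1 != 0 -> p2 != 0 -> c != 0 -> 0 < complex.Re w ->
  (forall x : R, complex.Re (c * (w * x%:C)) = 0) -> 0 < eta ->
  exists2 k : R, 0 < k & forall r : R, exists tau u,
    let T := w * tau%:C in
    [/\ r <= tau /\ 0 < tau, cabs u <= complex.Re w / 2 * tau,
        k <= cabs p1.[T] /\ k <= cabs p2.[T],
        p2.[T] * cexp (c * (T + u)) = - p1.[T] &
        forall s, cabs s <= 1 -> cabs (p1.[T + u + s] - p1.[T]) <= eta * cabs p1.[T] /\
          cabs (p2.[T + u + s] - p2.[T]) <= eta * cabs p2.[T]].
Proof.
move=> p10 p20 c0 w0 cw eta0.
have wn0 : 0 < cabs w by apply: lt_le_trans w0 _; apply: le_trans (ler_norm _) (cabs_Re _).
have [d1 [r1 [d10 r10 S1]]] := poly_slow_variation p10 eta0.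
have [d2 [r2 [d20 r20 S2]]] := poly_slow_variation p20 eta0.
have [c1 [r4 [c10 r40 L1]]] := poly_lower_bound p10.
have [c2 [r5 [c20 r50 L2]]] := poly_lower_bound p20.
have [d [dp dd1 dd2 dw]] : exists d, [/\ 0 < d, d <= d1 / 2, d <= d2 / 2 &
    d * cabs w <= complex.Re w / 2].
  (* Halving [d1] and [d2] leaves room for the shift [s] besides [u]; the last term makes [T + u]
     keep at least half of the real part of [T]. *)
  exists (Num.min (Num.min (d1 / 2) (d2 / 2)) (complex.Re w / 2 / cabs w)).
  split; [by rewrite !lt_min !divr_gt0 | by rewrite !ge_min lexx |
    by rewrite !ge_min lexx !orbT | by rewrite -ler_pdivlMr // !ge_min lexx !orbT].
have [r3 r30 NZ] := near_zero p10 p20 c0 dp.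
exists (Num.min c1 c2); first by rewrite lt_min c10.
move=> r; have [S S0 HS] := large_real [:: r1; r2; r3; r4; r5; 2 / d1; 2 / d2].
have [tau tau0 Htau] := large_real [:: r; S / cabs w].
pose T := w * tau%:C.
have TE : cabs T = cabs w * tau by rewrite cabsM cabsR gtr0_norm.
have TS : S <= cabs T.
  by rewrite TE mulrC -ler_pdivrMr //; apply: Htau; rewrite !inE eqxx orbT.
have Ty y : y \in [:: r1; r2; r3; r4; r5; 2 / d1; 2 / d2] -> y <= cabs T.
  by move=> /HS h; apply: le_trans TS.
have [u uT uE] := NZ T (Ty r3 ltac:(by rewrite !inE eqxx ?orbT)) (cw tau).
exists tau, u; rewrite -/T; split => //.
- by split=> //; apply: Htau; rewrite inE eqxx.
- apply: le_trans uT _; rewrite TE mulrA; apply: ler_wpM2r dw; exact: ltW.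
- by split; rewrite ge_min; apply/orP; [left; apply: L1 | right; apply: L2];
    apply: Ty; rewrite !inE eqxx ?orbT.
have CT0 := cabs_ge0 T.
have big (x d' : R) : 0 < d' -> 2 / d' <= cabs T -> d <= d' / 2 -> x <= 1 ->
    cabs u + x <= d' * cabs T.
  clear - uT CT0 => d'0; rewrite ler_pdivrMr // => h1 h2 x1.
  have := ler_wpM2r CT0 h2; lra.
move=> s s1; rewrite -!addrA; split.
- apply: S1; first by apply: Ty; rewrite !inE eqxx ?orbT.
  apply: le_trans (cabsD _ _) _; apply: big => //.
  by apply: Ty; rewrite !inE eqxx ?orbT.
- apply: S2; first by apply: Ty; rewrite !inE eqxx ?orbT.
  apply: le_trans (cabsD _ _) _; apply: big => //.
  by apply: Ty; rewrite !inE eqxx ?orbT.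
Qed.

Lemma cabs_le_double (eta : R) (x y : R[i]) : eta <= 1 / 2 ->
  cabs (x - y) <= eta * cabs y -> cabs x <= 2 * cabs y.
Proof.
move=> h e; have := cabs_subr_ge x y; have y0 := cabs_ge0 y.
have := ler_wpM2r y0 h; lra.
Qed.

Lemma cabs_cexp_le (a s : R[i]) : cabs s <= 1 -> cabs (cexp (a * s)) <= expR (cabs a).
Proof.
move=> s1; rewrite cabs_cexp ler_expR; apply: le_trans (ler_norm _) _.
by apply: le_trans (cabs_Re _) _; rewrite cabsM ler_piMr // cabs_ge0.
Qed.

(* The scale is X = |p1(T) e^t| = |p2(T) e^(b t)|: both exponential terms have
   size about X near t, while they cancel to within 2 eta X at t itself. *)
Lemma cancelling_terms (p1 p2 : {poly R[i]}) (b T t : R[i]) (eta : R) :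
  let X := cabs p1.[T] * cabs (cexp t) in
  0 < eta -> eta <= 1 / 2 -> p2.[T] * cexp ((b - 1) * t) = - p1.[T] ->
  (forall s, cabs s <= 1 -> cabs (p1.[t + s] - p1.[T]) <= eta * cabs p1.[T] /\
          cabs (p2.[t + s] - p2.[T]) <= eta * cabs p2.[T]) ->
  [/\ cabs p2.[T] * cabs (cexp (b * t)) = X,
    cabs (p1.[t] * cexp t + p2.[t] * cexp (b * t)) <= 2 * eta * X,
    (forall s, cabs s <= 1 ->
       cabs (p1.[t + s] * cexp (t + s) + p2.[t + s] * cexp (b * (t + s))) <=
         (2 * expR 1 + 2 * expR (cabs b)) * X),
    (1 - eta) * X <= cabs (p1.[t] * cexp t) &
    cabs ((deriv p1).[t] * cexp t) <= eta * X /\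
    cabs ((deriv p2).[t] * cexp (b * t)) <= eta * X].
Proof.
move=> X eta0 eta1 uE V.
have V1 s (s1 : cabs s <= 1) := (V s s1).1; have V2 s (s1 : cabs s <= 1) := (V s s1).2.
pose E := cabs (cexp t); pose Eb := cabs (cexp (b * t)).
have E0 : 0 <= E by exact: cabs_ge0.
have Eb0 : 0 <= Eb by exact: cabs_ge0.
have ebt : cexp (b * t) = cexp ((b - 1) * t) * cexp t.
  by rewrite -cexpD; congr cexp; ring.
have XE2 : cabs p2.[T] * Eb = X.
  by rewrite /Eb ebt cabsM mulrA -cabsM uE cabsN.
have v1 := V1 0; have v2 := V2 0; rewrite !addr0 cabs0 in v1 v2.
have {}v1 := v1 ler01; have {}v2 := v2 ler01.
split => //.
- have -> : p1.[t] * cexp t + p2.[t] * cexp (b * t) =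
     (p1.[t] - p1.[T]) * cexp t + (p2.[t] - p2.[T]) * cexp (b * t).
    have h : p2.[T] * cexp (b * t) = - p1.[T] * cexp t by rewrite ebt mulrA uE.
    transitivity (p1.[t] * cexp t + p2.[t] * cexp (b * t) - p1.[T] * cexp t - p2.[T] *
      cexp (b * t)); last by ring.
    by rewrite h; ring.
  apply: le_trans (cabsD _ _) _; rewrite (cabsM (p1.[t] - _)) (cabsM (p2.[t] - _)) -/E -/Eb.
  have h1 := ler_wpM2r E0 v1; have h2 := ler_wpM2r Eb0 v2.
  rewrite -mulrA in h1; rewrite -mulrA XE2 in h2.
  have -> : 2 * eta * X = eta * X + eta * X by ring.
  exact: lerD.
- move=> s s1; apply: le_trans (cabsD _ _) _; rewrite mulrDl; apply: lerD.
    rewrite (cabsM p1.[_]) cexpD (cabsM (cexp t)) -/E.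
    have h2 := cabs_cexp_le 1 s1; rewrite mul1r cabs1 in h2.
    have -> : 2 * expR 1 * X = 2 * cabs p1.[T] * (E * expR 1) by rewrite /X -/E; ring.
    apply: ler_pM; rewrite ?cabs_ge0 //; first by rewrite mulr_ge0 ?cabs_ge0.
      exact: cabs_le_double eta1 (V1 s s1).
    by rewrite ler_wpM2l.
  rewrite (cabsM p2.[_]) mulrDr cexpD (cabsM (cexp (b * t))) -/Eb.
  have h2 := cabs_cexp_le b s1.
  have -> : 2 * expR (cabs b) * X = 2 * cabs p2.[T] * (Eb * expR (cabs b)) by rewrite
    -XE2; ring.
  apply: ler_pM; rewrite ?cabs_ge0 //; first by rewrite mulr_ge0 ?cabs_ge0.
    exact: cabs_le_double eta1 (V2 s s1).
  by rewrite ler_wpM2l.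
- have v3 := cabs_subr_ge p1.[T] p1.[t]; rewrite cabsBC in v3.
  rewrite (cabsM p1.[t]) /X mulrA; apply: ler_wpM2r => //; clear - v1 v3; lra.
have dp q (z : R[i]) : (forall s, cabs s <= 1 -> cabs (q.[t + s] - z) <= eta * cabs z) ->
    cabs (deriv q).[t] <= eta * cabs z.
  move=> H.
  have D1 : hd (fun y => q.[y] - z) (fun y => (deriv q).[y] - 0).
    by move=> y; apply: cderB (hd_poly q y) (cder_cst _ y).
  have := @cauchy_estimate R _ _ t 1 (eta * cabs z) D1 ltr01; rewrite subr0 divr1;
    apply => s s1.
  by apply: H; rewrite s1.
split; first by rewrite (cabsM (deriv p1).[t]) /X mulrA; apply: ler_wpM2r => //; apply: dp.
by rewrite (cabsM (deriv p2).[t]) -XE2 mulrA; apply: ler_wpM2r => //; apply: dp.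
Qed.

Let h (b z : R[i]) : R := Num.max 0 (Num.max (complex.Re z) (complex.Re (b * z))).

Lemma max_exponent_lip (b t s : R[i]) : cabs s <= 1 -> h b (t + s) <= h b t + (1 + cabs b).
Proof.
move=> s1; have b0 := cabs_ge0 b.
rewrite {1}/h !ge_max; apply/andP; split; [|apply/andP; split].
- by apply: addr_ge0; [rewrite /h le_max lexx | lra].
- have h1 : complex.Re t <= h b t by rewrite /h !le_max lexx !orbT.
  have h2 := le_trans (ler_norm _) (cabs_Re s); rewrite raddfD /=; lra.
- have h1 : complex.Re (b * t) <= h b t by rewrite /h !le_max lexx !orbT.
  have h2 := le_trans (ler_norm _) (cabs_Re (b * s)); rewrite cabsM in h2.
  rewrite mulrDr raddfD /=.
  have : cabs b * cabs s <= cabs b by rewrite ler_piMr.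
  lra.
Qed.

(** As [0 <= Re t], the maximum is the real part of one of the two exponents, and that exponential
    has modulus at most [X / k]. *)
Lemma expR_max_exponent (b t : R[i]) (k x y X : R) : 0 < k -> 0 <= complex.Re t ->
  k <= x -> k <= y -> x * cabs (cexp t) = X -> y * cabs (cexp (b * t)) = X ->
  expR (h b t) <= k^-1 * X.
Proof.
move=> k0 t0 kx ky; rewrite !cabs_cexp => <- E.
rewrite mulrC ler_pdivlMr // mulrC /h (max_r (le_trans t0 _)); last by rewrite le_max lexx.
have [_|_] := leP (complex.Re t) (complex.Re (b * t)).
  by rewrite -E; apply: ler_wpM2r => //; exact: expR_ge0.
by apply: ler_wpM2r => //; exact: expR_ge0.
Qed.

(** [e^((1 - e) h)] is [e^h], comparable with [X], times [e^(- e h)]. Near the ray [h] is at least a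
    multiple of [tau], so the second factor beats every polynomial in [tau]. *)
Lemma remainder_small (Q : R[i] -> R[i]) (b w : R[i]) (e eta k : R) :
  0 < e -> e <= 1 -> 0 < eta -> 0 < k -> 0 < complex.Re w ->
  growth (@cabs R) (fun t => (1 - e) * h b t) Q ->
  exists r, forall tau u X, r <= tau -> 0 < tau -> 0 < X ->
    cabs u <= complex.Re w / 2 * tau ->
    expR (h b (w * tau%:C + u)) <= k^-1 * X ->
    forall s, cabs s <= 1 -> cabs (Q (w * tau%:C + u + s)) <= eta * X.
Proof.
move=> e0 e1 eta0 k0 w0 [C [K [C0 HQ]]].
have wn0 := cabs_ge0 w.
have wR := le_trans (ler_norm _) (cabs_Re w).
have b0 := cabs_ge0 b.
pose C3 := C * (2 + 2 * cabs w) ^+ K * expR (1 + cabs b) * k^-1.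
have ki0 : 0 <= k^-1 by rewrite invr_ge0 ltW.
have w20 : 0 <= 2 + 2 * cabs w by lra.
have C30 : 0 <= C3.
  by rewrite /C3; apply: mulr_ge0 => //; rewrite !mulr_ge0 ?expR_ge0 // exprn_ge0.
have ek0 : 0 < e * (complex.Re w / 2) by rewrite mulr_gt0 // divr_gt0.
have [r r0 DS] := exp_decay_small K ek0 C30 eta0.
exists r => tau u X rtau tau0 X0 uw; set t := w * tau%:C + u => eh s s1.
have Ret : complex.Re w / 2 * tau <= complex.Re t.
  have := cabs_Re u; rewrite ler_norml => /andP[u1 _].
  have -> : complex.Re t = complex.Re w * tau + complex.Re u.
    by rewrite /t raddfD /=; case: (w) => x y /=; ring.
  clear - u1 uw; lra.
have ht : complex.Re w / 2 * tau <= h b t by rewrite /h !le_max Ret orbT.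
apply: le_trans (HQ _) _.
apply: (@le_trans _ _ (C3 * (1 + tau) ^+ K * expR (- (e * (complex.Re w / 2) * tau)) *
  X)); last first.
  by apply: ler_wpM2r (DS tau rtau); exact: ltW.
set D := expR (- (e * _ * _)).
have -> : C3 * (1 + tau) ^+ K * D * X =
    (C * ((2 + 2 * cabs w) * (1 + tau)) ^+ K) * (k^-1 * X * (expR (1 + cabs b) * D)).
  by rewrite /C3 [((2 + 2 * cabs w) * (1 + tau)) ^+ K]exprMn; ring.
apply: ler_pM; rewrite ?expR_ge0 //.
- by rewrite mulr_ge0 // exprn_ge0 // addr_ge0 // cabs_ge0.
- have tau1 : 0 <= 1 + tau by clear - tau0; lra.
  apply: ler_wpM2l => //; apply: lerXn2r; rewrite ?nnegrE ?addr_ge0 ?cabs_ge0 //.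
    exact: mulr_ge0.
  have h1 := cabsD t s; have h2 := cabsD (w * tau%:C) u;
    rewrite -/t cabsM cabsR gtr0_norm // in h2.
  have h3 := mulr_ge0 wn0 (ltW tau0).
  have h4 : complex.Re w / 2 * tau <= cabs w / 2 * tau by apply: ler_wpM2r;
    [exact: ltW | clear - wR; lra].
  rewrite mulrDr mulr1 mulrDl; clear - h1 h2 h3 h4 s1 uw wn0 tau0; lra.
- apply: (@le_trans _ _ (expR (h b t) * (expR (1 + cabs b) * D))).
    rewrite -!expRD ler_expR.
    have h1 := max_exponent_lip b t s1; have h2 : 0 <= 1 - e by clear - e1; lra.
    have h3 := ler_wpM2l h2 h1.
    have h4 := ler_wpM2l (ltW e0) ht.
    have h5 : 0 <= e * (1 + cabs b) by apply: mulr_ge0; clear - e0 b0; lra.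
    clear - h1 h3 h4 h5; lra.
  by apply: ler_wpM2r => //; rewrite mulr_ge0 // expR_ge0.
Qed.

(** Here [d] is the derivative of [F^n] and [q] that of [Q]. Up to terms of order [eta X], the
    derivative of the sum is [b (p1 e^t + p2 e^(b t)) + (1 - b) p1 e^t]; the bracket is small at a
    near zero, while the last term has size about [|b - 1| X]. *)
Lemma derivative_lower_bound (p1 p2 : {poly R[i]}) (b t q d : R[i]) (eta X : R) :
  0 < eta -> 0 < X -> eta * (cabs (b - 1) + 2 * cabs b + 3) <= cabs (b - 1) / 2 ->
  cabs (p1.[t] * cexp t + p2.[t] * cexp (b * t)) <= 2 * eta * X ->
  (1 - eta) * X <= cabs (p1.[t] * cexp t) ->
  cabs ((deriv p1).[t] * cexp t) <= eta * X ->
  cabs ((deriv p2).[t] * cexp (b * t)) <= eta * X -> cabs q <= eta * X ->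
  d + q = (deriv p1).[t] * cexp t + p1.[t] * cexp t
    + ((deriv p2).[t] * cexp (b * t) + p2.[t] * (b * cexp (b * t))) ->
  cabs (b - 1) / 2 * X <= cabs d.
Proof.
move=> eta0 X0 eta2 Ut A1 dp1 dp2 qX DE.
have key : (b - 1) * (p1.[t] * cexp t) = b * (p1.[t] * cexp t + p2.[t] * cexp (b * t))
      + (deriv p1).[t] * cexp t + (deriv p2).[t] * cexp (b * t) - q - d.
  have -> : d = (d + q) - q by ring.
  by rewrite DE; ring.
have k1 : cabs ((b - 1) * (p1.[t] * cexp t)) <=
    cabs b * (2 * eta * X) + eta * X + eta * X + eta * X + cabs d.
  rewrite key; apply: le_trans (cabsB _ _) _; rewrite lerD2r.
  apply: le_trans (cabsB _ _) _; apply: lerD => //.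
  apply: le_trans (cabsD _ _) _; apply: lerD => //.
  apply: le_trans (cabsD _ _) _; apply: lerD => //.
  by rewrite (cabsM b); apply: ler_wpM2l => //; exact: cabs_ge0.
rewrite (cabsM (b - 1)) in k1.
have k2 := ler_wpM2l (cabs_ge0 (b - 1)) A1.
have k3 := ler_wpM2r (ltW X0) eta2.
have k4 : 0 <= eta * X by rewrite mulr_ge0 // ltW.
clear - k1 k2 k3 k4; lra.
Qed.

(* On the ray where both exponentials have the same large modulus, their sum
   comes close to having simple zeros.  There F is too small for the derivative
   n F^(n-1) F' of F^n to match the derivative of the sum. *)
Theorem nonreal_ratio (n : nat) (p1 p2 : {poly R[i]}) (b : R[i]) (e : R)
  (F F' Q Q' : R[i] -> R[i]) : (2 <= n)%N -> p1 != 0 -> p2 != 0 ->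
  complex.Im b != 0 -> 0 < e -> e <= 1 -> hd F F' -> hd Q Q' ->
  growth (@cabs R) (fun t => (1 - e) *
    Num.max 0 (Num.max (complex.Re t) (complex.Re (b * t)))) Q ->
  (forall t, F t ^+ n + Q t = p1.[t] * cexp t + p2.[t] * cexp (b * t)) -> False.
Proof.
move=> n2 p10 p20 Imb e0 e1 DF DQ GQ HE.
have n0 : (0 < n)%N by apply: leq_trans n2.
have Imc : complex.Im (b - 1) != 0 by rewrite raddfB /= subr0.
have c0 : b - 1 != 0 by apply: contraNneq Imc => ->.
have g0 : 0 < cabs (b - 1) by rewrite cabs_gt0.
pose C1 := 2 * expR 1 + 2 * expR (cabs b).
have C10 : 0 <= C1 by rewrite addr_ge0 // mulr_ge0 // expR_ge0.
have C11 : 0 < C1 + 1 by rewrite ltr_wpDl.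
pose D := n%:R ^+ n * 3 ^+ n.-1 * (C1 + 1).
have D0 : 0 < D by rewrite !mulr_gt0 ?exprn_gt0 ?ltr0n.
have [eta [eta0 eta1 eta2 eta3]] := small_parameter n g0 (cabs_ge0 b) D0.
have [w w0 cw] := critical_direction Imc.
have [k k0 Pts] := near_zero_points p10 p20 c0 w0 cw eta0.
have [r Hr] := remainder_small e0 e1 eta0 k0 w0 GQ.
have [tau [u]] := Pts r; set T := w * tau%:C; set t := T + u.
move=> [[rtau tau0] uw [kp1 kp2] uE V].
have [XE2 Ut Uts A1 [dp1 dp2]] := cancelling_terms eta0 eta1 uE V.
set X := cabs p1.[T] * cabs (cexp t) in XE2 Ut Uts A1 dp1 dp2.
have X0 : 0 < X by apply: mulr_gt0; [exact: lt_le_trans kp1 | rewrite cabs_gt0 cexp_neq0].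
have XE1 : cabs p1.[T] * cabs (cexp t) = X by [].
clearbody X.
have Ret : 0 <= complex.Re t.
  have := cabs_Re u; rewrite ler_norml => /andP[u1 _].
  have -> : complex.Re t = complex.Re w * tau + complex.Re u.
    by rewrite /t /T raddfD /=; case: (w) => x y /=; ring.
  have wt0 : 0 < complex.Re w * tau by rewrite mulr_gt0.
  clear - u1 uw wt0; lra.
have Qts := Hr tau u X rtau tau0 X0 uw (expR_max_exponent k0 Ret kp1 kp2 XE1 XE2).
have Q't : cabs (Q' t) <= eta * X.
  by rewrite -[leRHS]divr1; apply: (cauchy_estimate DQ ltr01) => s s1; apply: Qts;
    rewrite s1.
(* [F^n] is at most [(C1 + 1) X] on the unit disc about [t], so the root [M] bounds [F] there and,
   by Cauchy, [F'] at [t]. *)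
have [M M0 ME] := nth_root_exists n0 (mulr_gt0 C11 X0).
have Fts s : cabs s <= 1 -> cabs (F (t + s)) <= M.
  move=> s1; rewrite -(@ler_pXn2r _ n) ?nnegrE ?cabs_ge0 // ME -cabsX -[F _ ^+ n](addrK
    (Q (t + s))) HE.
  apply: le_trans (cabsB _ _) _; have u1 := Uts s s1; have u2 := Qts s s1.
  rewrite mulrDl; apply: lerD u1 _; apply: le_trans u2 _.
  by apply: ler_wpM2r; [exact: ltW | clear - eta1; lra].
have F't : cabs (F' t) <= M.
  by rewrite -[leRHS]divr1; apply: (cauchy_estimate DF ltr01) => s s1; apply: Fts;
    rewrite s1.
have Ft : cabs (F t) ^+ n <= 3 * eta * X.
  rewrite -cabsX -[F _ ^+ n](addrK (Q t)) HE; apply: le_trans (cabsB _ _) _.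
  have := Qts 0; rewrite addr0 cabs0 => /(_ ler01) h1; clear - h1 Ut; lra.
have DU : cder (fun z => p1.[z] * cexp z + p2.[z] * cexp (b * z)) t
   ((deriv p1).[t] * cexp t + p1.[t] * cexp t + ((deriv p2).[t] * cexp (b * t) + p2.[t] *
     (b * cexp (b * t)))).
  apply: cderD (cderM (hd_poly p2 t) (cder_cexp_lin b t)).
  exact: cderM (hd_poly p1 t) (cder_cexp t).
have DE : n%:R * F t ^+ n.-1 * F' t + Q' t =
    (deriv p1).[t] * cexp t + p1.[t] * cexp t + ((deriv p2).[t] * cexp (b * t) + p2.[t] *
      (b * cexp (b * t))).
  have := cderD (cderX n (DF t)) (DQ t).
  by move=> /(cder_ext HE) /cder_uniq; apply.
have low := derivative_lower_bound eta0 X0 eta2 Ut A1 dp1 dp2 Q't DE.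
(* Taking n-th powers turns [F^(n-1)] into [(F^n)^(n-1)], which is at most [(3 eta X)^(n-1)]. As
   [n >= 2], at least one factor [eta] survives. *)
have up : (cabs (b - 1) / 2 * X) ^+ n <= D * eta * X ^+ n.
  apply: (@le_trans _ _ (cabs (n%:R * F t ^+ n.-1 * F' t) ^+ n)).
    apply: lerXn2r low; rewrite nnegrE ?cabs_ge0 //.
    by rewrite mulr_ge0 ?divr_ge0 ?cabs_ge0 // ltW.
  have nC : cabs (n%:R : R[i]) = n%:R.
    by rewrite -(rmorph_nat (real_complex R)) cabsR ger0_norm.
  have -> : cabs (n%:R * F t ^+ n.-1 * F' t) ^+ n = n%:R ^+ n * (cabs (F t) ^+ n) ^+ n.-1
    * cabs (F' t) ^+ n.
    by rewrite cabsM cabsM nC cabsX exprMn exprMn -!exprM [(n.-1 * n)%N]mulnC.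
  have -> : D * eta * X ^+ n = n%:R ^+ n * (3 ^+ n.-1 * eta * X ^+ n.-1) * ((C1 + 1) * X).
    have -> : X ^+ n = X * X ^+ n.-1 by rewrite -exprS prednK.
    by rewrite /D; ring.
  apply: ler_pM.
  - by rewrite mulr_ge0 ?exprn_ge0 ?cabs_ge0.
  - by rewrite exprn_ge0 // cabs_ge0.
  - apply: ler_wpM2l; first by rewrite exprn_ge0.
    apply: (@le_trans _ _ ((3 * eta * X) ^+ n.-1)).
      by apply: lerXn2r Ft; rewrite nnegrE ?exprn_ge0 ?cabs_ge0 // !mulr_ge0 // ?(ltW
        eta0) ?(ltW X0).
    rewrite (exprMn _ (3 * eta) X) (exprMn _ 3 eta); apply: ler_wpM2r;
      first by rewrite exprn_ge0 // ltW.
    apply: ler_wpM2l; first by rewrite exprn_ge0.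
    have -> : n.-1 = n.-2.+1 by case: (n) n2 => [|[|]].
    rewrite exprS ler_piMr ?(ltW eta0) // exprn_ile1 //; [exact: ltW | clear - eta1; lra].
  - by rewrite -ME; apply: lerXn2r F't; rewrite nnegrE ?cabs_ge0.
by move: up; rewrite (exprMn n _ X) ler_pM2r ?exprn_gt0 // leNgt eta3.
Qed.

End NonrealRatio.

(** * Several variables: conclusion *)

Section PolynomialFunctions.
Context {R : realType}.

Lemma evalpE (m : nat) (p : mpoly m R[i]) (z : 'rV[R[i]]_m) :
  evalp p z = \sum_(u <- msupp p) mcoeff u p * \prod_(i < m) z 0 i ^+ u i.
Proof. exact: mevalE. Qed.

Lemma evalp_line (m : nat) (p : mpoly m R[i]) (z v : 'rV[R[i]]_m) :
  exists q : {poly R[i]}, forall t, q.[t] = evalp p (z + t *: v).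
Proof.
exists (\sum_(u <- msupp p) (mcoeff u p)%:P * \prod_(i < m) ((z 0 i)%:P + v 0 i *: 'X) ^+
  u i).
move=> t; rewrite evalpE horner_sum; apply: eq_bigr => u _.
rewrite hornerM hornerC horner_prod; congr (_ * _); apply: eq_bigr => i _.
by rewrite horner_exp hornerD hornerC hornerZ hornerX !mxE mulrC.
Qed.

Lemma digits_inj (N m : nat) (a b : nat -> nat) :
  (forall i, (a i < N)%N) -> (forall i, (b i < N)%N) ->
  (\sum_(i < m) a i * N ^ i = \sum_(i < m) b i * N ^ i)%N ->
  forall i, (i < m)%N -> a i = b i.
Proof.
elim: m a b => [//|m IH] a b aN bN.
have E (c : nat -> nat) : (\sum_(i < m.+1) c i * N ^ i = c 0 + N * \sum_(i < m) c i.+1 *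
  N ^ i)%N.
  rewrite big_ord_recl expn0 muln1 big_distrr /=; congr addn.
  by apply: eq_bigr => i _; rewrite /bump /= add1n expnS mulnCA.
have N0 : (0 < N)%N by apply: leq_ltn_trans (aN 0%N).
rewrite !E => e.
have e0 : a 0%N = b 0%N.
  have := congr1 (fun x => x %% N)%N e.
  by rewrite ![(_ + N * _)%N]addnC ![(N * _)%N]mulnC !modnMDl !modn_small.
move: e; rewrite e0 => /addnI /eqP; rewrite eqn_pmul2l // => /eqP e.
case=> [//|i]; rewrite ltnS => im.
exact: (IH (fun i => a i.+1) (fun i => b i.+1)).
Qed.

(* Kronecker substitution z_i = x^(N^i). *)
Lemma evalp_neq0 (m : nat) (p : mpoly m R[i]) : p != 0 -> exists z, evalp p z != 0.
Proof.
move=> p0; apply: contrapT => H.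
have pz z : evalp p z = 0 by apply/eqP/negPn/negP => h; apply: H; exists z.
have [N HN] : exists N : nat, forall u : multinom m, u \in msupp p -> forall i, (u i < N)%N.
  exists (\sum_(u <- msupp p) mdeg u).+1 => u up i; rewrite ltnS.
  rewrite (big_rem u) //=; apply: leq_trans (leq_addr _ _).
  by rewrite mdegE (bigD1 i) //= leq_addr.
pose K (u : multinom m) := (\sum_(i < m) u i * N ^ i)%N.
pose q : {poly R[i]} := \sum_(u <- msupp p) mcoeff u p *: 'X^(K u).
have q0 : q = 0.
  apply: poly_fun_eq0 => x; rewrite -(pz (\row_i x ^+ (N ^ i))) evalpE horner_sum.
  apply: eq_bigr => u _; rewrite hornerZ hornerXn; congr (_ * _).
  rewrite /K -prodrXr; apply: eq_bigr => i _; rewrite mxE -exprM mulnC //.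
have [u up] : exists u, u \in msupp p.
  case E : (msupp p) => [|u s]; last by exists u; rewrite inE eqxx.
  by move: p0; rewrite -msupp_eq0 E.
have Kinj u' : u' \in msupp p -> (K u == K u') = (u == u').
  move=> u'p; apply/eqP/eqP => [e|-> //]; apply/mnmP => i.
  pose f (w : multinom m) j := if insub j is Some i then w i else 0%N.
  have fE w (j : 'I_m) : f w j = w j by rewrite /f valK.
  have fN w : w \in msupp p -> forall j, (f w j < N)%N.
    move=> wp j; rewrite /f; case: insubP => [k _ _|_]; first exact: HN.
    by apply: leq_ltn_trans (HN _ wp i).
  have := @digits_inj N m (f u) (f u') (fN _ up) (fN _ u'p).
  rewrite -!fE; apply => //.
  by move: e; rewrite /K; under eq_bigr do rewrite -fE;
    under [in RHS]eq_bigr do rewrite -fE.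
have := congr1 (fun r : {poly R[i]} => r`_(K u)) q0.
rewrite /= coef0 coef_sum (bigD1_seq u) ?msupp_uniq //= coefZ coefXn eqxx mulr1.
rewrite big1_seq ?addr0; last first.
  by move=> w /andP[wu wp]; rewrite coefZ coefXn Kinj // eq_sym (negbTE wu) mulr0.
by move=> /eqP; rewrite mcoeff_eq0 up.
Qed.

End PolynomialFunctions.

(** * Growth in several variables and restriction to coordinate lines *)

Section Assembly.
Context {R : realType} {m : nat}.
Implicit Types (z w v : 'rV[R[i]]_m) (f G : 'rV[R[i]]_m -> R[i]).

Lemma dotcD (c : 'rV[R[i]]_m) z w : dotc c (z + w) = dotc c z + dotc c w.
Proof. by rewrite /dotc -big_split; apply: eq_bigr => k _; rewrite mxE mulrDr. Qed.

Lemma dotcZ (c : 'rV[R[i]]_m) (t : R[i]) z : dotc c (t *: z) = t * dotc c z.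
Proof. by rewrite /dotc mulr_sumr; apply: eq_bigr => k _; rewrite mxE mulrCA. Qed.

Lemma dotc_delta (c : 'rV[R[i]]_m) k : dotc c (delta_mx 0 k) = c 0 k.
Proof.
rewrite /dotc (bigD1 k) //= mxE !eqxx mulr1 big1 ?addr0 // => j jk.
by rewrite mxE (negbTE jk) andbF mulr0.
Qed.

Lemma cabs_dotc (c : 'rV[R[i]]_m) z : cabs (dotc c z) <= rnorm c * rnorm z.
Proof.
apply: le_trans (cabs_sum _ _ _) _; rewrite [leRHS]mulr_sumr; apply: ler_sum => k _.
by rewrite cabsM; apply: ler_wpM2r; [exact: cabs_ge0 | exact: cabs_coord].
Qed.

Lemma Re_dotc_lip (c : 'rV[R[i]]_m) z w :
  complex.Re (dotc c (z + w)) <= complex.Re (dotc c z) + rnorm c * rnorm w.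
Proof.
rewrite dotcD raddfD /= lerD2l; apply: le_trans (cabs_dotc c w).
exact: le_trans (ler_norm _) (cabs_Re _).
Qed.

Definition expo (a b : 'rV[R[i]]_m) z : R :=
  Num.max 0 (Num.max (complex.Re (dotc a z)) (complex.Re (dotc b z))).

Lemma expo_ge0 a b z : 0 <= expo a b z.
Proof. by rewrite le_max lexx. Qed.

Lemma expo_lip a b z w : expo a b (z + w) <= expo a b z + (rnorm a + rnorm b) * rnorm w.
Proof.
have x := rnorm_ge0 a; have y := rnorm_ge0 b; have s := rnorm_ge0 w.
have h1 : complex.Re (dotc a z) <= expo a b z by rewrite /expo !le_max lexx !orbT.
have h2 : complex.Re (dotc b z) <= expo a b z by rewrite /expo !le_max lexx !orbT.
have xs := mulr_ge0 x s; have ys := mulr_ge0 y s.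
have h3 := Re_dotc_lip a z w; have h4 := Re_dotc_lip b z w; have h0 := expo_ge0 a b z.
rewrite {1}/expo !ge_max mulrDl; apply/and3P; split; lra.
Qed.

Lemma growth_exp_poly (p : mpoly m R[i]) (a : 'rV[R[i]]_m) (H : 'rV[R[i]]_m -> R) :
  (forall z, complex.Re (dotc a z) <= H z) ->
  growth (@rnorm R m) H (fun z => evalp p z * cexp (dotc a z)).
Proof.
move=> aH; apply: growth0M; [exact: rnorm_ge0 | exact: evalp_growth |].
exists 1, 0%N; split => // z; rewrite expr0 !mul1r cabs_cexp ler_expR; exact: aH.
Qed.

Lemma growth_line (H : 'rV[R[i]]_m -> R) (h : R[i] -> R) G z v (c : R) :
  growth (@rnorm R m) H G -> (forall t, H (z + t *: v) <= h t + c) ->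
  growth (@cabs R) h (fun t => G (z + t *: v)).
Proof.
move=> [C [K [C0 HG]]] Hh; have z0 := rnorm_ge0 z; have v0 := rnorm_ge0 v.
exists (C * (1 + rnorm z + rnorm v) ^+ K * expR c), K; split.
  by rewrite !mulr_ge0 ?expR_ge0 // exprn_ge0 // !addr_ge0.
move=> t; have t0 := cabs_ge0 t; apply: le_trans (HG _) _.
have -> : C * (1 + rnorm z + rnorm v) ^+ K * expR c * (1 + cabs t) ^+ K * expR (h t) =
  C * ((1 + rnorm z + rnorm v) * (1 + cabs t)) ^+ K * (expR (h t) * expR c) by rewrite
    exprMn; ring.
rewrite -expRD; apply: ler_pM; rewrite ?expR_ge0 ?ler_expR //.
  by rewrite mulr_ge0 // exprn_ge0 // addr_ge0 // rnorm_ge0.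
apply: ler_wpM2l => //; apply: lerXn2r; rewrite ?nnegrE ?addr_ge0 ?rnorm_ge0 //.
  by rewrite mulr_ge0 ?addr_ge0.
have h1 := rnormD z (t *: v); rewrite rnormZ in h1.
have h2 := mulr_ge0 t0 z0.
rewrite mulrDr mulr1 !mulrDl mul1r; lra.
Qed.

Lemma ent_line f z v : ent f -> hol (fun t => f (z + t *: v)).
Proof. by case=> + _ => /(_ z v). Qed.

Variables (n : nat) (n4 : (4 <= n)%N) (P : diff_poly R m) (hP : (dp_deg P <= n - 3)%N).
Variables (f : 'rV[R[i]]_m -> R[i]) (Ef : ent f).
Let n0 : (0 < n)%N. Proof. exact: leq_trans n4. Qed.
Let nE : (n - 3)%:R / n%:R = 1 - 3 * n%:R^-1 :> R.
Proof.
rewrite natrB ?(leq_trans _ n4) // mulrBl divff //.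
by rewrite pnatr_eq0 -lt0n.
Qed.

Section Equation.
Variables (p1 p2 : mpoly m R[i]) (a b : 'rV[R[i]]_m).
Hypothesis HE : forall z, f z ^+ n + dp_eval P f z =
  evalp p1 z * cexp (dotc a z) + evalp p2 z * cexp (dotc b z).

Lemma solution_growth : growth (@rnorm R m) (fun z => expo a b z / n%:R) f.
Proof.
apply: (@growth_solution _ _ n (n - 3) f (dp_eval P f) _ (expo a b) (rnorm a + rnorm b))
  HE => //.
- by apply: dbound_le hP _; apply: dbound_dp_eval.
- by rewrite ltn_subrL n0.
- exact: expo_ge0.
- by rewrite addr_ge0 // rnorm_ge0.
- exact: expo_lip.
- apply: growthD; first exact: rnorm_ge0.
    by apply: growth_exp_poly => z; rewrite /expo !le_max lexx !orbT.
  by apply: growth_exp_poly => z; rewrite /expo !le_max lexx !orbT.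
Qed.

Lemma remainder_growth :
  growth (@rnorm R m) (fun z => (1 - 3 * n%:R^-1) * expo a b z) (dp_eval P f).
Proof.
have ni0 : 0 <= n%:R^-1 :> R by rewrite invr_ge0.
have := @growth_dbound R m (n - 3) f (dp_eval P f) (fun z => expo a b z / n%:R) ((rnorm a
  + rnorm b) / n%:R).
move=> /(_ _ _ _ _ solution_growth) H.
apply: growth_le (H _ _ _ _).
- exact: rnorm_ge0.
- by move=> z; rewrite -nE mulrCA [leLHS]mulrC.
- by apply: dbound_le hP _; apply: dbound_dp_eval.
- by move=> z; rewrite divr_ge0 // expo_ge0.
- by rewrite divr_ge0 // addr_ge0 // rnorm_ge0.
- by move=> z w; rewrite mulrAC -mulrDl ler_wpM2r // expo_lip.
Qed.

Variables (k : 'I_m) (z : 'rV[R[i]]_m).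
Hypotheses (ak : a 0 k != 0) (z1 : evalp p1 z != 0) (z2 : evalp p2 z != 0).
Let v := (a 0 k)^-1 *: delta_mx 0 k : 'rV[R[i]]_m.
Let r := b 0 k / a 0 k.

Lemma dotc_line_a t : dotc a (z + t *: v) = dotc a z + t.
Proof. by rewrite dotcD dotcZ /v dotcZ dotc_delta mulVf // mulr1. Qed.

Lemma dotc_line_b t : dotc b (z + t *: v) = dotc b z + r * t.
Proof. by rewrite dotcD dotcZ /v dotcZ dotc_delta /r [_^-1 * _]mulrC [t * _]mulrC. Qed.

(** The constants [e^<a, z>] and [e^<b, z>] are absorbed into [q1] and [q2], which are nonzero
    because they do not vanish at [t = 0]. *)
Lemma line_equation : exists q1 q2 : {poly R[i]}, [/\ q1 != 0, q2 != 0,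
  (forall t, q1.[t] * cexp t = evalp p1 (z + t *: v) * cexp (dotc a (z + t *: v))),
  (forall t, q2.[t] * cexp (r * t) = evalp p2 (z + t *: v) * cexp (dotc b (z + t *: v))) &
  forall t, f (z + t *: v) ^+ n + dp_eval P f (z + t *: v) = q1.[t] * cexp t + q2.[t] *
    cexp (r * t)].
Proof.
have [q1 H1] := evalp_line p1 z v; have [q2 H2] := evalp_line p2 z v.
have E1 t : (cexp (dotc a z) *: q1).[t] * cexp t = evalp p1 (z + t *: v) * cexp (dotc a
  (z + t *: v)).
  by rewrite hornerZ H1 dotc_line_a cexpD; ring.
have E2 t : (cexp (dotc b z) *: q2).[t] * cexp (r * t) = evalp p2 (z + t *: v) * cexp
  (dotc b (z + t *: v)).
  by rewrite hornerZ H2 dotc_line_b cexpD; ring.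
exists (cexp (dotc a z) *: q1), (cexp (dotc b z) *: q2); split => //.
- rewrite scaler_eq0 (negbTE (cexp_neq0 _)) /=; apply: contraNneq z1 => q0.
  by have := H1 0; rewrite q0 horner0 scale0r addr0 => <-.
- rewrite scaler_eq0 (negbTE (cexp_neq0 _)) /=; apply: contraNneq z2 => q0.
  by have := H2 0; rewrite q0 horner0 scale0r addr0 => <-.
- by move=> t; rewrite HE E1 E2.
Qed.

(** On the line, [P(f)] is holomorphic because the equation expresses it as an exponential
    polynomial minus [f^n]. *)
Lemma line_hd : exists F' Q', hd (fun t => f (z + t *: v)) F' /\
  hd (fun t => dp_eval P f (z + t *: v)) Q'.
Proof.
have [F' DF] := ent_line z v Ef.
have [q1 [q2 [_ _ _ _ E]]] := line_equation.
have [Q' DQ] : hol (fun t => dp_eval P f (z + t *: v)).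
  apply: (@hol_ext _ (fun t => q1.[t] * cexp (1 * t) + q2.[t] * cexp (r * t) - f (z + t
    *: v) ^+ n)).
    by move=> t; rewrite mul1r -E addrAC subrr add0r.
  apply: holB; last by apply: holX; exists F'.
  by apply: holD; apply: holM; [exact: hol_poly | exact: hol_exp | exact: hol_poly |
    exact: hol_exp].
by exists F', Q'.
Qed.

Lemma expo_line t : expo a b (z + t *: v) <=
  Num.max 0 (Num.max (complex.Re t) (complex.Re (r * t))) + (cabs (dotc a z) + cabs (dotc
    b z)).
Proof.
have a0 := cabs_ge0 (dotc a z); have b0 := cabs_ge0 (dotc b z).
have ra := le_trans (ler_norm _) (cabs_Re (dotc a z)).
have rb := le_trans (ler_norm _) (cabs_Re (dotc b z)).
set M := Num.max 0 _.
have M0 : 0 <= M by rewrite le_max lexx.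
have M1 : complex.Re t <= M by rewrite !le_max lexx !orbT.
have M2 : complex.Re (r * t) <= M by rewrite !le_max lexx !orbT.
rewrite /expo !ge_max dotc_line_a dotc_line_b !raddfD /=; apply/and3P.
by clearbody M; split; lra.
Qed.

Let nu3 : 0 < 1 - 3 * n%:R^-1 :> R.
Proof.
have : n%:R^-1 <= 1 / 4 :> R by rewrite mul1r lef_pV2 ?posrE ?ltr0n // ler_nat.
lra.
Qed.

Lemma line_nonreal : complex.Im r != 0 -> False.
Proof.
move=> Imr; have [q1 [q2 [q10 q20 _ _ E]]] := line_equation.
have [F' [Q' [DF DQ]]] := line_hd.
have nu4 := nu3.
apply: (@nonreal_ratio _ n q1 q2 r (3 * n%:R^-1) _ _ _ _ _ q10 q20 Imr _ _ DF DQ _ E).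
- exact: leq_trans n4.
- by rewrite mulr_gt0 // invr_gt0 ltr0n.
- lra.
- apply: (growth_line (c := (1 - 3 * n%:R^-1) * (cabs (dotc a z) + cabs (dotc b z)))
  remainder_growth) => t.
  by rewrite -mulrDr ler_pM2l // expo_line.
Qed.

(** The conclusion on the line is read off at [t = 0], so that it becomes a statement about every
    point where neither [p1] nor [p2] vanishes. *)
Lemma line_real (rho : R) : r = rho%:C -> -1 < rho -> rho < 1 -> rho != 0 ->
  0 < rho /\ f z ^+ n = evalp p1 z * cexp (dotc a z).
Proof.
move=> rE rho1 rho2 rho0; have [q1 [q2 [q10 q20 E1 _ E]]] := line_equation.
have [F' [Q' [DF DQ]]] := line_hd.
have nu4 := nu3.
have ni0 : 0 <= n%:R^-1 :> R by rewrite invr_ge0.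
have W t : Num.max 0 (Num.max (complex.Re t) (complex.Re (r * t))) <= wt 1 (Num.min 0
  rho) t.
  rewrite rE; have -> : complex.Re (rho%:C * t) = rho * complex.Re t by case: t => x y
    /=; ring.
  have m0 : Num.min 0 rho <= 0 by rewrite ge_min lexx.
  have m1 : Num.min 0 rho <= rho by rewrite ge_min lexx orbT.
  have m2 : Num.min 0 rho < 1 by lra.
  rewrite /wt !ge_max; set mu := Num.min 0 rho in m0 m1 m2 *; clearbody mu.
  by have [x0|x0] := leP 0 (complex.Re t); apply/and3P; split; nra.
have GF : Gr n%:R^-1 (Num.min 0 rho * n%:R^-1) (fun t => f (z + t *: v)).
  apply: growth_le (growth_line (h := fun t => wt 1 (Num.min 0 rho) t / n%:R) (c := (cabs
    (dotc a z) + cabs (dotc b z)) / n%:R) solution_growth _).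
  - exact: cabs_ge0.
  - by move=> t; rewrite /wt; case: ifP => _;
    rewrite ?mul1r mulrC ?mulrA // [n%:R^-1 * _]mulrC.
  - move=> t; rewrite -mulrDl ler_wpM2r //; apply: le_trans (expo_line t) _;
    by rewrite lerD2r.
have GQ : Gr (1 - 3 * n%:R^-1) ((1 - 3 * n%:R^-1) * Num.min 0 rho) (fun t => dp_eval P f
  (z + t *: v)).
  apply: growth_le (growth_line (h := fun t => (1 - 3 * n%:R^-1) * wt 1 (Num.min 0 rho)
    t) (c := (1 - 3 * n%:R^-1) * (cabs (dotc a z) + cabs (dotc b z))) remainder_growth _).
  - exact: cabs_ge0.
  - by move=> t; rewrite /wt; case: ifP => _; rewrite ?mul1r ?mulrA.
  - move=> t; rewrite -mulrDr ler_wpM2l //; first exact: ltW.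
    apply: le_trans (expo_line t) _; by rewrite lerD2r.
have E' t : f (z + t *: v) ^+ n + dp_eval P f (z + t *: v) =
    q1.[t] * cexp (1%:C * t) + q2.[t] * cexp (rho%:C * t).
  by rewrite E rE rmorph1 mul1r.
have [r0 H] := real_ratio n4 q10 q20 rho1 rho2 rho0 DF DQ GF GQ E'.
split => //; have := H 0; rewrite E1 scale0r addr0; exact.
Qed.

End Equation.

End Assembly.

(** * Separation of the exponents *)

Section FinalStep.
Context {R : realType}.

Lemma Gr_sum (I : Type) (s : seq I) (A : pred I) (F : I -> R[i] -> R[i]) (x l : R) :
  (forall i, A i -> Gr x l (F i)) -> Gr x l (fun t => \sum_(i <- s | A i) F i t).
Proof.
move=> H; elim: s => [|i s IH].
  exists 0, 0%N; split => // t; by rewrite big_nil cabs0 !mul0r.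
have [Ai|Ai] := boolP (A i).
  by apply: Gr_ext (GrD (H i Ai) IH) => t; rewrite big_cons Ai.
by apply: Gr_ext IH => t; rewrite big_cons (negbTE Ai).
Qed.

Lemma Gr_prod (I : Type) (s : seq I) (e : I -> nat) (F : I -> R[i] -> R[i]) (x l : R) :
  (forall i, Gr ((e i)%:R * x) ((e i)%:R * l) (F i)) ->
  Gr ((\sum_(i <- s) e i)%:R * x) ((\sum_(i <- s) e i)%:R * l) (fun t => \prod_(i <- s) F
    i t).
Proof.
move=> H; elim: s => [|i s IH].
  by rewrite big_nil !mul0r; apply: Gr_ext (Gr_cst 1) => t; rewrite big_nil.
rewrite big_cons natrD !mulrDl.
by apply: Gr_ext (GrM (H i) IH) => t; rewrite big_cons.
Qed.

Variables (m n : nat) (n4 : (4 <= n)%N) (P : diff_poly R m) (hP : (dp_deg P <= n - 3)%N).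
Variables (f : 'rV[R[i]]_m -> R[i]) (Ef : ent f).
Variables (p1 p2 : mpoly m R[i]) (a b : 'rV[R[i]]_m).
Hypotheses (p10 : p1 != 0) (p20 : p2 != 0).
Hypothesis HE : forall z, f z ^+ n + dp_eval P f z =
  evalp p1 z * cexp (dotc a z) + evalp p2 z * cexp (dotc b z).
Variable k : 'I_m.
Hypothesis ak : a 0 k != 0.
Let n0 : (0 < n)%N. Proof. exact: leq_trans n4. Qed.

Lemma good_point : exists z, evalp p1 z != 0 /\ evalp p2 z != 0.
Proof.
have [z] := evalp_neq0 (mulf_neq0 p10 p20).
have -> : evalp (p1 * p2) z = evalp p1 z * evalp p2 z by exact: mevalM.
by rewrite mulf_eq0 negb_or => /andP[]; exists z.
Qed.

Variable rho : R.
Hypotheses (rE : b 0 k / a 0 k = rho%:C) (rho1 : -1 < rho) (rho2 : rho < 1) (rho0 : rho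
  != 0).

Lemma rho_gt0 : 0 < rho.
Proof.
have [z [z1 z2]] := good_point.
by have [] := line_real n4 hP Ef HE ak z1 z2 rE rho1 rho2 rho0.
Qed.

(** [line_real] gives the identity wherever [p1 p2] is nonzero. On the line joining [z] to such a
    point [y], which need not be a coordinate line, [p1 p2] restricts to a nonzero polynomial, and
    [poly_mul_eq0] extends the identity to [z]. *)
Lemma power_equation z : f z ^+ n = evalp p1 z * cexp (dotc a z).
Proof.
have [y [y1 y2]] := good_point; pose u := y - z.
have [q1 H1] := evalp_line p1 z u; have [q2 H2] := evalp_line p2 z u.
have q0 : q1 * q2 != 0.
  apply: contraNneq (mulf_neq0 y1 y2) => q0.
  have zu : z + 1 *: u = y by rewrite scale1r addrCA subrr addr0.
  by have := congr1 (fun q : {poly R[i]} => q.[1]) q0;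
    rewrite hornerM H1 H2 zu horner0 => ->.
pose g t := f (z + t *: u) ^+ n - q1.[t] * (cexp (dotc a z) * cexp (dotc a u * t)).
have hg : hol g.
  apply: holB; first exact/holX/ent_line.
  apply: holM; first exact: hol_poly.
  by apply: holM; [exact: hol_cst | exact: hol_exp].
have gE t : g t = f (z + t *: u) ^+ n - evalp p1 (z + t *: u) * cexp (dotc a (z + t *: u)).
  by rewrite /g H1 -cexpD dotcD dotcZ [t * _]mulrC.
have gz : forall t, g t = 0.
  apply: (poly_mul_eq0 q0 (hol_ccont hg)) => t.
  have [e|] := eqVneq ((q1 * q2).[t]) 0; first by rewrite e mul0r.
  rewrite hornerM mulf_eq0 negb_or H1 H2 => /andP[e1 e2].
  have [_ h] := line_real n4 hP Ef HE ak e1 e2 rE rho1 rho2 rho0.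
  by rewrite gE h subrr mulr0.
by have := gz 0; rewrite gE scale0r addr0 => /eqP; rewrite subr_eq0 => /eqP.
Qed.

(** Unlike in [solution_growth], the exponent is linear, without a maximum. On a line, [f] thus has
    the same rate [1 / n] on both half-planes, and a term of degree [j] the rate [j / n]. *)
Lemma sharp_growth : growth (@rnorm R m) (fun z => complex.Re (dotc a z) / n%:R) f.
Proof.
have r0 := @rnorm_ge0 R m.
apply: (growth_root r0 n0).
apply: growth_ext (fun z => esym (power_equation z)) _.
apply: growth_le (growth_exp_poly p1 (fun z => lexx (complex.Re (dotc a z)))) => // z.
by rewrite mulrCA divff ?mulr1 // pnatr_eq0 -lt0n.
Qed.

Lemma sharp_growth_mpderiv (nu : multinom m) :
  growth (@rnorm R m) (fun z => complex.Re (dotc a z) / n%:R) (mpderiv nu f).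
Proof.
apply: (growth_derive_bound (A := rnorm a / n%:R) (derive_bound_mpderiv nu Ef) _ _
  sharp_growth).
  by rewrite divr_ge0 // rnorm_ge0.
by move=> z w; rewrite mulrAC -mulrDl ler_wpM2r ?invr_ge0 // Re_dotc_lip.
Qed.

Lemma ent_line_growth D z : ent D ->
  growth (@rnorm R m) (fun z => complex.Re (dotc a z) / n%:R) D ->
  Gr n%:R^-1 n%:R^-1 (fun t => D (z + t *: ((a 0 k)^-1 *: delta_mx 0 k))).
Proof.
move=> ED GD; apply: (growth_line (c := complex.Re (dotc a z) / n%:R) GD) => t.
by rewrite dotc_line_a // raddfD /= mulrDl addrC /wt if_same mulrC.
Qed.

(* On a line, P(f) is a combination of the e^(j t / n) with coefficients of
   polynomial growth; separating j / n < rho from j / n > rho shows that it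
   cannot equal q2 e^(rho t). *)
Lemma no_solution_of_small_ratio : (forall j : nat, rho != j%:R / n%:R) -> False.
Proof.
move=> irr; have rp := rho_gt0.
have ni0 : 0 < n%:R^-1 :> R by rewrite invr_gt0 ltr0n.
have [z [z1 z2]] := good_point.
have [q1 [q2 [q10 q20 E1 E2 E]]] := line_equation HE ak z1 z2.
set v := (a 0 k)^-1 *: delta_mx 0 k in E1 E2 E.
pose term i t := evalp (dp_coef P i) (z + t *: v) * f (z + t *: v) ^+ i ord0 *
    \prod_(j < dp_N P) mpderiv (tnth (dp_nu P) j) f (z + t *: v) ^+ i (lift ord0 j).
have hterm i : hol (term i).
  apply: holM; first apply: holM.
  - by have [q Hq] := evalp_line (dp_coef P i) z v; apply: hol_ext (hol_poly q).
  - exact/holX/ent_line.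
  - by apply: hol_prod => j; apply/holX/ent_line/ent_mpderiv.
(* The coefficients have rate 0, and [f] and each of its derivatives have rate [1 / n] on both
   sides. *)
have Gterm i : Gr ((mdeg i)%:R / n%:R) ((mdeg i)%:R / n%:R) (term i).
  have -> : mdeg i = (0 + i ord0 + \sum_(j < dp_N P) i (lift ord0 j))%N.
    by rewrite mdegE big_ord_recl add0n.
  rewrite 2!natrD !mulrDl mul0r.
  apply: GrM; first apply: GrM.
  - by have [q Hq] := evalp_line (dp_coef P i) z v; apply: Gr_ext (Gr_poly q).
  - by apply: GrX; apply: ent_line_growth => //; exact: sharp_growth.
  - apply: Gr_prod => j; apply: GrX; apply: ent_line_growth; first exact: ent_mpderiv.
    exact: sharp_growth_mpderiv.
have Sum t : \sum_(i <- dp_I P) term i t = q2.[t] * cexp (rho%:C * t).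
  have := E2 t; rewrite rE => ->.
  have := HE (z + t *: v); rewrite power_equation => /addrI <-.
  by [].
(* [J] is the least integer with [rho < J / n]; strictness on the other side is the irrationality of
   [rho]. Terms of degree less than [J] form [low], the others [high]. *)
have [J [J0 J1 J2]] : exists J : nat, [/\ (0 < J)%N, J.-1%:R / n%:R < rho & rho < J%:R /
  n%:R].
  have exJ : exists J : nat, rho < J%:R / n%:R.
    exists n; by rewrite divff // pnatr_eq0 -lt0n.
  case: (ex_minnP exJ) => J hJ Jmin; exists J.
  have Jp : (0 < J)%N by rewrite lt0n; apply/eqP => j0; move: hJ;
    rewrite j0 mul0r ltNge (ltW rp).
  split => //; rewrite ltNge le_eqVlt negb_or irr /=; apply/negP => h.
  by have := Jmin _ h; rewrite leqNgt prednK // leqnn.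
pose low t := \sum_(i <- dp_I P | (mdeg i < J)%N) term i t.
pose high t := \sum_(i <- dp_I P | ~~ (mdeg i < J)%N) term i t.
have LH t : low t + high t = q2.[t] * cexp (rho%:C * t) by rewrite -Sum [RHS](bigID (fun
  i => (mdeg i < J)%N)).
have hlow : hol low by exact: hol_sum.
have hhigh : hol high by exact: hol_sum.
have Glow : Gr (J.-1%:R / n%:R) 0 low.
  apply: Gr_sum => i iJ; apply: Gr_le (Gterm i).
    by rewrite ler_pM2r // ler_nat -ltnS prednK.
  by rewrite divr_ge0.
have Ghigh : Gr ((dp_deg P)%:R / n%:R) (J%:R / n%:R) high.
  rewrite /high; under [X in Gr _ _ X]eq_fun do rewrite big_seq_cond.
  apply: Gr_sum => i /andP[iP]; rewrite -leqNgt => iJ; apply: Gr_le (Gterm i).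
    by rewrite ler_pM2r // ler_nat /dp_deg (big_rem i) //= leq_maxl.
  by rewrite ler_pM2r // ler_nat.
have YE t : high t * cexp ((- rho)%:C * t) = q2.[t] - low t * cexp ((- rho)%:C * t).
  have -> : high t = q2.[t] * cexp (rho%:C * t) - low t by rewrite -LH addrAC subrr add0r.
  rewrite mulrBl -mulrA cexpcD subrr mul0r cexp0 mulr1 //.
(* On the right this product equals [q2 - low e^(- rho t)] and has rate 0, since the rate of [low]
   is below [rho]. On the left its rate is [J / n - rho > 0], directly from the terms of [high]. *)
have YZ : forall t, high t * cexp ((- rho)%:C * t) = 0.
  apply: (@Gr_eq0 _ 0 (J%:R / n%:R + - rho)); last by rewrite subr_gt0.
    by apply: holM => //; exact: hol_exp.
  apply: (@Gr_mix _ _ _ ((dp_deg P)%:R / n%:R + - rho) (- rho));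
    last by apply: GrM => //; exact: Gr_exp.
  apply: (Gr_ext (fun t => esym (YE t))); apply: GrB.
    by apply: Gr_le (Gr_poly q2) => //; rewrite oppr_le0 ltW.
  apply: Gr_le (GrM Glow (Gr_exp (- rho))); last by rewrite add0r.
  by rewrite subr_le0 ltW.
(* With [high = 0], the polynomial [q2 = low e^(- rho t)] decays on the right. *)
move/negP: q20; apply; apply/eqP; apply: poly_fun_eq0.
apply: (@Gr_eq0 _ (J.-1%:R / n%:R + - rho) 0); first exact: hol_poly.
  apply: (@Gr_mix _ _ _ 0 (0 + - rho)); last exact: Gr_poly.
  apply: Gr_ext (GrM Glow (Gr_exp (- rho))) => t.
  by have := YE t; rewrite YZ => /eqP; rewrite eq_sym subr_eq0 => /eqP.
by rewrite subr_lt0.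
Qed.

End FinalStep.

Theorem theorem2p2 (R : realType) (m n : nat) (hm : (1 <= m)%N)
  (hn : (4 <= n)%N)
  (P : diff_poly R m) (hP : (dp_deg P <= n - 3)%N)
  (p1 p2 : mpoly m R[i]) (hp1 : p1 != 0) (hp2 : p2 != 0)
  (alpha beta : 'rV[R[i]]_m)
  (halpha : forall k, alpha 0 k != 0)
  (hbeta : forall k, beta 0 k != 0)
  (hratio : forall k, ~ exists q : rat, alpha 0 k / beta 0 k = ratr q) :
  ~ exists f : 'rV[R[i]]_m -> R[i]^o,
      [/\ entire f,
          transcendental f &
          forall z, f z ^+ n + dp_eval P f z =
            evalp p1 z * cexp (dotc alpha z) + evalp p2 z * cexp (dotc beta z)].
Proof.
move=> [f [/entire_ent Ef _ HE]].
pose k : 'I_m := Ordinal hm.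
have n0 : (0 < n)%N by apply: leq_trans hn.
have [r rE] : exists r, r = beta 0 k / alpha 0 k by eexists.
have r0 : r != 0 by rewrite rE mulf_neq0 // invr_eq0.
have rV : alpha 0 k / beta 0 k = r^-1 by rewrite rE invf_div.
have rirr (q : rat) : r <> ratr q.
  by move=> e; apply: (hratio k); exists q^-1; rewrite rV e fmorphV.
have [z [z1 z2]] := good_point hp1 hp2.
have [Imr|Imr] := eqVneq (complex.Im r) 0; last first.
  by apply: (line_nonreal hn hP Ef HE (halpha k) z1 z2); rewrite -rE.
pose rho := complex.Re r.
have rC : r = rho%:C by rewrite [r]complexE Imr mulr0 addr0.
have rho0 : rho != 0 by apply: contraNneq r0 => e; rewrite rC e.
have ratR (q : rat) : rho <> ratr q.
  move=> e; apply: (rirr q); rewrite rC e; exact: fmorph_rat.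
have rho1 : rho != 1 by apply/eqP => e; apply: (ratR 1); rewrite rmorph1.
have rhoN1 : rho != -1 by apply/eqP => e; apply: (ratR (-1)); rewrite rmorphN1.
have irr (j : nat) : rho != j%:R / n%:R.
  by apply/eqP => e; apply: (ratR (j%:R / n%:R)); rewrite fmorph_div !rmorph_nat.
have irrV (j : nat) : rho^-1 != j%:R / n%:R.
  apply/eqP => e; apply: (ratR (j%:R / n%:R)^-1).
  by rewrite fmorphV fmorph_div !rmorph_nat -e invrK.
have [rlt|rge] := ltP `|rho| 1.
  have /ltr_normlP [h1 h2] := rlt.
  by apply: (no_solution_of_small_ratio hn hP Ef hp1 hp2 HE (halpha k) (rho := rho)) =>
    //; [rewrite -rE | lra].
have rgt : 1 < `|rho|.
  rewrite lt_neqAle rge andbT eq_sym eqr_norml ltW // andbT negb_or rho1 //.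
(* Exchanging the two exponential terms replaces [rho] by its inverse, which is irrational as well
   and of modulus less than 1. *)
have HE' y : f y ^+ n + dp_eval P f y =
    evalp p2 y * cexp (dotc beta y) + evalp p1 y * cexp (dotc alpha y).
  by rewrite HE addrC.
have : `|rho^-1| < 1 by rewrite normfV invf_lt1 // (lt_trans ltr01).
move=> /ltr_normlP [h1 h2].
apply: (no_solution_of_small_ratio hn hP Ef hp2 hp1 HE' (hbeta k) (rho := rho^-1)) => //.
- by rewrite rV rC fmorphV.
- lra.
- by rewrite invr_eq0.
Qed.
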